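(* Let $I_0=(a_0,b_0)\subset(0,2^{\tau+1})$, with $a_0,b_0\in\mathbb{Q}$, be an isolating interval for a simple root $\xi$ of a $k$-nomial $p\in\mathbb{Z}[x]$ of magnitude $(n,\tau)$, and let $L$ be a positive integer. For computing an interval $I=(a,b)\subset I_0$, with $a,b\in\mathbb{Q}$, $\xi\in I$ and width less than $2^{-L}$, the algorithm NewRefine (described in the context) needs $O(\operatorname{var}(p,I_0)\cdot(\log n+\log(\tau+L)))$ many iterations and $O(k\cdot\log n\cdot\operatorname{var}(p,I_0)\cdot(\log n+\log(\tau+L)))$ many arithmetic operations over $\mathbb{Q}$.
   Context: A $k$-nomial of magnitude $(n,\tau)$ is a polynomial in $\mathbb{Z}[x]$ of degree at most $n$ with at most $k$ non-vanishing coefficients, each of absolute value less than $2^\tau$; it is given by its sparse representation (exponents and coefficients of the non-zero terms). Here $p$ has degree $n$. An interval is isolating for a root $\xi$ of $p$ if it contains $\xi$ and no other root of $p$. Logarithms are to base $2$. For an interval $I=(a,b)$, $\operatorname{var}(p,I)$ is the number of sign variations in the coefficient sequence (after removing zero entries) of $p_I(x):=(x+1)^n\cdot p\left(\frac{ax+b}{x+1}\right)$. Write $w(I)=b-a$ for the width and $m(I)$ for the midpoint of $I$. For $m\in\mathbb{R}$ and $\delta>0$ let $m[\delta]:=\{m+(i-\lceil k/2\rceil)\cdot\delta : i=0,\ldots,2\lceil k/2\rceil\}$. Algorithm NewRefine. Input: $p$, $I_0$ (isolating the simple real root $\xi$), $L$. It stores a pair $(I,N_I)$, $I=(a,b)$,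 initially $(I_0,4)$, and stops as soon as $w(I)<2^{-L}$. One iteration is as follows. (1) Newton test. Let $\epsilon:=2^{-\lceil 5+\log n\rceil}$, $\xi_1:=a+\frac14 w(I)$, $\xi_2:=a+\frac12 w(I)$, $\xi_3:=a+\frac34 w(I)$; choose arbitrary points $\xi_j^*\in\xi_j[\epsilon\cdot w(I)]$ and let $v_j:=p(\xi_j^* )/p'(\xi_j^* )$ for $j=1,2,3$. For each of the three pairs $i<j$ in $\{1,2,3\}$: approximate $p(\xi_i^* ),p(\xi_j^* ),p'(\xi_i^* ),p'(\xi_j^* )$ with $1,2,4,\ldots$ bits after the binary point until one can verify either (A) $|v_i|,|v_j|>w(I)$ or $|v_i-v_j|<\frac{w(I)}{4n}$, or (B) $|v_i|,|v_j|<2w(I)$ and $|v_i-v_j|>\frac{w(I)}{8n}$. If (A), discard the pair. Otherwise compute an approximation $\tilde\lambda_{i,j}$ of $\lambda_{i,j}:=\xi_i^*+\frac{\xi_j^*-\xi_i^*}{v_i-v_j}\cdot v_i$ with $|\tilde\lambda_{i,j}-\lambda_{i,j}|\le\frac{1}{32N_I}$. If $\tilde\lambda_{i,j}\notin[a,b]$, discard the pair. Otherwise let $\ell_{i,j}:=\left\lfloor\frac{4N_I(\tilde\lambda_{i,j}-a)}{w(I)}\right\rfloor$, $a_{i,j}:=a+\max(0,\ell_{i,j}-1)\cdot\frac{w(I)}{4N_I}$, $b_{i,j}:=a+\min(4N_I,\ell_{i,j}+2)\cdot\frac{w(I)}{4N_I}$. Set $a_{i,j}^*:=a$ if $a_{i,j}=a$,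 and otherwise choose an arbitrary $a_{i,j}^*\in a_{i,j}[\epsilon\cdot\frac{w(I)}{N_I}]$; set $b_{i,j}^*:=b$ if $b_{i,j}=b$, and otherwise choose an arbitrary $b_{i,j}^*\in b_{i,j}[\epsilon\cdot\frac{w(I)}{N_I}]$. If $p(a_{i,j}^* )\cdot p(b_{i,j}^* )<0$, return $I':=(a_{i,j}^*,b_{i,j}^* )$; otherwise discard the pair. The test succeeds if an interval $I'$ is returned for at least one pair (any one may be taken); then $(I,N_I)$ is replaced by $(I',N_I^2)$. Otherwise it fails. (2) Boundary test, if (1) fails. Let $\epsilon:=2^{-\lceil 2+\log n\rceil}$, $m_\ell:=a+\frac{w(I)}{2N_I}$, $m_r:=b-\frac{w(I)}{2N_I}$, and choose arbitrary $m_\ell^*\in m_\ell[\epsilon\cdot\frac{w(I)}{N_I}]$, $m_r^*\in m_r[\epsilon\cdot\frac{w(I)}{N_I}]$. If $p(a)\cdot p(m_\ell^* )<0$, let $I':=(a,m_\ell^* )$; if $p(b)\cdot p(m_r^* )<0$, let $I':=(m_r^*,b)$. In either case the test succeeds and $(I,N_I)$ is replaced by $(I',N_I^2)$. Otherwise it fails. (3) Bisection, if (1) and (2) fail. Choose an arbitrary $m^*\in m(I)\left[\frac{w(I)}{2^{\lceil 2+\log n\rceil}}\right]$. If $p(a)\cdot p(m^* )<0$, replace $(I,N_I)$ by $((a,m^* ),\max(4,\sqrt{N_I}))$; if $p(m^* )=0$, stop and return the interval $[m^*]$ of width zero; otherwise replace $(I,N_I)$ by $((m^*,b),\max(4,\sqrt{N_I}))$.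 For counting arithmetic operations over $\mathbb{Q}$, one may assume that all quantities are computed by exact rational arithmetic (so that the conditions in (1) are decided directly and $\tilde\lambda_{i,j}=\lambda_{i,j}$); each iteration then uses a constant number of evaluations of $p$ and its derivative $p'$.
   Formalization: Assumes p(a_0) and p(b_0) are non-zero and k ≤ n+1 (otherwise NewRefine can lose ξ, be slow or diverge); the factor log n in the operation count is read as max(1, log n); all quantities are computed exactly, so the approximation of λ equals λ. *)

(* Defs.v *)
From mathcomp Require Import all_boot all_order all_algebra.
From mathcomp Require Import reals exp.

Set Implicit Arguments.
Unset Strict Implicit.
Unset Printing Implicit Defensive.

Import Order.TTheory GRing.Theory Num.Theory.
Local Open Scope ring_scope.

Definition log2 (R : realType) (x : R) : R := ln x / ln 2.

Definition knomial (k n tau : nat) (p : {poly int}) : Prop :=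
  [/\ (size p <= n.+1)%N,
      (count (fun c : int => c != 0%R) p <= k)%N
    & forall i, `|p`_i| < 2 ^+ tau].

Definition isolating (R : realType) (p : {poly int}) (a b : rat) (xi : R) :
    Prop :=
  [/\ ratr a < xi < ratr b, root (map_poly intr p) xi
    & forall y : R, ratr a < y < ratr b -> root (map_poly intr p) y -> y = xi].

(* The binomially expanded form of (x+1)^n * p((a*x+b)/(x+1)). *)
Definition itv_poly (n : nat) (p : {poly int}) (a b : rat) : {poly rat} :=
  \sum_(i < n.+1)
    (p`_i)%:~R *: ((a *: 'X + b%:P) ^+ i * ('X + 1) ^+ (n - i)).

Definition sign_variations (s : seq rat) : nat :=
  let t := [seq c <- s | c != 0] in
  count (fun cd : rat * rat => cd.1 * cd.2 < 0) (zip t (behead t)).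

Definition var (n : nat) (p : {poly int}) (a b : rat) : nat :=
  sign_variations (itv_poly n p a b).

(* Cost model: a computation returns its result together with the number of
   operations performed; +, -, *, /, absolute value, comparison, and the floor
   and the square root of the algorithm are one operation each. Arithmetic is
   exact, so no approximations of p, p' and lambda enter. *)
Definition cost (T : Type) : Type := (nat * T)%type.

Definition charge (T : Type) (c : nat) (x : T) : cost T := (c, x).

Definition bind (T U : Type) (m : cost T) (f : T -> cost U) : cost U :=
  let r := f m.2 in ((m.1 + r.1)%N, r.2).

Notation "'let*' x := m 'in' f" := (bind m (fun x => f))
  (at level 200, x name, m at level 100, f at level 200).

Inductive expr : Type :=
| Cst of rat
| Add of expr & expr
| Sub of expr & expr
| Mul of expr & expr
| Div of expr & expr
| Abs of expr.

Coercion Cst : rat >-> expr.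
Arguments Cst _%_ring_scope.
Declare Scope expr_scope.
Bind Scope expr_scope with expr.
Notation "x + y" := (Add x y) : expr_scope.
Notation "x - y" := (Sub x y) : expr_scope.
Notation "x * y" := (Mul x y) : expr_scope.
Notation "x / y" := (Div x y) : expr_scope.
Notation "`| x |" := (Abs x) : expr_scope.

Fixpoint nops (e : expr) : nat :=
  match e with
  | Cst _ => 0
  | Add x y | Sub x y | Mul x y | Div x y => (nops x + nops y).+1
  | Abs x => (nops x).+1
  end.

Fixpoint value (e : expr) : rat :=
  match e with
  | Cst x => x
  | Add x y => value x + value y
  | Sub x y => value x - value y
  | Mul x y => value x * value y
  | Div x y => value x / value y
  | Abs x => `|value x|
  end.

Definition calc (e : expr) : cost rat := charge (nops e) (value e).
Definition test_lt (e f : expr) : cost bool :=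
  charge (nops e + nops f).+1 (value e < value f).
Definition test_eq (e f : expr) : cost bool :=
  charge (nops e + nops f).+1 (value e == value f).

Fixpoint pow_pos (x : rat) (e : BinNums.positive) : cost rat :=
  match e with
  | BinNums.xH => charge 0 x
  | BinNums.xO e' => let* y := pow_pos x e' in calc (y * y)
  | BinNums.xI e' => let* y := pow_pos x e' in calc (x * (y * y))
  end.

Definition pow (x : rat) (e : nat) : cost rat :=
  match bin_of_nat e with
  | BinNums.N0 => charge 0 1
  | BinNums.Npos e' => pow_pos x e'
  end.

Definition sparse (p : {poly int}) : seq (nat * int) :=
  [seq (i, p`_i) | i <- iota 0 (size p) & p`_i != 0].

Definition eval (s : seq (nat * int)) (x : rat) : cost rat :=
  foldr (fun t (acc : cost rat) =>
    let* r := acc in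
    let* y := pow x t.1 in
    calc (Cst t.2%:~R * y + r)) (charge 0 0) s.

Definition eval_deriv (s : seq (nat * int)) (x : rat) : cost rat :=
  foldr (fun t (acc : cost rat) =>
    if t.1 is e.+1 then
      let* r := acc in
      let* y := pow x e in
      calc (Cst t.2%:~R * Cst e.+1%:R * y + r)
    else acc) (charge 0 0) s.

Definition opposite_signs (s : seq (nat * int)) (x y : rat) : cost bool :=
  let* u := eval s x in
  let* v := eval s y in
  test_lt (u * v) (Cst 0).

(* [uphalf k] is the ceiling of k/2; [grid k] indexes the set m[delta]. *)
Definition grid (k : nat) : finType := 'I_((uphalf k).*2.+1).

Definition grid_point (k : nat) (m delta : rat) (i : grid k) : cost rat :=
  calc (m + (Cst (i : nat)%:R - Cst (uphalf k)%:R) * delta).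

(* 2^-ceil(c + log n), [up_log 2 n] being the ceiling of log n. *)
Definition grid_eps (c n : nat) : cost rat := pow (1 / 2) (c + up_log 2 n).

(* The arbitrary choices made in one iteration: the grid points, for each pair
   the outcome of the test (A)/(B) where this is not determined, and the pair
   whose interval is returned. *)
Record pair_choices (k : nat) : Type := PairChoices {
  a_idx : grid k; b_idx : grid k; keep : bool }.

Record choices (k : nat) : Type := Choices {
  x1_idx : grid k; x2_idx : grid k; x3_idx : grid k;
  c12 : pair_choices k; c13 : pair_choices k; c23 : pair_choices k;
  first_pair : 'I_3;
  ml_idx : grid k; mr_idx : grid k;
  m_idx : grid k }.

Record state : Type := State { lo : rat; hi : rat; speed : nat }.

(* p(x)/p'(x); undefined if p'(x) = 0. *)
Definition newton_value (s : seq (nat * int)) (x : rat) : cost (option rat) :=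
  let* d := eval_deriv s x in
  let* z := test_eq d (Cst 0) in
  if z then charge 0 None else
  let* y := eval s x in
  let* v := calc (y / d) in
  charge 0 (Some v).

(* Whether the pair is kept, given c = [keep]. If (A) and (B) both hold, either
   may be verified first, and if neither holds, the test prescribes no outcome:
   both outcomes are then possible. *)
Definition keep_pair (n : nat) (w vi vj : rat) (c : bool) : cost bool :=
  let* i1 := test_lt w `|vi| in
  let* j1 := test_lt w `|vj| in
  let* d1 := test_lt `|vi - vj| (w / (Cst 4 * Cst n%:R)) in
  let* i2 := test_lt `|vi| (Cst 2 * w) in
  let* j2 := test_lt `|vj| (Cst 2 * w) in
  let* d2 := test_lt (w / (Cst 8 * Cst n%:R)) `|vi - vj| in
  let condA := i1 && j1 || d1 in
  let condB := [&& i2, j2 & d2] in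
  charge 0 (if condA == condB then c else condB).

Definition newton_pair (k n : nat) (s : seq (nat * int)) (st : state)
    (c : pair_choices k) (xi xj : rat) (vi vj : option rat) :
    cost (option (rat * rat)) :=
  let a := lo st in let b := hi st in let N := speed st in
  match vi, vj with
  | Some vi, Some vj =>
    let* w := calc (b - a) in
    let* kp := keep_pair n w vi vj (keep c) in
    if ~~ kp then charge 0 None else
    let* lambda := calc (xi + (xj - xi) / (vi - vj) * vi) in
    let* below := test_lt lambda a in
    let* above := test_lt b lambda in
    if below || above then charge 0 None else
    let* q := calc (Cst 4 * Cst N%:R * (lambda - a) / w) in
    let* l := charge 1 (Num.floor q) in
    let* la := charge 2 (Num.max 0 (l - 1)) in
    let* lb := charge 3 (Num.min (4 * N%:R) (l + 2)) in
    let* aij := calc (a + Cst la%:~R * (w / (Cst 4 * Cst N%:R))) in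
    let* bij := calc (a + Cst lb%:~R * (w / (Cst 4 * Cst N%:R))) in
    let* eps := grid_eps 5 n in
    let* delta := calc (eps * (w / Cst N%:R)) in
    let* ea := test_eq aij a in
    let* a' := if ea then charge 0 a else grid_point aij delta (a_idx c) in
    let* eb := test_eq bij b in
    let* b' := if eb then charge 0 b else grid_point bij delta (b_idx c) in
    let* ok := opposite_signs s a' b' in
    charge 0 (if ok then Some (a', b') else None)
  | _, _ => charge 0 None
  end.

Definition newton_test (k n : nat) (s : seq (nat * int)) (c : choices k)
    (st : state) : cost (option (rat * rat)) :=
  let a := lo st in
  let* w := calc (hi st - a) in
  let* eps := grid_eps 5 n in
  let* delta := calc (eps * w) in
  let* xi1 := calc (a + Cst (1 / 4) * w) in
  let* xi2 := calc (a + Cst (1 / 2) * w) in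
  let* xi3 := calc (a + Cst (3 / 4) * w) in
  let* x1 := grid_point xi1 delta (x1_idx c) in
  let* x2 := grid_point xi2 delta (x2_idx c) in
  let* x3 := grid_point xi3 delta (x3_idx c) in
  let* v1 := newton_value s x1 in
  let* v2 := newton_value s x2 in
  let* v3 := newton_value s x3 in
  let* r12 := newton_pair n s st (c12 c) x1 x2 v1 v2 in
  let* r13 := newton_pair n s st (c13 c) x1 x3 v1 v3 in
  let* r23 := newton_pair n s st (c23 c) x2 x3 v2 v3 in
  charge 0 (ohead (pmap id (rot (first_pair c) [:: r12; r13; r23]))).

Definition boundary_test (k n : nat) (s : seq (nat * int)) (c : choices k)
    (st : state) : cost (option (rat * rat)) :=
  let a := lo st in let b := hi st in let N := speed st in
  let* w := calc (b - a) in
  let* eps := grid_eps 2 n in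
  let* delta := calc (eps * (w / Cst N%:R)) in
  let* ml := calc (a + w / (Cst 2 * Cst N%:R)) in
  let* mr := calc (b - w / (Cst 2 * Cst N%:R)) in
  let* ml' := grid_point ml delta (ml_idx c) in
  let* mr' := grid_point mr delta (mr_idx c) in
  let* left := opposite_signs s a ml' in
  let* right := opposite_signs s b mr' in
  charge 0 (if left then Some (a, ml')
            else if right then Some (mr', b) else None).

(* The integer square root is exact here: the values taken by [speed] in a run
   are of the form 2^(2^i) with i >= 1. *)
Definition sqrtn (m : nat) : nat := \max_(i < m.+1 | (i ^ 2 <= m)%N) i.

Definition slow_down (N : nat) : cost nat := charge 2 (maxn 4 (sqrtn N)).

Definition bisection (k n : nat) (s : seq (nat * int)) (c : choices k)
    (st : state) : cost (state + rat) :=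
  let a := lo st in let b := hi st in
  let* w := calc (b - a) in
  let* mid := calc ((a + b) / Cst 2) in
  let* eps := grid_eps 2 n in
  let* delta := calc (w * eps) in
  let* m := grid_point mid delta (m_idx c) in
  let* left := opposite_signs s a m in
  let* N := slow_down (speed st) in
  if left then charge 0 (inl (State a m N)) else
  let* y := eval s m in
  let* z := test_eq y (Cst 0) in
  charge 0 (if z then inr m else inl (State m b N)).

Definition iteration (k n : nat) (s : seq (nat * int)) (c : choices k)
    (st : state) : cost (state + rat) :=
  let* r := newton_test n s c st in
  if r is Some I' then
    charge 1 (inl (State I'.1 I'.2 (speed st ^ 2)%N)) else
  let* r := boundary_test n s c st in
  if r is Some I' then
    charge 1 (inl (State I'.1 I'.2 (speed st ^ 2)%N)) else
  bisection n s c st.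

(* The open interval (a,b), or the interval [m] of width zero. *)
Inductive output : Type :=
| Interval of rat & rat
| Exact of rat.

(* [run n s width ch t st it ops o]: started in state st with the choices
   ch t, ch (t+1), ..., the loop stops after it iterations and ops operations
   and returns o. *)
Inductive run (k n : nat) (s : seq (nat * int)) (width : rat)
    (ch : nat -> choices k) :
    nat -> state -> nat -> nat -> output -> Prop :=
| run_stop t st c :
    test_lt (hi st - lo st) width = (c, true) ->
    run n s width ch t st 0 c (Interval (lo st) (hi st))
| run_exact t st c d m :
    test_lt (hi st - lo st) width = (c, false) ->
    iteration n s (ch t) st = (d, inr m) ->
    run n s width ch t st 1 (c + d) (Exact m)
| run_step t st c d st' it ops o :
    test_lt (hi st - lo st) width = (c, false) ->
    iteration n s (ch t) st = (d, inl st') ->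
    run n s width ch t.+1 st' it ops o ->
    run n s width ch t st it.+1 (c + d + ops) o.

Definition NewRefine (k n : nat) (p : {poly int}) (a0 b0 : rat) (L : nat)
    (ch : nat -> choices k) (it ops : nat) (o : output) : Prop :=
  exists c width ops', [/\ pow (1 / 2) L = (c, width),
    run n (sparse p) width ch 0 (State a0 b0 4) it ops' o
    & ops = (c + ops')%N].

Definition correct_output (R : realType) (a0 b0 : rat) (xi : R) (L : nat)
    (o : output) : Prop :=
  match o with
  | Interval a b =>
    [/\ a0 <= a, b <= b0, ratr a < xi < ratr b & b - a < 2 ^- L]
  | Exact m => a0 < m < b0 /\ xi = ratr m
  end.

(* Main.v *)
(* Call an iteration a success if the Newton or the boundary test succeeds: the
   width w drops to at most w/N and N is squared. A bisection leaves at most 3/4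
   of w and replaces N by max(4, sqrt N). Compare w with the distances |z - xi|
   of the complex roots z of p. A root within min(xi - a0, b0 - xi)/(16(n+3)) of
   xi contributes to var(p,I0): multiplying a polynomial by the linear or
   quadratic factor of such a root or conjugate pair adds one or two sign
   variations to p_I (a discrete Rolle argument). So at most var(p,I0) distances
   matter, the distance 0 of xi among them.
   Let lo < hi be consecutive distances and v the number of roots within lo.
   As p'/p is the sum of the 1/(x - z), for lo (c n N)^B <= w <= hi/(c n N) the
   value v p(x)/p'(x) approximates x - xi up to a small multiple of w/N at every
   sample point x that is not within 8 lo of xi. If it does so at both points of
   a pair, Newton's test succeeds, unless xi is near an end of the interval,
   where the boundary test does. A sample point within 8 lo of xi can spoil this,
   but the sample points of 41 consecutive iterations lie on a common grid of
   step at least 16 lo, so it is always the same point, and that point forces too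
   few bisections to prevent an increase of N over the 41 iterations.
   With N = 2^(2^e), a potential c log l + |log l - e - c'|, where l is
   log(w/lo), then drops steadily, so that w passes such a range in
   O(log n + log(tau + L)) iterations. *)
Require Import Defs.
From mathcomp Require Import all_boot all_order all_algebra.
From mathcomp Require Import reals exp complex.
From mathcomp Require boolp.
From mathcomp Require Import ring lra zify.

Set Implicit Arguments.
Unset Strict Implicit.
Unset Printing Implicit Defensive.

Import Order.TTheory GRing.Theory Num.Theory.
Local Open Scope ring_scope.

(** * Alternations and sign variations *)

(** No single iteration is sure to make progress: the grid choices are arbitrary, and a sample point
    G may stay close to xi for many iterations. The number 41 comes from counting inside such a
    window. A pair containing an inaccurate G succeeds only if |v p(G)/p'(G)| is comparable with the
    cell width; as G is fixed and the width shrinks at least fourfold at each success, this happens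
    at most 9 times. Before, between and after these lucky successes there are at most two
    bisections: a bisection needs G at relative position about 1/4 or 3/4, an integer equation
    forbids this three times in a row, and an accurate success in between puts xi near the middle
    third, away from the quarters. Hence there are at most 2 * 9 + 2 = 20 bisections, and every
    bisection costs 2 in e compared with a success: 41 - 2 * 20 = 1. The integer equation needs a
    grid radius of at most 3/128, which holds from degree 3 on. In smaller degrees no other root is
    close to xi, because such a root would come with its conjugate; the cluster is then xi alone,
    every sample point is accurate, and no bisection occurs in the range considered. *)

Section Alternation.
Variable F : realFieldType.
Implicit Types (f g : nat -> F) (s : F) (q i j : nat).

(** Values of signs s, -s, s, ... at q+1 indices from i on, hence q sign changes; of [s] only the
    sign matters. Non-decreasing indices suffice, since opposite signs cannot share an index. Unlike
    a count after deletion of zeros, this form passes at once to any sequence with the same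
    signs. *)
Fixpoint alternates f s i q : Prop :=
  if q is q'.+1 then
    exists2 j, (i <= j)%N & 0 < s * f j /\ alternates f (- s) j q'
  else exists2 j, (i <= j)%N & 0 < s * f j.

Lemma alternates_le f s i j q :
  (j <= i)%N -> alternates f s i q -> alternates f s j q.
Proof.
by case: q => [|q] ji /= [m im H]; exists m => //; apply: leq_trans im.
Qed.

Lemma eq_sign_alternates f g s i q :
  (forall t j, 0 < t * f j -> 0 < t * g j) ->
  alternates f s i q -> alternates g s i q.
Proof.
move=> fg; elim: q s i => [|q IH] s i /= [j ij].
  by move=> /fg fj; exists j.
by case=> /fg fj /IH alt; exists j.
Qed.

Lemma alternatesN f s i q :
  alternates f s i q -> alternates (fun j => - f j) (- s) i q.
Proof.
elim: q s i => [|q IH] s i /= [j ij]; first by exists j; rewrite ?mulrNN.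
by case=> fj /IH alt; exists j; rewrite ?mulrNN.
Qed.

Lemma alternates_bump f s i q :
  ~~ (0 < s * f i) -> alternates f s i q -> alternates f s i.+1 q.
Proof.
move=> fi; case: q => [|q] [j ij H]; exists j => //; rewrite ltn_neqAle ij andbT;
  apply/eqP => E; move: fi; rewrite E ?H//; by case: H => ->.
Qed.

Lemma alternates_shift f s i q :
  alternates f s i.+1 q -> alternates (fun j => f j.+1) s i q.
Proof.
elim: q s i => [|q IH] s i /= [[|j]] // ij; first by exists j.
by case=> fj alt; exists j => //; split=> //; exact: IH.
Qed.

Lemma telescope_pos (d y : nat -> F) i j :
  (forall m, d m = y m.+1 - y m) -> y i < y j -> (i <= j)%N ->
  exists2 m, (i <= m < j)%N & 0 < d m.
Proof.
move=> dE yij; elim: j yij => [|j IH] yj.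
  by rewrite leqn0 => /eqP i0; move: yj; rewrite i0 ltxx.
rewrite leq_eqVlt => /orP[/eqP ij|]; first by move: yj; rewrite ij ltxx.
rewrite ltnS => ij.
have [yj0|yj0] := ltP (y i) (y j).
  have [m /andP[im mj] dm] := IH yj0 ij; exists m => //.
  by rewrite im (leq_trans mj).
exists j; first by rewrite ltnSn ij.
by rewrite dE subr_gt0; apply: le_lt_trans yj0 yj.
Qed.

(* Discrete Rolle: the differences of a finitely supported sequence have one
   more alternation than the sequence itself. *)
Lemma alternates_diff (d y : nat -> F) q s B :
  y 0%N = 0 -> (forall m, d m = y m.+1 - y m) ->
  (forall m, (B <= m)%N -> y m = 0) ->
  alternates (fun j => y j.+1) s 0 q -> alternates d s 0 q.+1.
Proof.
move=> y0 dS yB.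
have drop t i j : (i <= j)%N -> t * y i < t * y j ->
    exists2 m, (i <= m < j)%N & 0 < t * d m.
  move=> ij yij.
  by apply: (@telescope_pos (fun m => t * d m) (fun m => t * y m)) => // m;
    rewrite dS mulrBr.
suff main t i : t * y i <= 0 ->
    alternates (fun j => y j.+1) t i q -> alternates d t i q.+1.
  by apply: main; rewrite y0 mulr0.
elim: q t i => [|q IH] t i yi [j ij].
  move=> yj.
  have [m /andP[im mj] dm] := drop t i j.+1 (leqW ij) (le_lt_trans yi yj).
  exists m => //; split=> //.
  (* The additional alternation: beyond [B] the sequence is 0 again, so after its last excursion it
     has to move back. *)
  have [||m' /andP[jm' _] dm'] := drop (- t) j.+1 (maxn j.+1 B).
  - exact: leq_maxl.
  - by rewrite [y (maxn _ _)]yB ?leq_maxr// mulr0 mulNr oppr_lt0.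
  by exists m' => //; apply: leq_trans jm'; apply: ltnW.
move=> [yj alt].
have [m /andP[im mj] dm] := drop t i j.+1 (leqW ij) (le_lt_trans yi yj).
exists m => //; split=> //.
apply: (@alternates_le _ _ j.+1); first exact: ltnW.
apply: IH; first by rewrite mulNr oppr_le0 ltW.
by apply: alternates_bump alt; rewrite mulNr oppr_gt0 -leNgt ltW.
Qed.

End Alternation.

Section SignVariations.
Variable F : realFieldType.
Implicit Types (x y s : F) (l : seq F).

(** The count of [sign_variations] without filtering: [x] is the last nonzero entry met so far,
    which makes induction on the list possible. *)
Fixpoint variations_from x l : nat :=
  if l is y :: l' then
    if y == 0 then variations_from x l'
    else ((x * y < 0)%R + variations_from y l')%N
  else 0%N.

Lemma alternates_variations x l s q :
  0 < s * x -> alternates (nth 0 l) (- s) 0 q -> (q < variations_from x l)%N.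
Proof.
elim: l x s q => [|y l IH] x s q sx.
  by case: q => [|q] [j _]; rewrite nth_nil mulr0 ltxx // => -[].
have shift t q' : ~~ (0 < t * y) -> alternates (nth 0 (y :: l)) t 0 q' ->
    alternates (nth 0 l) t 0 q'.
  move=> ty alt; apply: (@alternates_shift _ (nth 0 (y :: l))).
  exact: alternates_bump alt.
move=> alt /=; have [y0|y0] := eqVneq y 0.
  by apply: IH sx _; apply: shift alt; rewrite y0 mulr0 ltxx.
have [xy|] := ltP (x * y) 0.
  rewrite add1n ltnS; case: q alt => [//|q] [j _ [_ alt]].
  have sy : 0 < - s * y.
    by move: sx xy; have [s0|s0|->] := ltrgt0P s; rewrite ?mul0r ?ltxx // => sx xy;
      [have x0 : 0 < x by rewrite -(pmulr_rgt0 _ s0)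
      |have x0 : x < 0 by rewrite -(nmulr_rgt0 _ s0)]; nra.
  apply: (IH y (- s)) => //; rewrite opprK; rewrite opprK in alt.
  have {}alt : alternates (nth 0 (y :: l)) s 0 q by apply: alternates_le alt.
  by apply: shift alt; rewrite -leNgt; lra.
move=> xy; rewrite add0n; have sy : 0 < s * y.
  move: sx xy; have [s0|s0|->] := ltrgt0P s; rewrite ?mul0r ?ltxx // => sx xy;
      [have x0 : 0 < x by rewrite -(pmulr_rgt0 _ s0)
      |have x0 : x < 0 by rewrite -(nmulr_rgt0 _ s0)].
  - by apply: mulr_gt0 => //; rewrite lt_neqAle eq_sym y0 -(pmulr_rge0 _ x0).
  - by rewrite nmulr_rgt0// lt_neqAle y0 -(nmulr_rge0 _ x0).
by apply: (IH y s) => //; apply: shift alt; rewrite -leNgt; lra.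
Qed.

End SignVariations.

Lemma sign_variations_cons (x y : rat) (l : seq rat) : x != 0 ->
  sign_variations (x :: y :: l) =
  if y == 0 then sign_variations (x :: l)
  else ((x * y < 0)%R + sign_variations (y :: l))%N.
Proof. by move=> x0; rewrite /sign_variations /= x0; case: eqP. Qed.

Lemma sign_variations_variations_from (F : realFieldType) (x : rat) (l : seq rat) :
  x != 0 ->
  sign_variations (x :: l) =
    variations_from (ratr x : F) (map ratr l).
Proof.
elim: l x => [|y l IH] x x0; first by rewrite /sign_variations /= x0.
rewrite sign_variations_cons//= fmorph_eq0; case: eqP => [_|/eqP y0]; first exact: IH.
by rewrite IH// -rmorphM ltrq0.
Qed.

Lemma alternates_sign_variations (F : realFieldType) (l : seq rat) (s : F) q :
  alternates (fun j => ratr (nth 0 l j)) s 0 q -> (q <= sign_variations l)%N.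
Proof.
elim: l s q => [|y l IH] s q.
  by case: q => // q [j _ [+ _]] /=; rewrite nth_nil rmorph0 mulr0 ltxx.
move=> alt; have [ys|ys] := boolP (0 < s * ratr y).
  case: q alt => // q [j _ [_ alt]].
  have y0 : y != 0 by apply/eqP => y0; move: ys; rewrite y0 rmorph0 mulr0 ltxx.
  rewrite (sign_variations_variations_from F)//.
  apply: (@alternates_variations _ _ _ s) => //.
  have : alternates (fun j => ratr (nth 0 l j)) (- s) 0 q.
    apply: (@alternates_shift _ (fun j => ratr (nth 0 (y :: l) j))).
    apply: alternates_bump; first by rewrite mulNr oppr_gt0 -leNgt ltW.
    exact: alternates_le alt.
  apply: eq_sign_alternates => t m; have [ml|ml] := ltnP m (size l).
    by rewrite (nth_map 0).
  by rewrite !nth_default ?size_map// rmorph0.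
have : (q <= sign_variations l)%N.
  apply: (IH s); apply: (@alternates_shift _ (fun j => ratr (nth 0 (y :: l) j))).
  exact: alternates_bump alt.
move/leq_trans; apply; have [->|y0] := eqVneq y 0; first by [].
rewrite /sign_variations /= y0; case: [seq c <- l | c != 0] => //= z t.
exact: leq_addl.
Qed.

(** * Factors that add sign variations *)

Section VariationFactors.
Variable F : realFieldType.
Implicit Types (p : {poly F}) (s : F).

(** Once the coefficient of index j is scaled by (C/A)^j, multiplication by A X - C amounts to
    taking differences, up to sign and positive factors, so discrete Rolle gives one more
    alternation. *)
Lemma alternates_mul_linear (A C : F) p s q : 0 < A -> 0 < C ->
  alternates (fun j => p`_j) s 0 q ->
  alternates (fun j => ((A *: 'X - C%:P) * p)`_j) (- s) 0 q.+1.
Proof.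
move=> A0 C0 alt.
pose y j := if j is i.+1 then (C / A) ^+ i * p`_i else 0.
pose d m := y m.+1 - y m.
have r0 i : 0 < (C / A) ^+ i by apply/exprn_gt0/divr_gt0.
have : alternates d s 0 q.+1.
  apply: (@alternates_diff _ d y q s (size p).+1) => //.
  - by case=> // m; rewrite ltnS => pm; rewrite /y nth_default// mulr0.
  apply: eq_sign_alternates alt => t j tj /=.
  by rewrite mulrCA mulr_gt0.
move/alternatesN; apply: eq_sign_alternates => t j.
have -> : - d j = (C / A) ^+ j / C * ((A *: 'X - C%:P) * p)`_j.
  rewrite mulrBl coefB -scalerAl coefZ coefXM coefCM /d /y.
  case: j => [|j] /=; first by rewrite expr0; field; rewrite ?lt0r_neq0.
  by rewrite exprS; field; rewrite ?lt0r_neq0.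
by rewrite mulrCA pmulr_rgt0// divr_gt0.
Qed.

(** The pair (k_i, k_(i+1)) of the solution of C k_(i+2) = 2 M k_(i+1) - A k_i with k_0 = 0 and k_1
    = 1. If M^2 < A C and cos t = M / sqrt(A C), this is sin(i t) / sin t up to a geometric
    factor. *)
Fixpoint kernel (M A C : F) (i : nat) : F * F :=
  if i is i'.+1 then
    let: (x, y) := kernel M A C i' in (y, (2 * M * y - A * x) / C)
  else (0, 1).

Lemma kernelS1 M A C i : (kernel M A C i.+1).1 = (kernel M A C i).2.
Proof. by rewrite /=; case: (kernel M A C i). Qed.

Lemma kernelS2 M A C i : (kernel M A C i.+1).2 =
  (2 * M * (kernel M A C i).2 - A * (kernel M A C i).1) / C.
Proof. by rewrite /=; case: (kernel M A C i). Qed.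

(** In the oscillating case the hypothesis reads tan t <= 1/(2m), which keeps sin(i t) positive for
    0 < i <= m. Instead of trigonometry, the induction carries a lower bound on the ratio:
    k_(j+1)/k_j >= (M/C) 2j/(2j-1), a relaxation of the ratio (M/C)(j+1)/j of the double-root case A
    C = M^2. *)
Lemma kernel_gt0 (M A C : F) m i : 0 < M -> 0 < A -> 0 < C ->
  A * C * (4 * m%:R ^+ 2) <= M ^+ 2 * (4 * m%:R ^+ 2 + 1) ->
  (i < m)%N -> 0 < (kernel M A C i).2.
Proof.
move=> M0 A0 C0 H.
suff : forall j, (j <= m)%N -> (0 < j)%N -> 0 < (kernel M A C j).1 /\
    (M / C) * (2 * j%:R) * (kernel M A C j).1 <=
      (2 * j%:R - 1) * (kernel M A C j).2.
  move=> main im; have [] := main i.+1 im isT.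
  by rewrite kernelS1.
elim=> // j IH jm _; case: j IH jm => [|j] IH jm.
  rewrite /=; split=> //; have -> : (2 * M * 1 - A * 0) / C = 2 * (M / C).
    by field; rewrite lt0r_neq0.
  have : 0 < M / C by apply: divr_gt0.
  lra.
have [k1 k2] := IH (ltnW jm) isT.
move: k1 k2; rewrite (kernelS1 _ _ _ j.+1) (kernelS2 _ _ _ j.+1).
move: (kernel M A C j.+1).1 (kernel M A C j.+1).2 => x y x0.
have -> : j.+2%:R = j.+1%:R + 1 :> F by rewrite -natr1.
set t := j.+1%:R; have t1 : 1 <= t by rewrite ler1n.
move=> k2; have y0 : 0 < y.
  have : 0 < (2 * t - 1) * y.
    by apply: lt_le_trans k2; rewrite !mulr_gt0 ?invr_gt0//; lra.
  by rewrite pmulr_rgt0//; lra.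
split=> //.
have tm : t <= m%:R by rewrite ler_nat ltnW.
have m1 : 1 <= m%:R :> F by lra.
have {}H : A * C * (4 * t ^+ 2) <= M ^+ 2 * (4 * t ^+ 2 + 1).
  have : A * C <= M ^+ 2 * (1 + (4 * m%:R ^+ 2)^-1).
    have e : 0 < 4 * m%:R ^+ 2 :> F by nra.
    rewrite -(ler_pM2r e) (le_trans H)//.
    rewrite le_eqVlt; apply/orP; left; apply/eqP.
    by field; rewrite lt0r_neq0//; lra.
  have : (4 * m%:R ^+ 2)^-1 <= (4 * t ^+ 2)^-1.
    by rewrite lef_pV2 ?posrE; nra.
  set a := _^-1; set b := (4 * t ^+ 2)^-1 => ab AC.
  have tb : 4 * t ^+ 2 * b = 1 by rewrite /b mulfV//; nra.
  have AC2 : A * C <= M ^+ 2 * (1 + b) by nra.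
  have : A * C * (4 * t ^+ 2) <= M ^+ 2 * (1 + b) * (4 * t ^+ 2).
    by apply: ler_wpM2r => //; nra.
  have -> : M ^+ 2 * (1 + b) * (4 * t ^+ 2) = M ^+ 2 * (4 * t ^+ 2 + 4 * t ^+ 2 * b) by ring.
  by rewrite tb.
have {}k2 : M * (2 * t) * x <= (2 * t - 1) * y * C.
  move: k2; rewrite -(ler_pM2r C0); congr (_ <= _); field; exact: lt0r_neq0.
have -> : 2 * (t + 1) - 1 = 2 * t + 1 by ring.
rewrite -(ler_pM2r C0) -(ler_pM2r M0).
have -> : M / C * (2 * (t + 1)) * y * C * M = M ^+ 2 * (2 * (t + 1)) * y.
  by field; exact: lt0r_neq0.
have -> : (2 * t + 1) * ((2 * M * y - A * x) / C) * C * M =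
          (2 * t + 1) * (2 * M ^+ 2 * y - A * M * x) by field; exact: lt0r_neq0.
have t0 : 0 < 2 * t by lra.
rewrite -(ler_pM2r t0).
have h1 : (2 * t + 1) * A * (M * (2 * t) * x) <= (2 * t + 1) * A * ((2 * t - 1) * y * C).
  by apply: ler_wpM2l k2; apply: mulr_ge0; lra.
have h2 : y * (A * C * (4 * t ^+ 2)) <= y * (M ^+ 2 * (4 * t ^+ 2 + 1)).
  by apply: ler_wpM2l H; lra.
have AC0 : 0 < A * C by apply: mulr_gt0.
have h3 : (2 * t + 1) * A * ((2 * t - 1) * y * C) <= M ^+ 2 * (4 * t ^+ 2) * y.
  have -> : (2 * t + 1) * A * ((2 * t - 1) * y * C) = (A * C * (4 * t ^+ 2 - 1)) * y
     by ring.
  apply: ler_wpM2r; first exact: ltW.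
  have [le|gt] := lerP (M ^+ 2) (A * C); first by lra.
  have : A * C * (4 * t ^+ 2 - 1) <= M ^+ 2 * (4 * t ^+ 2 - 1).
    by apply: ler_wpM2r; [nra|exact: ltW].
  have : 0 <= M ^+ 2 by exact: sqr_ge0.
  lra.
by have := le_trans h1 h3; lra.
Qed.

(* With k in the kernel of the recurrence and W_j = k_j a_(j+1) - k_(j+1) a_j,
   the product has the coefficients b_j with (C/A)^(j+1) W_(j+1) - (C/A)^j W_j
   a positive multiple of b_j, and W_j is a positive multiple of
   a_(j+1)/k_(j+1) - a_j/k_j: discrete Rolle applies twice. *)
Lemma alternates_mul_quadratic (M A C : F) p s q : 0 < M -> 0 < A -> 0 < C ->
  A * C * (4 * (size p).+3%:R ^+ 2) <= M ^+ 2 * (4 * (size p).+3%:R ^+ 2 + 1) ->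
  alternates (fun j => p`_j) s 0 q ->
  alternates (fun j => ((A *: 'X^2 - (2 * M) *: 'X + C%:P) * p)`_j) s 0 q.+2.
Proof.
move=> M0 A0 C0 H alt.
pose k i := (kernel M A C i).1.
have kS i : C * k i.+2 = 2 * M * k i.+1 - A * k i.
  rewrite /k /=; case: (kernel M A C i) => x y /=.
  by field; exact: lt0r_neq0.
have k0 i : (i <= (size p).+2)%N -> 0 < k i.+1.
  move=> ip; have := kernel_gt0 M0 A0 C0 H (ip : (i < (size p).+3)%N).
  by rewrite /k /=; case: (kernel M A C i).
(* The shift by two places makes [Y] and [W] vanish at 0, where the discrete Rolle argument
   starts. *)
pose a i := if i is i'.+2 then p`_i' else 0.
have a0 i : (size p < i.-1)%N -> a i = 0.
  by case: i => [|[|i]] //= pi; rewrite nth_default// ltnW.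
pose Y j := a j.+1 / k j.+1.
pose z m := Y m.+1 - Y m.
have altz : alternates z s 0 q.+1.
  apply: (@alternates_diff _ z Y q s (size p).+1) => //.
  - by rewrite /Y mul0r.
  - by move=> m pm; rewrite /Y a0// mul0r.
  apply: eq_sign_alternates alt => t j tj /=.
  rewrite /Y /=; rewrite mulrA divr_gt0// k0//.
  have [//|jp] := leqP j (size p).+1.
  by move: tj; rewrite nth_default ?mulr0 ?ltxx//; apply: ltnW; apply: ltnW.
pose W j := (C / A) ^+ j * (k j * a j.+1 - k j.+1 * a j).
pose d m := W m.+1 - W m.
have r0 i : 0 < (C / A) ^+ i by apply/exprn_gt0/divr_gt0.
have : alternates d s 0 q.+2.
  apply: (@alternates_diff _ d W q.+1 s (size p).+3) => //.
  - by rewrite /W /a !mulr0 subr0 mulr0.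
  - by move=> m pm; rewrite /W !a0 ?mulr0 ?subr0 ?mulr0//; lia.
  apply: eq_sign_alternates altz => t j.
  rewrite /z /Y /W mulrCA => tj; rewrite pmulr_rgt0//.
  have [jp|jp] := leqP j (size p).+1; last first.
    have e1 : a j.+1 = 0 by apply: a0; exact: ltnW jp.
    have e2 : a j.+2 = 0 by apply: a0; exact: ltnW (ltnW jp).
    by move: tj; rewrite e1 e2 !mul0r subr0 mulr0 ltxx.
  have k1 : 0 < k j.+1 by apply: k0; exact: leqW jp.
  have k2 : 0 < k j.+2 by apply: k0; exact: jp.
  move: tj => /(mulr_gt0 (mulr_gt0 k1 k2)) tj.
  rewrite (lt_le_trans tj)// le_eqVlt; apply/orP; left; apply/eqP.
  move: (k j.+1) (k j.+2) (a j.+1) (a j.+2) k1 k2 => x y u v x0 y0.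
  by field; rewrite ?lt0r_neq0.
apply: eq_sign_alternates => t j.
have bj : ((A *: 'X^2 - (2 * M) *: 'X + C%:P) * p)`_j =
    A * a j - 2 * M * a j.+1 + C * a j.+2.
  rewrite mulrDl mulrBl coefD coefB -!scalerAl !coefZ coefXM coefCM coefXnM.
  by case: j => [|[|j]] //=; rewrite subn2.
have dj : d j = (C / A) ^+ j * k j.+1 / A * (A * a j - 2 * M * a j.+1 + C * a j.+2).
  have := kS j; rewrite /d /W exprS => kSj.
  have e : k j = (2 * M * k j.+1 - C * k j.+2) / A.
    by rewrite kSj; field; exact: lt0r_neq0.
  by rewrite e; field; rewrite lt0r_neq0.
rewrite bj dj => tj; have [jp|jp] := leqP j (size p).+1; last first.
  have e0 : a j = 0 by apply: a0; case: j jp {tj bj dj}.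
  have e1 : a j.+1 = 0 by apply: a0; exact: ltnW jp.
  have e2 : a j.+2 = 0 by apply: a0; exact: ltnW (ltnW jp).
  by move: tj; rewrite e0 e1 e2 !mulr0 subr0 addr0 !mulr0 ltxx.
move: tj; rewrite mulrCA pmulr_rgt0// divr_gt0// mulr_gt0// k0//; exact: leqW.
Qed.

End VariationFactors.

(** * The transformed polynomial as a product over the roots *)

Definition moebius (F : comNzRingType) (n : nat) (p : {poly F}) (a b : F) : {poly F} :=
  \sum_(i < n.+1) p`_i *: ((a *: 'X + b%:P) ^+ i * ('X + 1) ^+ (n - i)).

Lemma itv_polyE n p a b : itv_poly n p a b = moebius n (map_poly intr p) a b.
Proof. by apply: eq_bigr => i _; rewrite coef_map. Qed.

Lemma map_moebius (F G : comNzRingType) (f : {rmorphism F -> G}) n p a b :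
  map_poly f (moebius n p a b) = moebius n (map_poly f p) (f a) (f b).
Proof.
rewrite /moebius rmorph_sum /=; apply: eq_bigr => i _.
rewrite map_polyZ rmorphM !rmorphXn !rmorphD coef_map /=.
by rewrite map_polyZ map_polyX map_polyC rmorph1.
Qed.

Lemma size_moebius (F : comNzRingType) n (p : {poly F}) a b :
  (size (moebius n p a b) <= n.+1)%N.
Proof.
apply: (leq_trans (size_sum _ _ _)); apply/bigmax_leqP => i _.
apply: leq_trans (size_scale_leq _ _) _.
apply: leq_trans (size_polyMleq _ _) _.
have lin (q : {poly F}) : (size q <= 2)%N -> forall j, (size (q ^+ j) <= j.+1)%N.
  move=> q2; elim=> [|j IH]; first by rewrite expr0 size_poly1.
  rewrite exprS; apply: leq_trans (size_polyMleq _ _) _.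
  by rewrite -subn1 leq_subLR; apply: leq_trans (leq_add q2 IH) _.
have s1 : (size (a *: 'X + b%:P)%R <= 2)%N.
  apply: leq_trans (size_polyD _ _) _; rewrite geq_max.
  rewrite (leq_trans (size_scale_leq _ _)) ?size_polyX//.
  exact: leq_trans (size_polyC_leq1 _) _.
have s2 : (size ('X + 1 : {poly F})%R <= 2)%N.
  by apply: leq_trans (size_polyD _ _) _; rewrite size_polyX size_poly1.
rewrite -subn1 leq_subLR; apply: leq_trans (leq_add (lin _ s1 i) (lin _ s2 (n - i)%N)) _.
by have := ltn_ord i; lia.
Qed.

(** Homogenisation is multiplicative: a root z contributes the factor (a X + b) - z (X + 1), and the
    degree bound rises by one with each factor. *)
Lemma moebius_mul_factor (F : comNzRingType) n (p : {poly F}) z a b :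
  (size p <= n.+1)%N ->
  moebius n.+1 (('X - z%:P) * p) a b =
  ((a - z) *: 'X + (b - z)%:P) * moebius n p a b.
Proof.
move=> pn; set U := a *: 'X + b%:P; set W := 'X + 1 : {poly F}.
have -> : (a - z) *: 'X + (b - z)%:P = U - z *: W.
  by rewrite /U /W scalerBl polyCB scalerDr alg_polyC opprD addrACA.
have eX : moebius n.+1 ('X * p) a b = U * moebius n p a b.
  rewrite /moebius big_ord_recl coefXM scale0r add0r mulr_sumr.
  by apply: eq_bigr => i _; rewrite coefXM /= subSS exprS -scalerAr mulrA.
have eC : moebius n.+1 (z%:P * p) a b = z *: W * moebius n p a b.
  rewrite /moebius big_ord_recr /= coefCM [p`_n.+1]nth_default// mulr0 scale0r addr0.
  rewrite mulr_sumr; apply: eq_bigr => i _; rewrite coefCM /=.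
  have -> : (n.+1 - i = (n - i).+1)%N by rewrite subSn// -ltnS.
  rewrite [_ ^+ (n - i).+1]exprS.
  rewrite -/W -/U; move: (U ^+ i) (W ^+ (n - i)) => X Y.
  by rewrite -!mul_polyC polyCM; ring.
rewrite [RHS]mulrBl -eX -eC /moebius -sumrB; apply: eq_bigr => i _.
by rewrite -scalerBl mulrBl coefB.
Qed.

Lemma moebius0 (F : comNzRingType) (p : {poly F}) a b : moebius 0 p a b = (p`_0)%:P.
Proof. by rewrite /moebius big_ord1 !expr0 mulr1 alg_polyC. Qed.

Section RootsVariations.
Variable R : rcfType.
Local Notation toC := (real_complex R).
Local Notation normc := Normc.normc.

Lemma normc_ltP (x y d : R) : 0 <= d ->
  (normc (Complex x y) < d) = (x ^+ 2 + y ^+ 2 < d ^+ 2).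
Proof.
by move=> d0; rewrite -(ltr_pXn2r (_ : 0 < 2)%N) ?nnegrE ?sqrtr_ge0// sqr_sqrtr// addr_ge0 ?sqr_ge0.
Qed.

Definition near_xi (xi d : R) (z : R[i]) := normc (z - toC xi) < d.

Lemma near_xiE xi d x y : 0 <= d ->
  near_xi xi d (Complex x y) = ((x - xi) ^+ 2 + y ^+ 2 < d ^+ 2).
Proof.
by move=> d0; rewrite /near_xi -normc_ltP//; congr (normc _ < _); simpc; rewrite ?oppr0 ?addr0.
Qed.

Lemma near_xi_bounds xi d x y : 0 <= d -> near_xi xi d (Complex x y) ->
  `|x - xi| < d /\ `|y| < d.
Proof.
move=> d0; rewrite near_xiE// => H.
have sq (u v : R) : u ^+ 2 + v ^+ 2 < d ^+ 2 -> `|u| < d.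
  rewrite -(real_normK (num_real u)) => H'.
  rewrite -(ltr_pXn2r (_ : 0 < 2)%N) ?nnegrE ?normr_ge0//.
  by apply: le_lt_trans H'; rewrite lerDl sqr_ge0.
by split; [apply: sq H|apply: (sq _ (x - xi)); rewrite addrC].
Qed.

Definition quad (x y : R) : {poly R} := 'X^2 - (2 * x) *: 'X + (x ^+ 2 + y ^+ 2)%:P.

Lemma map_quad x y : map_poly toC (quad x y) =
  ('X - (Complex x y)%:P) * ('X - (Complex x (- y))%:P).
Proof.
rewrite /quad rmorphD rmorphB /= map_polyXn map_polyZ map_polyX map_polyC /=.
have -> : toC (2 * x) = Complex x y + Complex x (- y).
  by apply/eqP; rewrite eq_complex /=; apply/andP; split; apply/eqP; ring.
have -> : toC (x ^+ 2 + y ^+ 2) = Complex x y * Complex x (- y).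
  by apply/eqP; rewrite eq_complex /=; apply/andP; split; apply/eqP; ring.
by rewrite -mul_polyC polyCM polyCD; ring.
Qed.

Lemma real_conj_root (p : {poly R}) (z : R[i]) :
  root (map_poly toC p) z -> root (map_poly toC p) z^*%C.
Proof.
rewrite -complex_root_conj -map_poly_comp /=.
by congr (root _ z); apply: eq_map_poly => x /=; rewrite oppr0.
Qed.

(** In the notation of [kernel], A = |a - z|^2, C = |b - z|^2 and A C - M^2 = y^2 (b - a)^2. For M >
    0 the angle t of this factor thus satisfies tan t = |y| (b - a) / M. The identity is obtained
    from two linear factors over the complex numbers. *)
Lemma moebius_quad n (p : {poly R}) x y a b : (size p <= n.+1)%N ->
  moebius n.+2 (quad x y * p) a b =
  (((a - x) ^+ 2 + y ^+ 2) *: 'X^2 -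
     (2 * ((x - a) * (b - x) - y ^+ 2)) *: 'X + ((b - x) ^+ 2 + y ^+ 2)%:P) *
  moebius n p a b.
Proof.
move=> pn; apply: (map_inj_poly (@complexI R)) => //.
rewrite map_moebius rmorphM /= map_quad -mulrA.
have sp : (size (map_poly toC p) <= n.+1)%N by rewrite size_map_poly.
have sp' : (size (('X - (Complex x (- y))%:P) * map_poly toC p)%R <= n.+2)%N.
  apply: leq_trans (size_polyMleq _ _) _; rewrite size_XsubC.
  by rewrite add2n /= ltnS.
rewrite moebius_mul_factor// moebius_mul_factor// rmorphM /= map_moebius mulrA.
congr (_ * _).
rewrite [RHS]rmorphD [X in _ = X + _]rmorphB /= !map_polyZ map_polyXn map_polyX [in RHS]map_polyC /=.
rewrite -!mul_polyC.
set A := toC a; set B := toC b; set z := Complex x y; set t := Complex x (- y).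
have -> : toC ((a - x) ^+ 2 + y ^+ 2) = (A - z) * (A - t).
  by apply/eqP; rewrite eq_complex /=; apply/andP; split; apply/eqP; ring.
have -> : toC ((b - x) ^+ 2 + y ^+ 2) = (B - z) * (B - t).
  by apply/eqP; rewrite eq_complex /=; apply/andP; split; apply/eqP; ring.
have -> : toC (2 * ((x - a) * (b - x) - y ^+ 2)) =
    - ((A - z) * (B - t) + (A - t) * (B - z)).
  by apply/eqP; rewrite eq_complex /=; apply/andP; split; apply/eqP; ring.
by rewrite polyCN !(polyCD, polyCM, polyCN); ring.
Qed.

Lemma moebius_roots (rs : seq R[i]) c (p : {poly R[i]}) a b : a != b ->
  c != 0 -> p = c *: \prod_(z <- rs) ('X - z%:P) ->
  moebius (size rs) p a b != 0.
Proof.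
move=> ab c0 ->; elim: rs => [|z rs IH].
  by rewrite big_nil moebius0 coefZ coef1 mulr1 polyC_eq0.
rewrite big_cons scalerAr moebius_mul_factor; last first.
  by rewrite (leq_trans (size_scale_leq _ _))// size_prod_XsubC.
rewrite mulf_neq0//; apply/eqP => /polyP E.
have := E 0%N; have := E 1%N; rewrite !coef0 !coefD !coefZ !coefX !coefC mulr1 mulr0 addr0 add0r.
move=> /eqP; rewrite subr_eq0 => /eqP az /eqP; rewrite subr_eq0 => /eqP bz.
by move: ab; rewrite az bz eqxx.
Qed.

(** Near roots are split off as one real root or one conjugate pair at a time, so the induction runs
    on a bound for the number of roots. Every restored factor adds its one or two alternations; the
    far roots stay in the base polynomial, whose nonzero leading coefficient gives the alternation
    of length 0. *)
Lemma near_roots_alternate n (a b xi d : R) : 0 < d ->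
  16 * n.+3%:R * d <= xi - a -> 16 * n.+3%:R * d <= b - xi ->
  forall (rs : seq R[i]) c (p : {poly R}), (size rs <= n)%N -> c != 0 ->
    map_poly toC p = c *: \prod_(z <- rs) ('X - z%:P) ->
  exists s, alternates (fun j => (moebius (size rs) p a b)`_j) s 0
              (count (near_xi xi d) rs).
Proof.
move=> d0 da db rs; have [m rsm] := ubnP (size rs); elim: m rs rsm => // m IH rs rsm.
move=> c p rsn c0 pE.
have n3 : 3 <= n.+3%:R :> R by rewrite ler_nat.
have kd : 3 * d <= n.+3%:R * d by rewrite ler_wpM2r// ltW.
have ab : a < b by lra.
have [/hasP[z zrs zn]|none] := boolP (has (near_xi xi d) rs); last first.
  have -> : count (near_xi xi d) rs = 0%N.
    by apply/eqP; rewrite -leqn0 leqNgt -has_count.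
  have p0 : moebius (size rs) p a b != 0.
    rewrite -(map_poly_eq0 toC) map_moebius.
    by apply: moebius_roots c0 pE; rewrite (inj_eq (@complexI R)) lt_eqF.
  exists (lead_coef (moebius (size rs) p a b)); exists (size (moebius (size rs) p a b)).-1 => //.
  by rewrite -/(lead_coef _) -expr2 exprn_even_gt0//= lead_coef_eq0.
have rsE : perm_eq rs (z :: rem z rs) by apply: perm_to_rem.
have cntE : count (near_xi xi d) rs = (count (near_xi xi d) (rem z rs)).+1.
  by rewrite (permP rsE) /= zn add1n.
have sE : size rs = (size (rem z rs)).+1 by rewrite (perm_size rsE).
rewrite (perm_big _ rsE) /= big_cons in pE.
rewrite sE cntE; rewrite sE in rsm rsn; move: (rem z rs) rsm rsn pE {rsE cntE sE zrs} => {}rs.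
rewrite ltnS => rsm rsn pE.
have xy := near_xi_bounds (ltW d0) _.
case: z zn pE => x y zn pE.
have [xd yd] := xy _ _ _ zn.
have [y0|y0] := eqVneq y 0.
  rewrite {}y0 in zn pE yd.
  have root_x : root p x.
    by rewrite -(fmorph_root toC) pE /root hornerZ hornerM hornerXsubC subrr mul0r mulr0.
  have pXE : p = ('X - x%:P) * (p %/ ('X - x%:P)).
    by rewrite mulrC divpK// dvdp_XsubCl.
  set q := _ %/ _ in pXE.
  have qE : map_poly toC q = c *: \prod_(z <- rs) ('X - z%:P).
    apply: (@mulfI _ ('X - (Complex x 0)%:P)); first by rewrite polyXsubC_eq0.
    by rewrite -scalerAr -pE [in RHS]pXE rmorphM /= map_polyXsubC.
  have sq : (size q <= (size rs).+1)%N.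
    rewrite -(size_map_poly toC) qE (leq_trans (size_scale_leq _ _))//.
    by rewrite size_prod_XsubC.
  have [s alt] := IH rs rsm c q (ltnW rsn) c0 qE.
  exists s; rewrite -[s]opprK.
  have E : moebius (size rs).+1 p a b =
      - (((x - a) *: 'X - (b - x)%:P) * moebius (size rs) q a b).
    rewrite [in LHS]pXE moebius_mul_factor// -mulNr; congr (_ * _).
    by rewrite opprB addrC -scaleNr opprB.
  have A0 : 0 < x - a by move: xd; rewrite ltr_norml => /andP[]; lra.
  have C0 : 0 < b - x by move: xd; rewrite ltr_norml => /andP[]; lra.
  rewrite E; apply: eq_sign_alternates (alternatesN (alternates_mul_linear A0 C0 alt)).
  by move=> t j; rewrite coefN.
have zbar : Complex x (- y) \in rs.
  have : root (map_poly toC p) (Complex x y)^*%C.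
    apply: real_conj_root.
    by rewrite pE /root hornerZ hornerM hornerXsubC subrr mul0r mulr0.
  rewrite pE rootZ// rootM root_XsubC root_prod_XsubC => /orP[/eqP[]|//].
  by move/eqP; rewrite eq_sym -addr_eq0 -mulr2n mulrn_eq0 (negPf y0).
have zbn : near_xi xi d (Complex x (- y)).
  by rewrite near_xiE ?ltW// sqrrN -near_xiE ?ltW.
have rsE : perm_eq rs (Complex x (- y) :: rem (Complex x (- y)) rs) by apply: perm_to_rem.
have cntE : count (near_xi xi d) rs =
    (count (near_xi xi d) (rem (Complex x (- y)) rs)).+1.
  by rewrite (permP rsE) /= zbn add1n.
have sE : size rs = (size (rem (Complex x (- y)) rs)).+1 by rewrite (perm_size rsE).
rewrite (perm_big _ rsE) /= big_cons in pE.
rewrite sE cntE; rewrite sE in rsm rsn.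
move: (rem _ rs) rsm rsn pE {rsE cntE sE zbar} => {}rs rsm rsn pE.
have pqE : map_poly toC p = map_poly toC (quad x y) * (c *: \prod_(z <- rs) ('X - z%:P)).
  by rewrite pE map_quad -scalerAr mulrA.
have pQE : p = quad x y * (p %/ quad x y).
  by rewrite mulrC divpK// -(dvdp_map toC) pqE dvdp_mulIl.
set q := _ %/ _ in pQE.
have quad0 : map_poly toC (quad x y) != 0.
  by rewrite map_quad mulf_neq0// polyXsubC_eq0.
have qE : map_poly toC q = c *: \prod_(z <- rs) ('X - z%:P).
  by apply: (mulfI quad0); rewrite -pqE -rmorphM /= -pQE.
have sq : (size q <= (size rs).+1)%N.
  rewrite -(size_map_poly toC) qE (leq_trans (size_scale_leq _ _))//.
  by rewrite size_prod_XsubC.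
have [s alt] := IH rs (ltnW rsm) c q (ltnW (ltnW rsn)) c0 qE.
exists s; rewrite pQE moebius_quad//.
have /andP[xd1 xd2] : - d < x - xi < d by rewrite -ltr_norml.
have y2 : y ^+ 2 < d ^+ 2.
  by rewrite -(real_normK (num_real y)) ltr_pXn2r ?nnegrE ?normr_ge0 ?(ltW d0).
have y20 : 0 < y ^+ 2 by rewrite exprn_even_gt0.
set k : R := n.+3%:R in n3 da db kd.
(* Origin of the constant 16(n+3): if u and v are both at least 16 k d, then u v >= 8 k d (u + v),
   and moving from xi to x + i y leaves M >= 2 k d (b - a). With |y| < d this gives tan t = |y| (b -
   a) / M <= 1/(2k), as [kernel_gt0] demands. *)
have M2 : 2 * k * d * (b - a) <= (x - a) * (b - x) - y ^+ 2.
  set u := xi - a in da; set v := b - xi in db.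
  have -> : b - a = u + v by rewrite /u /v; ring.
  have uv : 8 * k * d * (u + v) <= u * v.
    have h1 : 0 <= (u - 16 * k * d) * v by apply: mulr_ge0; nra.
    have h2 : 0 <= (v - 16 * k * d) * u by apply: mulr_ge0; nra.
    nra.
  have uv0 : 0 <= u + v by nra.
  have k1 : d * (u + v) * 3 <= k * d * (u + v).
    by rewrite -mulrA [leRHS]mulrC [leRHS]mulrC -subr_ge0; nra.
  have -> : (x - a) * (b - x) = u * v - (x - xi) * (u - v) - (x - xi) ^+ 2.
    by rewrite /u /v; ring.
  have h3 : (x - xi) * (u - v) <= d * (u + v).
    have e1 : 0 <= u by nra.
    have e2 : 0 <= v by nra.
    nra.
  have h4 : (x - xi) ^+ 2 <= d ^+ 2 by nra.
  have h5 : d ^+ 2 <= d * (u + v) by nra.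
  nra.
have M0 : 0 < (x - a) * (b - x) - y ^+ 2.
  by apply: lt_le_trans M2; rewrite !mulr_gt0 ?subr_gt0//; lra.
have A0 : 0 < (a - x) ^+ 2 + y ^+ 2 by have := sqr_ge0 (a - x); lra.
have C0 : 0 < (b - x) ^+ 2 + y ^+ 2 by have := sqr_ge0 (b - x); lra.
apply: alternates_mul_quadratic => //.
set t := (size _).+3%:R.
have mk : t <= k.
  by rewrite ler_nat !ltnS; apply: leq_trans (size_moebius _ _ _ _) (ltnW rsn).
have m0 : 0 <= t by [].
set M := (x - a) * (b - x) - y ^+ 2 in M0 M2 *.
have -> : ((a - x) ^+ 2 + y ^+ 2) * ((b - x) ^+ 2 + y ^+ 2) = M ^+ 2 + y ^+ 2 * (b - a) ^+ 2.
  by rewrite /M; ring.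
suff : y ^+ 2 * (b - a) ^+ 2 * (4 * t ^+ 2) <= M ^+ 2 by lra.
have h1 : (2 * k * d * (b - a)) ^+ 2 <= M ^+ 2.
  by rewrite ler_pXn2r ?nnegrE ?(ltW M0)// !mulr_ge0 ?subr_ge0 ?ltW//; lra.
apply: le_trans h1.
have -> : y ^+ 2 * (b - a) ^+ 2 * (4 * t ^+ 2) = 4 * (b - a) ^+ 2 * (y ^+ 2 * t ^+ 2) by ring.
have -> : (2 * k * d * (b - a)) ^+ 2 = 4 * (b - a) ^+ 2 * (d ^+ 2 * k ^+ 2) by ring.
apply: ler_wpM2l; first by have := sqr_ge0 (b - a); lra.
apply: ler_pM; [exact: sqr_ge0|exact: sqr_ge0|exact: ltW|].
by rewrite ler_pXn2r ?nnegrE//; lra.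
Qed.

End RootsVariations.

(** * Accuracy of Newton's quotient away from a cluster of roots *)

Section NewtonAccuracy.
Variable R : rcfType.
Local Notation toC := (real_complex R).
Local Notation normc := Normc.normc.

Lemma near_roots_le_var n (p : {poly int}) (a b : rat) (xi d : R) (rs : seq R[i]) c :
  0 < d -> 16 * n.+3%:R * d <= xi - ratr a -> 16 * n.+3%:R * d <= ratr b - xi ->
  size rs = n -> c != 0 ->
  map_poly toC (map_poly intr p) = c *: \prod_(z <- rs) ('X - z%:P) ->
  (count (near_xi xi d) rs <= var n p a b)%N.
Proof.
move=> d0 da db rsn c0 pE.
have rsn' : (size rs <= n)%N by rewrite rsn.
have [s alt] := near_roots_alternate d0 da db rsn' c0 pE.
apply: (@alternates_sign_variations R _ s).
apply: eq_sign_alternates alt => t j; rewrite rsn itv_polyE.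
rewrite -[ratr (nth _ _ _)]coef_map map_moebius -map_poly_comp.
by congr (0 < t * (moebius _ _ _ _)`_j); apply: eq_map_poly => x /=; rewrite ratr_int.
Qed.

Lemma deriv_prod_XsubC (K : fieldType) (rs : seq K) (x : K) :
  x \notin rs ->
  (\prod_(z <- rs) ('X - z%:P))^`().[x] =
  (\prod_(z <- rs) ('X - z%:P)).[x] * \sum_(z <- rs) (x - z)^-1.
Proof.
elim: rs => [|z rs IH]; first by rewrite !big_nil derivC horner0 mulr0.
rewrite inE negb_or => /andP[xz xrs].
rewrite !big_cons derivM derivXsubC hornerD !hornerM hornerXsubC IH// hornerC mul1r.
have xz0 : x - z != 0 by rewrite subr_eq0.
rewrite mulrDr; congr (_ + _); last by rewrite mulrA.
by rewrite mulrAC divff// mul1r.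
Qed.

Lemma normc_real (x : R) : normc (toC x) = `|x|.
Proof. by rewrite /= expr0n /= addr0 sqrtr_sqr. Qed.

Lemma normcN (z : R[i]) : normc (- z) = normc z.
Proof. by case: z => x y /=; rewrite !sqrrN. Qed.

Lemma normc_ge0 (z : R[i]) : 0 <= normc z.
Proof. by case: z => x y; apply: sqrtr_ge0. Qed.

Lemma normc_triangle (x y : R[i]) : normc (x + y) <= normc x + normc y.
Proof. exact: le_normcD. Qed.

Lemma normc_sum (I : Type) (s : seq I) (F : I -> R[i]) :
  normc (\sum_(i <- s) F i) <= \sum_(i <- s) normc (F i).
Proof.
elim: s => [|i s IH]; first by rewrite !big_nil Normc.normc0.
by rewrite !big_cons (le_trans (normc_triangle _ _))// lerD2l.
Qed.

Definition cluster (xi r : R) (z : R[i]) := normc (z - toC xi) <= r.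

(** By the logarithmic derivative, T = (x - xi) P'(x)/P(x) is the sum of (x - xi)/(x - z) over the
    roots. Each of the v cluster roots contributes 1 up to 2r/D, each far root at most 2D/hi, where
    D = |x - xi|. So T is close to v, in particular nonzero, and v P/P' - (x - xi) = (x - xi)(v -
    T)/T. *)
Lemma newton_value_accurate (P : {poly R}) (rs : seq R[i]) c xi r hi x :
  c != 0 -> map_poly toC P = c *: \prod_(z <- rs) ('X - z%:P) ->
  (0 < count (cluster xi r) rs)%N ->
  (forall z, z \in rs -> cluster xi r z \/ hi <= normc (z - toC xi)) ->
  0 <= r -> 0 < `|x - xi| -> 8 * r <= `|x - xi| ->
  8 * (size rs)%:R * `|x - xi| <= hi ->
  P^`().[x] != 0 /\
  `|(count (cluster xi r) rs)%:R * (P.[x] / P^`().[x]) - (x - xi)| <=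
    4 * r + 4 * (size rs)%:R * `|x - xi| ^+ 2 / hi.
Proof.
move=> c0 pE v0 sep r0 x0 xr xhi.
set v := count _ _ in v0 *; set n := size rs in xhi *; set D := `|x - xi| in x0 xr xhi *.
have vn : (v <= n)%N by exact: count_size.
have n1 : 1 <= n%:R :> R by rewrite ler1n (leq_trans v0).
have v1 : 1 <= v%:R :> R by rewrite ler1n.
have nD : D <= n%:R * D by rewrite ler_peMl// ltW.
have hi0 : 0 < hi by lra.
have far z : z \in rs -> D / 2 <= normc (toC x - z).
  move=> /sep zrs; rewrite -normcN.
  have := normc_triangle (z - toC x) (toC (x - xi)).
  have := normc_triangle (toC x - z) (z - toC xi).
  have -> : toC x - z + (z - toC xi) = toC (x - xi) by rewrite rmorphB /=; ring.
  have -> : z - toC x + toC (x - xi) = z - toC xi by rewrite rmorphB /=; ring.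
  rewrite -[normc (toC x - z)]normcN opprB !normc_real -/D.
  by case: zrs; rewrite /cluster; lra.
have xrs : toC x \notin rs.
  apply/negP => /far; rewrite subrr Normc.normc0; lra.
have Q0 : P.[x] != 0.
  rewrite -(fmorph_eq0 toC) -horner_map /= pE hornerZ mulf_neq0//.
  by rewrite -rootE root_prod_XsubC.
have logd : toC (P^`().[x] / P.[x]) = \sum_(z <- rs) (toC x - z)^-1.
  rewrite fmorph_div -!horner_map /= -deriv_map pE derivZ !hornerZ deriv_prod_XsubC//.
  have Pr0 : (\prod_(z <- rs) ('X - z%:P)).[toC x] != 0 by rewrite -rootE root_prod_XsubC.
  by field; rewrite ?c0 ?Pr0.
pose t (z : R[i]) : R[i] := (toC x - z)^-1 - (cluster xi r z)%:R * (toC (x - xi))^-1.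
have xxi : toC (x - xi) != 0.
  by rewrite (fmorph_eq0 toC) -normr_gt0.
have sumt : \sum_(z <- rs) t z = toC (P^`().[x] / P.[x]) - toC (v%:R / (x - xi)).
  rewrite /t sumrB logd -mulr_suml; congr (_ - _).
  rewrite fmorph_div; congr (_ / _); rewrite rmorph_nat /v -sum1_count natr_sum.
  by rewrite [RHS]big_mkcond; apply: eq_bigr => z _; case: (cluster _ _ _).
have tb z : z \in rs -> normc (t z) <= (cluster xi r z)%:R * (2 * r / D ^+ 2) + 2 / hi.
  move=> zrs; have := sep z zrs; rewrite /t.
  have h2 : 0 < 2 / hi by rewrite divr_gt0.
  have xz : toC x - z != 0.
    by apply/eqP => E; have := far z zrs; rewrite E Normc.normc0; lra.
  have [zc _|zc [//|zf]] := boolP (cluster xi r z).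
    rewrite !mul1r.
    have -> : (toC x - z)^-1 - (toC (x - xi))^-1 =
              (z - toC xi) * ((toC x - z)^-1 * (toC (x - xi))^-1).
      have xxi' : toC x - toC xi != 0 by rewrite -rmorphB.
      by field; rewrite xz xxi'.
    rewrite !Normc.normcM !Normc.normcV normc_real -/D.
    apply: le_trans (_ : 2 * r / D ^+ 2 <= _); last by rewrite lerDl ltW.
    have := far z zrs; set m := normc (toC x - z) => m2.
    have m0 : 0 < m by lra.
    have -> : 2 * r / D ^+ 2 = r * ((D / 2)^-1 * D^-1).
      by field; rewrite lt0r_neq0.
    apply: ler_pM => //; first exact: normc_ge0.
      by rewrite mulr_ge0// invr_ge0 ltW.
    by rewrite ler_wpM2r ?invr_ge0 ?(ltW x0)// lef_pV2 ?posrE//; lra.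
  rewrite !mul0r subr0 add0r Normc.normcV.
  have -> : 2 / hi = (hi / 2)^-1 by field; rewrite lt0r_neq0.
  have := normc_triangle (z - toC x) (toC (x - xi)).
  have -> : z - toC x + toC (x - xi) = z - toC xi by rewrite rmorphB /=; ring.
  rewrite -[normc (z - toC x)]normcN opprB !normc_real -/D => tri.
  by rewrite lef_pV2 ?posrE//; lra.
have sumb : `|P^`().[x] / P.[x] - v%:R / (x - xi)| <=
    v%:R * (2 * r / D ^+ 2) + n%:R * (2 / hi).
  have -> : `|P^`().[x] / P.[x] - v%:R / (x - xi)| = normc (\sum_(z <- rs) t z).
    by rewrite sumt -normc_real; congr (normc _); rewrite -raddfB.
  apply: le_trans (normc_sum _ _) _.
  apply: (@le_trans _ _ (\sum_(z <- rs) ((cluster xi r z)%:R * (2 * r / D ^+ 2) + 2 / hi))).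
    by rewrite big_seq [leRHS]big_seq; apply: ler_sum => z /tb.
  rewrite big_split /= -mulr_suml big_const_seq count_predT iter_addr_0 -[_ *+ size rs]mulr_natl.
  rewrite lerD2r le_eqVlt; apply/orP; left; apply/eqP; congr (_ * _).
  rewrite /v -sum1_count natr_sum [RHS]big_mkcond.
  by apply: eq_bigr => z _; case: (cluster _ _ _).
set T := (x - xi) * (P^`().[x] / P.[x]).
have Tb : `|T - v%:R| <= v%:R * (2 * r / D) + n%:R * (2 * D / hi).
  have -> : T - v%:R = (x - xi) * (P^`().[x] / P.[x] - v%:R / (x - xi)).
    rewrite mulrBr -/T; congr (_ - _); rewrite mulrCA divff ?mulr1//.
    by rewrite -normr_gt0.
  rewrite normrM -/D.
  apply: (le_trans (ler_wpM2l (ltW x0) sumb)).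
  rewrite le_eqVlt; apply/orP; left; apply/eqP; field.
  by rewrite !lt0r_neq0.
have e1 : 2 * r / D <= 1 / 4 by rewrite ler_pdivrMr//; lra.
have e2 : n%:R * (2 * D / hi) <= 1 / 4.
  by rewrite mulrA ler_pdivrMr//; lra.
have e3 : v%:R * (2 * r / D) <= v%:R * (1 / 4) by rewrite ler_wpM2l.
have T2 : v%:R / 2 <= T by move: Tb; rewrite ler_norml => /andP[]; lra.
have P0 : P^`().[x] != 0.
  apply/eqP => E; move: T2; rewrite /T E !mul0r mulr0; lra.
split=> //.
have T0 : 0 < T by lra.
have xx0 : x - xi != 0 by rewrite -normr_gt0.
have -> : v%:R * (P.[x] / P^`().[x]) - (x - xi) = (x - xi) * ((v%:R - T) / T).
  have -> : P.[x] / P^`().[x] = (x - xi) / T.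
    by rewrite /T; field; rewrite xx0 P0 Q0.
  by field; rewrite lt0r_neq0.
rewrite !normrM -/D normfV distrC (gtr0_norm T0).
apply: (@le_trans _ _ (D * ((v%:R * (2 * r / D) + n%:R * (2 * D / hi)) * (2 / v%:R)))).
  apply: ler_wpM2l; first exact: ltW.
  apply: ler_pM => //; first by rewrite invr_ge0 ltW.
  have -> : 2 / v%:R = (v%:R / 2)^-1 :> R by field; rewrite lt0r_neq0//; lra.
  by rewrite lef_pV2 ?posrE//; lra.
have -> : D * ((v%:R * (2 * r / D) + n%:R * (2 * D / hi)) * (2 / v%:R)) =
    4 * r + 4 * n%:R * D ^+ 2 / hi * v%:R^-1.
  by field; rewrite !lt0r_neq0//; lra.
rewrite lerD2l; apply: ler_piMr; last by rewrite invf_le1//; lra.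
by apply: divr_ge0 (ltW hi0); apply: mulr_ge0; [lra|exact: sqr_ge0].
Qed.

End NewtonAccuracy.

(** * One iteration over a real field *)

Lemma ltr_intS (F : numDomainType) (l m : int) : (l < m) -> l%:~R + 1 <= m%:~R :> F.
Proof. by move=> lm; rewrite -(intrD F l 1) ler_int; lia. Qed.

Lemma ltr_int1 (F : numDomainType) (l m : int) : l%:~R < m%:~R + 1 :> F -> l <= m.
Proof. by rewrite -(intrD F m 1) ltr_int; lia. Qed.

(** With X = x - xi, D = x - y and e, f the errors of the two scaled Newton quotients, the bounded
    fraction is the distance from xi to the secant point. The numerator is at most w times the
    errors, the denominator a fixed fraction of w. *)
Lemma secant_error (F : realFieldType) (w u X D e f : F) :
  0 < u -> 16 * u <= w -> `|X| <= w -> `|D| <= w -> 3 / 16 * w <= `|D| ->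
  `|e| <= u / 2000 -> `|f| <= u / 2000 ->
  D + (e - f) != 0 /\ `|(X * (e - f) - D * e) / (D + (e - f))| <= u / 100.
Proof.
move=> u0 uw Xw Dw D0 e0 f0.
have efb : `|e - f| <= u / 1000 by have := ler_normB e f; lra.
have Db : 17 / 100 * w <= `|D + (e - f)|.
  by have := lerB_dist D (- (e - f)); rewrite opprK normrN; lra.
have Dne : D + (e - f) != 0 by rewrite -normr_gt0; lra.
split=> //; rewrite normrM normfV ler_pdivrMr; last by rewrite normr_gt0.
have h1 : `|X * (e - f)| <= w * (u / 1000) by rewrite normrM ler_pM.
have h2 : `|D * e| <= w * (u / 2000) by rewrite normrM ler_pM.
have h3 := ler_normB (X * (e - f)) (D * e).
have h4 : u / 100 * (17 / 100 * w) <= u / 100 * `|D + (e - f)|.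
  by apply: ler_wpM2l Db; rewrite divr_ge0// ltW.
have uw0 : 0 < u * w by apply: mulr_gt0 => //; apply: lt_le_trans uw; rewrite mulr_gt0.
clear - h1 h2 h3 h4 uw0; lra.
Qed.

Section Step.
Variables (R : realFieldType) (P : {poly R}) (n K h : nat).
Implicit Types (a b x y lam : R) (N : nat).

(** The grid step of the Newton test, with h in the role of the rounded-up logarithm of n. The grids
    of the boundary test and of bisection are 8 times coarser, whence the factors 8 below. Choices
    of the algorithm become existential statements over any real field, so that the analysis can
    take place over the reals. *)
Definition eps : R := (2 ^+ (5 + h))^-1.

Definition offset (d : R) : Prop := exists2 i : int, (`|i| <= K)%N & d = i%:~R * eps.

Definition newton_quotient x := P.[x] / P^`().[x].

Definition secant x y :=
  let vx := newton_quotient x in let vy := newton_quotient y in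
  x + (y - x) / (vx - vy) * vx.

Definition cell a b N := (b - a) / (4 * N%:R).

Definition located a b N lam a' b' : Prop :=
  exists (l : int) (y z : R),
  let u := cell a b N in
  [/\ l%:~R * u <= lam - a < (l%:~R + 1) * u, offset y, offset z,
      a' = (if l <= 1 then a else a + (l%:~R - 1 + 4 * y) * u)
    & b' = (if 4 * N%:R <= l + 2 then b else a + (l%:~R + 2 + 4 * z) * u)].

Definition pair_success a b N x y a' b' : Prop :=
  [/\ P^`().[x] != 0, P^`().[y] != 0, newton_quotient x != newton_quotient y
    & [/\ a <= secant x y <= b, located a b N (secant x y) a' b'
        & P.[a'] * P.[b'] < 0]].

(** The premises on the quotients say that (A) fails and (B) holds, so that the pair cannot be
    discarded by that test. Otherwise a failure carries no information, hence the implication. *)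
Definition pair_failure a b N x y : Prop :=
  let vx := newton_quotient x in let vy := newton_quotient y in
  let w := b - a in
  P^`().[x] != 0 -> P^`().[y] != 0 ->
  `|vx| <= w -> `|vy| < 2 * w -> w / (8 * n%:R) < `|vx - vy| ->
  w / (4 * n%:R) <= `|vx - vy| ->
  a <= secant x y <= b ->
  exists a' b', located a b N (secant x y) a' b' /\ ~~ (P.[a'] * P.[b'] < 0).

Definition samples a b (x : R * R * R) : Prop :=
  let w := b - a in
  [/\ exists2 d, offset d & x.1.1 = a + (1 / 4 + d) * w,
      exists2 d, offset d & x.1.2 = a + (1 / 2 + d) * w
    & exists2 d, offset d & x.2 = a + (3 / 4 + d) * w].

Definition boundary_points a b N ml mr : Prop :=
  let w := b - a in
  (exists2 d, offset d & ml = a + (1 / 2 + 8 * d) * (w / N%:R)) /\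
  (exists2 d, offset d & mr = b - (1 / 2 + 8 * d) * (w / N%:R)).

Definition newton_step a b N (x : R * R * R) a' b' : Prop :=
  [\/ pair_success a b N x.1.1 x.1.2 a' b', pair_success a b N x.1.1 x.2 a' b'
    | pair_success a b N x.1.2 x.2 a' b'].

(** Of the failed Newton test, the outer pair is recorded: its points are farthest apart, and its
    failure forces xi to an end of the interval or to one of these two points. *)
Definition boundary_step a b N (x : R * R * R) a' b' : Prop :=
  pair_failure a b N x.1.1 x.2 /\
  exists ml mr, boundary_points a b N ml mr /\
   ([/\ P.[a] * P.[ml] < 0, a' = a & b' = ml] \/
    [/\ P.[b] * P.[mr] < 0, a' = mr & b' = b]).

Definition bisection_step a b N (x : R * R * R) a' b' : Prop :=
  [/\ pair_failure a b N x.1.1 x.2,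
   exists ml mr, [/\ boundary_points a b N ml mr, ~~ (P.[a] * P.[ml] < 0)
                   & ~~ (P.[b] * P.[mr] < 0)]
   & exists d, let m := a + (1 / 2 + 8 * d) * (b - a) in
     [/\ offset d, P.[m] != 0
       & [/\ P.[a] * P.[m] < 0, a' = a & b' = m] \/
         [/\ ~~ (P.[a] * P.[m] < 0), a' = m & b' = b]]].

Definition success_step a b N (x : R * R * R) a' b' : Prop :=
  newton_step a b N x a' b' \/ boundary_step a b N x a' b'.

Variable xi : R.
(** Isolation and simplicity of xi in a form that subintervals inherit. The interval is closed, so
    the signs at the end points count as well. *)
Definition signs_at a b : Prop := forall x y, a <= x <= b -> a <= y <= b ->
  (P.[x] * P.[y] < 0) = ((x - xi) * (y - xi) < 0).


(** [kap] bounds the radius of the grid relative to w. The value 1/32 keeps bisection points within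
    the middle half of the interval and displaces an end chosen by the Newton test by at most an
    eighth of a cell. *)
Definition state_ok kap a b N : Prop :=
  [/\ a < xi < b, (4 <= N)%N, kap <= 1 / 32,
     forall d, offset d -> - kap <= d <= kap & signs_at a b].

Definition accurate v u x : Prop :=
  P^`().[x] != 0 /\ `|v%:R * newton_quotient x - (x - xi)| <= u / 2000.

End Step.

Lemma natN_ge4 (R : realFieldType) N : (4 <= N)%N -> 4 <= N%:R :> R.
Proof. by rewrite ler_nat. Qed.

Lemma cell_gt0 (R : realFieldType) (a b : R) N : a < b -> (4 <= N)%N -> 0 < cell a b N.
Proof.
move=> ab /(natN_ge4 R) N0; rewrite divr_gt0 ?subr_gt0// mulr_gt0//.
exact: lt_le_trans N0.
Qed.

Lemma cellE (R : realFieldType) (a b : R) N : (4 <= N)%N ->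
  4 * N%:R * cell a b N = b - a.
Proof.
move=> /(natN_ge4 R) N0; rewrite /cell; field; rewrite lt0r_neq0//.
exact: lt_le_trans N0.
Qed.

Lemma widthN (R : realFieldType) (a b : R) N : (4 <= N)%N ->
  (b - a) / N%:R = 4 * cell a b N.
Proof.
move=> /(natN_ge4 R) N0; rewrite /cell; field; rewrite lt0r_neq0//.
exact: lt_le_trans N0.
Qed.

Lemma cell_le (R : realFieldType) (a b : R) N : a < b -> (4 <= N)%N ->
  16 * cell a b N <= b - a.
Proof.
move=> ab N4; rewrite -(cellE a b N4) ler_pM2r ?cell_gt0//.
by have := natN_ge4 R N4; lra.
Qed.

Lemma located_bounds (R : realFieldType) K h (kap a b : R) N lam a' b'
    (u := cell a b N) :
  a < b -> (4 <= N)%N -> kap <= 1 / 32 ->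
  (forall d, offset K h d -> - kap <= d <= kap) ->
  a <= lam <= b -> located K h a b N lam a' b' ->
  [/\ a <= a', b' <= b, a' < b', b' - a' <= (3 + 8 * kap) * u &
   [/\ lam - a' <= (2 + 4 * kap) * u, b' - lam <= (2 + 4 * kap) * u,
       a' = a \/ (1 - 4 * kap) * u <= lam - a'
     & b' = b \/ (1 - 4 * kap) * u <= b' - lam]].
Proof.
move=> ab N4 kap_le offsetP /andP[al lb] [l [y [z [/andP[lu ul] /offsetP/andP[y1 y2] /offsetP/andP[z1 z2]]]]].
have u0 := cell_gt0 ab N4; have uw := cellE a b N4; have N0 := natN_ge4 R N4.
rewrite -/u in u0 uw lu ul *.
set L : R := l%:~R in lu ul *.
have yu1 : - kap * u <= y * u by rewrite ler_wpM2r// ltW.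
have yu2 : y * u <= kap * u by rewrite ler_wpM2r// ltW.
have zu1 : - kap * u <= z * u by rewrite ler_wpM2r// ltW.
have zu2 : z * u <= kap * u by rewrite ler_wpM2r// ltW.
have ku : kap * u <= 1 / 32 * u by rewrite ler_wpM2r// ltW.
have l0 : 0 <= L.
  have : 0 < (L + 1) * u by lra.
  by rewrite pmulr_lgt0// => L0; rewrite /L ler0z; apply: (@ltr_int1 R).
have lN : L <= 4 * N%:R.
  by rewrite -(ler_pM2r u0) uw (le_trans lu)// lerD2r.
have NE : (4 * N%:R : int)%:~R = 4 * N%:R :> R by rewrite rmorphM /= !rmorph_nat.
have wE : b = a + 4 * N%:R * u by rewrite uw; ring.
rewrite /located.
case: (lerP l 1) => l1 ->.
  have L1 : L <= 1 by move: l1; rewrite -(ler_int R).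
  have Lu : L * u <= 1 * u by rewrite ler_wpM2r// ltW.
  have Lu0 : 0 <= L * u by rewrite mulr_ge0// ltW.
  case: (lerP (4 * N%:R) (l + 2)) => l2 ->.
    have L2 : 4 * N%:R <= L + 2.
      by move: l2; rewrite -(ler_int R) NE intrD.
    lra.
  have L2 : L + 3 <= 4 * N%:R.
    by have := ltr_intS R l2; rewrite NE intrD -/L; lra.
  have L2u := ler_wpM2r (ltW u0) L2; clear - al lb lu ul yu1 yu2 zu1 zu2 ku wE Lu Lu0 L2u u0.
  by split; try lra; split; lra.
have L1 : 2 <= L by have := ltr_intS R l1; rewrite -/L; lra.
have Lu : 2 * u <= L * u by rewrite ler_wpM2r// ltW.
case: (lerP (4 * N%:R) (l + 2)) => l2 ->.
  have L2 : 4 * N%:R <= L + 2.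
    by move: l2; rewrite -(ler_int R) NE intrD.
  have L2u := ler_wpM2r (ltW u0) L2.
  have lNu := ler_wpM2r (ltW u0) lN.
  clear - al lb lu ul yu1 yu2 zu1 zu2 ku wE Lu L2u lNu u0.
  by split; try lra; split; lra.
have L2 : L + 3 <= 4 * N%:R.
  by have := ltr_intS R l2; rewrite NE intrD -/L; lra.
have L2u := ler_wpM2r (ltW u0) L2.
clear - al lb lu ul yu1 yu2 zu1 zu2 ku wE Lu L2u u0.
by split; try lra; split; lra.
Qed.

Lemma samples_bounds (R : realFieldType) K h (kap a b : R) (x : R * R * R)
    (w := b - a) :
  a < b -> (forall d, offset K h d -> - kap <= d <= kap) ->
  samples K h a b x ->
  [/\ - (kap * w) <= x.1.1 - (a + 1 / 4 * w) <= kap * w,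
      - (kap * w) <= x.1.2 - (a + 1 / 2 * w) <= kap * w
    & - (kap * w) <= x.2 - (a + 3 / 4 * w) <= kap * w].
Proof.
move=> ab offsetP; have w0 : 0 < w by rewrite subr_gt0.
have main (q d : R) : offset K h d ->
    - (kap * w) <= a + (q + d) * w - (a + q * w) <= kap * w.
  move=> /offsetP dk; have -> : a + (q + d) * w - (a + q * w) = d * w by ring.
  by rewrite -mulNr !ler_pM2r.
by case=> [[d1 /(main (1 / 4)) d1k ->] [d2 /(main (1 / 2)) d2k ->] [d3 /(main (3 / 4)) d3k ->]].
Qed.

Lemma secant_accurate (R : realFieldType) (P : {poly R}) (xi a b : R) N v x y
    (u := cell a b N) :
  a < xi < b -> (4 <= N)%N -> (0 < v)%N ->
  accurate P xi v u x -> accurate P xi v u y ->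
  a <= x <= b -> a <= y <= b -> 3 / 16 * (b - a) <= `|x - y| ->
  `|secant P x y - xi| <= u / 100.
Proof.
move=> /andP[axi xib] N4 v1 [_ ax] [_ ay] /andP[ax1 xb] /andP[ay1 yb] xy.
have ab := lt_trans axi xib.
have v0 : 0 < v%:R :> R by rewrite ltr0n.
have u0 := cell_gt0 ab N4; have uw := cell_le ab N4; rewrite -/u in u0 uw.
rewrite /secant; set vx := newton_quotient P x in ax *.
set vy := newton_quotient P y in ay *.
have [Dne] : (x - y) + ((v%:R * vx - (x - xi)) - (v%:R * vy - (y - xi))) != 0 /\
    `|((x - xi) * ((v%:R * vx - (x - xi)) - (v%:R * vy - (y - xi))) -
      (x - y) * (v%:R * vx - (x - xi))) /
     ((x - y) + ((v%:R * vx - (x - xi)) - (v%:R * vy - (y - xi))))| <= u / 100.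
  apply: (secant_error u0 uw _ _ xy ax ay).
  - by clear - ax1 xb axi xib; rewrite ler_norml; apply/andP; split; lra.
  - by clear - ax1 xb ay1 yb; rewrite ler_norml; apply/andP; split; lra.
have DE : (x - y) + ((v%:R * vx - (x - xi)) - (v%:R * vy - (y - xi))) = v%:R * (vx - vy).
  by ring.
rewrite DE in Dne *; move: Dne; rewrite mulf_eq0 negb_or => /andP[_ vne].
have -> : ((x - xi) * (v%:R * vx - (x - xi) - (v%:R * vy - (y - xi))) -
   (x - y) * (v%:R * vx - (x - xi))) / (v%:R * (vx - vy)) =
   x + (y - x) / (vx - vy) * vx - xi.
  by field; rewrite vne lt0r_neq0.
by [].
Qed.

Lemma cell_edges (R : realFieldType) (P : {poly R}) K h (kap xi a b : R) N lam a' b'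
    (u := cell a b N) :
  state_ok P K h xi kap a b N -> a <= lam <= b -> located K h a b N lam a' b' ->
  - (u / 100) <= lam - xi <= u / 100 -> P.[a'] * P.[b'] < 0.
Proof.
move=> [/andP[axi xib] N4 kap_le offsetP signs] lab loc /andP[sec1 sec2].
have ab := lt_trans axi xib; have u0 := cell_gt0 ab N4; rewrite -/u in u0.
have [aa' b'b a'b' _ [_ _ la' lb']] := located_bounds ab N4 kap_le offsetP lab loc.
have ku : kap * u <= 1 / 32 * u by rewrite ler_wpM2r// ltW.
rewrite signs; last 2 first.
- by rewrite aa' (le_trans (ltW a'b')).
- by rewrite b'b (le_trans aa' (ltW a'b')).
rewrite -/u in la' lb'.
have a'xi : a' < xi by case: la' => [->//|la']; clear - la' ku sec2 sec1 u0; lra.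
have xib' : xi < b' by case: lb' => [->//|lb']; clear - lb' ku sec2 sec1 u0; lra.
by rewrite nmulr_rlt0 ?subr_gt0// subr_lt0.
Qed.

Lemma accurate_quotient_le (R : realFieldType) (xi a b u V x v : R) :
  1 <= v -> 0 < u -> 16 * u <= b - a -> a < xi < b ->
  a + 3 / 16 * (b - a) <= x <= b - 3 / 16 * (b - a) ->
  `|v * V - (x - xi)| <= u / 2000 -> `|V| <= b - a.
Proof.
move=> v1 u0 uw /andP[axi xib] /andP[xa xb] H.
have v0 : 0 < v by apply: lt_le_trans v1.
have : `|v * V| <= b - a.
  by move: H; rewrite !ler_norml => /andP[H1 H2]; apply/andP; split; lra.
rewrite normrM (gtr0_norm v0); apply: le_trans.
by rewrite ler_peMl.
Qed.

(** Accuracy at both points forces the pair to be kept: the quotients are at most w in size, and v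
    |v_1 - v_3| is close to |x_1 - x_3| with v <= n. As lambda is within u/100 of xi, a lambda
    inside [a,b] would give a sign change; so lambda has left the interval and xi is next to an
    end. *)
Lemma accurate_near_edge (R : realFieldType) (P : {poly R}) n K h (kap xi a b : R) N v x
    (u := cell a b N) :
  state_ok P K h xi kap a b N -> (0 < v)%N -> (v <= n)%N ->
  samples K h a b x -> accurate P xi v u x.1.1 -> accurate P xi v u x.2 ->
  pair_failure P n K h a b N x.1.1 x.2 -> xi - a <= u / 100 \/ b - xi <= u / 100.
Proof.
move=> ok v0 vn xs A1 A3 fail.
have [axib N4 kap_le offsetP signs] := ok; have /andP[axi xib] := axib.
have ab := lt_trans axi xib; have u0 := cell_gt0 ab N4.
have uw := cell_le ab N4; rewrite -/u in u0 uw.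
have [/andP[x1a x1b] _ /andP[x3a x3b]] := samples_bounds ab offsetP xs.
move: x1a x1b x3a x3b A1 A3 fail; move: x.1.1 x.2 => x1 x3 x1a x1b x3a x3b A1 A3.
have vge1 : 1 <= v%:R :> R by rewrite ler1n.
have vn' : v%:R <= n%:R :> R by rewrite ler_nat.
have w0 : 0 < b - a by rewrite subr_gt0.
have kw : kap * (b - a) <= 1 / 32 * (b - a) by rewrite ler_wpM2r// ltW.
have x13 : 7 / 16 * (b - a) <= x3 - x1 by clear - x1b x3a kw; lra.
have x13' : 7 / 16 * (b - a) <= `|x1 - x3|.
  by rewrite distrC ger0_norm//; clear - x13 w0; lra.
have x1ab : a + 3 / 16 * (b - a) <= x1 <= b - 3 / 16 * (b - a).
  by clear - x1a x1b kw w0; apply/andP; split; lra.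
have x3ab : a + 3 / 16 * (b - a) <= x3 <= b - 3 / 16 * (b - a).
  by clear - x3a x3b kw w0; apply/andP; split; lra.
have sec : `|secant P x1 x3 - xi| <= u / 100.
  apply: (secant_accurate axib N4 v0 A1 A3).
  - by clear - x1ab w0; case/andP: x1ab => *; apply/andP; split; lra.
  - by clear - x3ab w0; case/andP: x3ab => *; apply/andP; split; lra.
  - by apply: le_trans x13'; clear - w0; lra.
case: A1 A3 => P1 A1 [P3 A3]; rewrite /pair_failure.
have s1 := accurate_quotient_le vge1 u0 uw axib x1ab A1.
have s3 := accurate_quotient_le vge1 u0 uw axib x3ab A3.
move: s1 s3 A1 A3; set v1x := newton_quotient P x1; set v3x := newton_quotient P x3.
move=> s1 s3 A1 A3.
have dV : 43 / 100 * (b - a) <= v%:R * `|v1x - v3x|.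
  rewrite -{1}(ger0_norm (ler0n R v)) -normrM.
  have -> : v%:R * (v1x - v3x) =
    (x1 - x3) + ((v%:R * v1x - (x1 - xi)) - (v%:R * v3x - (x3 - xi))) by ring.
  have := ler_normB (v%:R * v1x - (x1 - xi)) (v%:R * v3x - (x3 - xi)).
  set e := _ - _ - (_ - _) => eb.
  have := lerB_dist (x1 - x3) (- e); rewrite opprK normrN => H.
  by clear - H eb A1 A3 x13' uw u0; lra.
have n0 : 0 < n%:R :> R by apply: lt_le_trans vn'; rewrite ltr0n.
have dVn : 43 / 100 * (b - a) <= n%:R * `|v1x - v3x|.
  by apply: (le_trans dV); rewrite ler_wpM2r.
have c1 : (b - a) / (8 * n%:R) < `|v1x - v3x|.
  by rewrite ltr_pdivrMr ?mulr_gt0//; clear - dVn w0; lra.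
have c2 : (b - a) / (4 * n%:R) <= `|v1x - v3x|.
  by rewrite ler_pdivrMr ?mulr_gt0//; clear - dVn w0; lra.
have s3' : `|v3x| < 2 * (b - a) by clear - s3 w0; lra.
move=> /(_ P1 P3 s1 s3' c1 c2); move: sec; set lam := secant P x1 x3.
rewrite ler_norml => sec fail; have /andP[sec1 sec2] := sec.
have [la|al] := ltP lam a; first by left; clear - sec1 la; lra.
have [bl|lb] := ltP b lam; first by right; clear - sec2 bl; lra.
have lab : a <= lam <= b by rewrite al lb.
have [a' [b' [loc /negP[]]]] := fail lab.
exact: cell_edges ok lab loc sec.
Qed.

Lemma signs_between (R : realFieldType) (P : {poly R}) (xi a b x y : R) :
  signs_at P xi a b -> a <= x <= b -> a <= y <= b -> x <= y ->
  P.[x] * P.[y] < 0 -> x < xi < y.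
Proof.
move=> signs xab yab xy; rewrite signs// => H.
have [xx|xx] := ltP x xi; last first.
  by move: H; rewrite ltNge mulr_ge0 ?subr_ge0// (le_trans xx).
by rewrite /= ltNge; apply/negP => yx; move: H; rewrite ltNge mulr_le0 ?subr_le0// ltW.
Qed.

Section Success.
Variables (R : realFieldType) (P : {poly R}) (n K h : nat) (kap xi : R).
Implicit Types (a b s t : R) (N : nat) (x : R * R * R).
Local Notation state_ok := (state_ok P K h xi kap).

(** The sign change certifies that xi lies in the new interval, which extends at most (2 + 4 kap) u
    from lambda on either side. This locates lambda even when the two quotients are inaccurate. *)
Lemma pair_success_bounds a b N s t a' b' (u := cell a b N) :
  state_ok a b N -> pair_success P K h a b N s t a' b' ->
  [/\ a <= a', b' <= b, a' < xi < b', b' - a' <= (b - a) / N%:R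
    & `|secant P s t - xi| <= 43 / 20 * u].
Proof.
move=> [/andP[axi xib] N4 kap_le offsetP signs] [_ _ _ [lab loc neg]].
have ab := lt_trans axi xib; have u0 := cell_gt0 ab N4.
have [aa' b'b a'b' wd [la' lb' _ _]] := located_bounds ab N4 kap_le offsetP lab loc.
rewrite -/u in u0 wd la' lb'.
have ku : kap * u <= 1 / 32 * u by rewrite ler_wpM2r// ltW.
have /andP[a'xi xib'] : a' < xi < b'.
  apply: signs_between signs _ _ (ltW a'b') neg.
  - by rewrite aa' (le_trans (ltW a'b')).
  - by rewrite b'b (le_trans aa' (ltW a'b')).
split=> //.
- by rewrite a'xi xib'.
- by rewrite widthN// -/u; clear - wd ku u0; lra.
- by clear - a'xi xib' la' lb' ku u0; rewrite ler_norml; apply/andP; split; lra.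
Qed.

Lemma boundary_points_bounds a b N ml mr (u := cell a b N) :
  state_ok a b N -> boundary_points K h a b N ml mr ->
  u <= ml - a <= (2 + 32 * kap) * u /\ u <= b - mr <= (2 + 32 * kap) * u.
Proof.
move=> [/andP[axi xib] N4 kap_le offsetP signs] [].
have ab := lt_trans axi xib; have u0 := cell_gt0 ab N4; rewrite -/u in u0.
rewrite widthN// -/u.
have main d : offset K h d ->
    u <= (1 / 2 + 8 * d) * (4 * u) <= (2 + 32 * kap) * u.
  move=> /offsetP/andP[d1 d2].
  have d1u := ler_wpM2r (ltW u0) d1; have d2u := ler_wpM2r (ltW u0) d2.
  have ku : kap * u <= 1 / 32 * u by rewrite ler_wpM2r// ltW.
  by clear - d1u d2u ku u0; apply/andP; split; lra.
move=> [d /main dm ->] [d' /main dm' ->]; split.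
- by rewrite addrC addKr.
- by rewrite opprB addrC addrNK.
Qed.

Lemma success_step_bounds a b N x a' b' :
  state_ok a b N -> success_step P n K h a b N x a' b' ->
  [/\ a <= a', b' <= b, a' < xi < b' & b' - a' <= (b - a) / N%:R].
Proof.
move=> ok; case=> [nw|[_ [ml [mr [pts side]]]]].
  have [s [t ps]] : exists s t, pair_success P K h a b N s t a' b'.
    by case: nw; [exists x.1.1, x.1.2|exists x.1.1, x.2|exists x.1.2, x.2].
  by have [] := pair_success_bounds ok ps.
have [/andP[axi xib] N4 kap_le offsetP signs] := ok.
have ab := lt_trans axi xib; have u0 := cell_gt0 ab N4.
have := boundary_points_bounds ok pts; rewrite widthN//.
have uw := cell_le ab N4; move: (cell a b N) u0 uw => u u0 uw [/andP[l1 l2] /andP[r1 r2]].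
have ku : kap * u <= 1 / 32 * u by rewrite ler_wpM2r// ltW.
have mlab : a <= ml <= b by clear - l1 l2 ku u0 uw; apply/andP; split; lra.
have mrab : a <= mr <= b by clear - r1 r2 ku u0 uw; apply/andP; split; lra.
case: side => -[neg -> ->].
  have /andP[_ xm] := signs_between signs (introT andP (conj (lexx a) (ltW ab))) mlab
    (proj1 (andP mlab)) neg.
  split; rewrite ?axi ?xm ?(proj2 (andP mlab))//.
  by clear - l1 l2 ku u0 uw; lra.
rewrite mulrC in neg.
have /andP[mx _] := signs_between signs mrab (introT andP (conj (ltW ab) (lexx b)))
  (proj2 (andP mrab)) neg.
split; rewrite ?xib ?mx ?(proj1 (andP mrab))//.
by clear - r1 r2 ku u0 uw; lra.
Qed.

Lemma bisection_step_bounds a b N x a' b' :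
  state_ok a b N -> bisection_step P n K h a b N x a' b' ->
  [/\ a <= a', b' <= b, a' < xi < b' & b' - a' <= 3 / 4 * (b - a)].
Proof.
move=> [/andP[axi xib] N4 kap_le offsetP signs] [_ _ [d [/offsetP/andP[d1 d2] m0 side]]].
have ab := lt_trans axi xib; have w0 : 0 < b - a by rewrite subr_gt0.
move: m0 side; set m := a + _ => m0 side.
have mE : m - a = (1 / 2 + 8 * d) * (b - a) by rewrite /m; ring.
have d1w := ler_wpM2r (ltW w0) d1; have d2w := ler_wpM2r (ltW w0) d2.
have kw : kap * (b - a) <= 1 / 32 * (b - a) by rewrite ler_wpM2r// ltW.
have /andP[ma mb] : 1 / 4 * (b - a) <= m - a <= 3 / 4 * (b - a).
  by rewrite mE; clear - d1w d2w kw w0; apply/andP; split; lra.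
have mab : a <= m <= b by clear - ma mb w0; apply/andP; split; lra.
case: side => -[neg -> ->].
  have /andP[_ xm] := signs_between signs (introT andP (conj (lexx a) (ltW ab))) mab
    (proj1 (andP mab)) neg.
  by split; rewrite ?axi ?xm ?(proj2 (andP mab)).
have xm : m < xi.
  rewrite signs ?lexx ?(ltW ab)// in neg.
  rewrite lt_neqAle; apply/andP; split.
    (* The case m = xi contradicts p(m) <> 0: both p(a) p(m) and p(b) p(m) would be nonnegative,
       while p(a) p(b) is negative. *)
    apply/eqP => mx; have aab : a <= a <= b by rewrite lexx ltW.
    have bab : a <= b <= b by rewrite lexx ltW.
    have := signs a m aab mab; rewrite mx subrr mulr0 ltxx => /negbT.
    have := signs b m bab mab; rewrite mx subrr mulr0 ltxx => /negbT.
    have Pab : P.[a] * P.[b] < 0 by rewrite signs// nmulr_rlt0 ?subr_lt0// subr_gt0.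
    rewrite -mx -!leNgt => Pb Pa.
    have : 0 <= (P.[a] * P.[m]) * (P.[b] * P.[m]) by apply: mulr_ge0.
    rewrite mulrACA nmulr_rge0// -expr2 => Pm.
    by move: m0; rewrite -sqrf_eq0 eq_le Pm sqr_ge0.
  by rewrite leNgt; apply/negP => xm; move: neg; rewrite nmulr_rlt0 ?subr_gt0 ?subr_lt0// xm.
split; rewrite ?xm ?(proj1 (andP mab))//.
by clear - ma w0; lra.
Qed.
End Success.

(** * The relative position of xi in the interval *)

Definition inner (R : realFieldType) (q xi a b : R) : Prop :=
  q * (b - a) <= xi - a /\ q * (b - a) <= b - xi.

(** The positions available to an outer sample point, 1/4 - 3/128 to 1/4 + 3/128 from an end,
    widened by the small distance that xi may have from it. *)
Definition quarter (R : realFieldType) (xi a b : R) : Prop :=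
  22 / 100 * (b - a) <= xi - a <= 275 / 1000 * (b - a) \/
  22 / 100 * (b - a) <= b - xi <= 275 / 1000 * (b - a).

Section Positions.
Variables (R : realFieldType) (P : {poly R}) (n K h : nat) (kap xi : R).
Implicit Types (a b s t : R) (N : nat) (x : R * R * R).
Local Notation state_ok := (state_ok P K h xi kap).

(** Away from the ends neither side loses a cell to clamping, so the new interval has three cells
    and xi is within u/100 of the middle one: nearly a third of the width remains on each side. The
    value 29/100 is chosen above the 275/1000 of [quarter]. *)
Lemma accurate_success_inner a b N s t a' b' (u := cell a b N) :
  kap <= 3 / 128 -> state_ok a b N -> inner (1 / 10) xi a b ->
  pair_success P K h a b N s t a' b' -> `|secant P s t - xi| <= u / 100 ->
  inner (29 / 100) xi a' b'.
Proof.
move=> kap_small [/andP[axi xib] N4 _ offsetP _] [qa qb].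
move=> [_ _ _ [/andP[al lb] [l [y [z [/andP[lu ul] /offsetP/andP[y1 y2] /offsetP/andP[z1 z2] aE bE]]]] _]].
have ab := lt_trans axi xib; have u0 := cell_gt0 ab N4; have uw := cellE a b N4.
have N0 := natN_ge4 R N4; have uw16 := cell_le ab N4.
rewrite -/u in u0 uw uw16 lu ul aE bE *; move: (secant P s t) al lb lu ul => lam al lb lu ul.
set L : R := l%:~R in lu ul *; rewrite ler_norml => /andP[e1 e2].
have yu1 : - kap * u <= y * u by rewrite ler_wpM2r// ltW.
have yu2 : y * u <= kap * u by rewrite ler_wpM2r// ltW.
have zu1 : - kap * u <= z * u by rewrite ler_wpM2r// ltW.
have zu2 : z * u <= kap * u by rewrite ler_wpM2r// ltW.
have ku : kap * u <= 3 / 128 * u by rewrite ler_wpM2r// ltW.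
have L1 : 1 <= L.
  have : 0 < L * u by clear - ul e1 e2 qa uw16 u0; lra.
  by rewrite pmulr_lgt0// /L ltr0z => /(ltr_intS R); rewrite mulr0z add0r.
have LN : L + 2 <= 4 * N%:R.
  have NE : (4 * N%:R : int)%:~R = 4 * N%:R :> R by rewrite rmorphM /= !rmorph_nat.
  have : (L + 1) * u < 4 * N%:R * u.
    by rewrite uw; clear - lu e1 e2 qb uw16 u0; lra.
  rewrite ltr_pM2r// => LN; have lN : l + 1 < 4 * N%:R.
    by rewrite -(ltr_int R) NE intrD.
  by have := ltr_intS R lN; rewrite NE intrD -/L => H; clear - H u0; lra.
have LNu := ler_wpM2r (ltW u0) LN.
have [Y [Y1 Y2 {}aE]] : exists Y, [/\ - (3 / 128 * u) <= Y, Y <= 3 / 128 * u &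
    a' - a = (L - 1) * u + 4 * Y].
  move: aE; case: (lerP l 1) => l1 ->; last first.
    by exists (y * u); rewrite -/L; split; [lra|lra|ring].
  have -> : L = 1 by apply: le_anti; rewrite L1 andbT; move: l1; rewrite -(ler_int R).
  by exists 0; split; [clear - u0; lra|clear - u0; lra|ring].
have [Z [Z1 Z2 {}bE]] : exists Z, [/\ - (3 / 128 * u) <= Z, Z <= 3 / 128 * u &
    b' - a = (L + 2) * u + 4 * Z].
  move: bE; case: (lerP (4 * N%:R) (l + 2)) => l1 ->; last first.
    by exists (z * u); rewrite -/L; split; [lra|lra|ring].
  exists 0; split; [clear - u0; lra|clear - u0; lra|rewrite mulr0 addr0 -uw].
  have -> // : L + 2 = 4 * N%:R.
  apply: le_anti; rewrite LN; move: l1; rewrite -(ler_int R) intrD.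
  by rewrite rmorphM /= !rmorph_nat.
clear - aE bE e1 e2 lu ul u0 Y1 Y2 Z1 Z2.
split; lra.
Qed.

(** As 8 * 3/128 = 3/16, the point m lies between 5/16 and 11/16. With xi at most 275/1000 from one
    end, at least 3/80 of w separates xi from m. *)
Lemma bisection_from_quarter a b N x a' b' :
  kap <= 3 / 128 -> state_ok a b N -> quarter xi a b -> bisection_step P n K h a b N x a' b' ->
  inner (1 / 10) xi a' b' /\
  exists d, let m := a + (1 / 2 + 8 * d) * (b - a) in
    [/\ offset K h d, 5 / 16 * (b - a) <= m - a, 5 / 16 * (b - a) <= b - m &
      (22 / 100 * (b - a) <= xi - a <= 275 / 1000 * (b - a) /\ a' = a /\ b' = m) \/
      (22 / 100 * (b - a) <= b - xi <= 275 / 1000 * (b - a) /\ a' = m /\ b' = b)].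
Proof.
move=> kap_small [/andP[axi xib] N4 _ offsetP signs] qu [_ _ [d [od m0 side]]].
have ab := lt_trans axi xib; have w0 : 0 < b - a by rewrite subr_gt0.
have /offsetP/andP[d1 d2] := od.
move: m0 side; set m := a + _ => m0 side.
have mE : m - a = (1 / 2 + 8 * d) * (b - a) by rewrite /m; ring.
have d1w := ler_wpM2r (ltW w0) d1; have d2w := ler_wpM2r (ltW w0) d2.
have kw : kap * (b - a) <= 3 / 128 * (b - a) by rewrite ler_wpM2r// ltW.
have /andP[ma mb] : 5 / 16 * (b - a) <= m - a <= 11 / 16 * (b - a).
  by rewrite mE; clear - d1w d2w kw w0; apply/andP; split; lra.
have mab : a <= m <= b by clear - ma mb w0; apply/andP; split; lra.
have negE : (P.[a] * P.[m] < 0) = (xi < m).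
  by rewrite signs ?lexx ?(ltW ab)// nmulr_rlt0 ?subr_lt0// subr_gt0.
case: qu => /andP[q1 q2].
  have xm : xi < m by clear - q2 ma w0; lra.
  case: side; rewrite negE xm => -[// _ -> ->].
  split; first by split; clear - q1 q2 ma mb w0; lra.
  exists d; split=> //; first by rewrite -/m; clear - mb w0; lra.
  by left; rewrite q1 q2.
have mx : m < xi by clear - q2 mb w0; lra.
case: side; rewrite negE ltNge (ltW mx) => -[// _ -> ->].
split; first by split; clear - q1 q2 ma mb w0; lra.
exists d; split=> //; first by rewrite -/m; clear - mb w0; lra.
by right; rewrite q1 q2.
Qed.

Lemma quarter_not_inner a b : a < b -> quarter xi a b -> ~ inner (29 / 100) xi a b.
Proof. by rewrite /quarter /inner -subr_gt0 => w0 [/andP[]|/andP[]] *; lra. Qed.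

Lemma boundary_not_quarter a b N ml mr :
  kap <= 3 / 128 -> state_ok a b N -> boundary_points K h a b N ml mr -> quarter xi a b ->
  ~~ (P.[a] * P.[ml] < 0) /\ ~~ (P.[b] * P.[mr] < 0).
Proof.
move=> kap_small ok pts; have [/andP[axi xib] N4 _ offsetP signs] := ok.
have ab := lt_trans axi xib; have u0 := cell_gt0 ab N4; have uw := cell_le ab N4.
have := boundary_points_bounds ok pts.
move: (cell a b N) u0 uw => u u0 uw [/andP[l1 l2] /andP[r1 r2]].
have ku : kap * u <= 3 / 128 * u by rewrite ler_wpM2r// ltW.
have mlab : a <= ml <= b by clear - l1 l2 ku u0 uw; apply/andP; split; lra.
have mrab : a <= mr <= b by clear - r1 r2 ku u0 uw; apply/andP; split; lra.
rewrite !signs ?lexx ?(ltW ab)// nmulr_rlt0 ?subr_lt0// subr_gt0.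
rewrite pmulr_rlt0 ?subr_gt0// subr_lt0 -!leNgt.
by case=> /andP[q1 q2]; split; clear - q1 q2 l2 r2 ku uw u0; lra.
Qed.

Lemma edge_boundary a b N ml mr :
  state_ok a b N -> boundary_points K h a b N ml mr ->
  (xi - a < cell a b N -> P.[a] * P.[ml] < 0) /\
  (b - xi < cell a b N -> P.[b] * P.[mr] < 0).
Proof.
move=> ok pts; have [/andP[axi xib] N4 kap_le offsetP signs] := ok.
have ab := lt_trans axi xib; have u0 := cell_gt0 ab N4; have uw := cell_le ab N4.
have := boundary_points_bounds ok pts.
move: (cell a b N) u0 uw => u u0 uw [/andP[l1 l2] /andP[r1 r2]].
have ku : kap * u <= 1 / 32 * u by rewrite ler_wpM2r// ltW.
have mlab : a <= ml <= b by clear - l1 l2 ku u0 uw; apply/andP; split; lra.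
have mrab : a <= mr <= b by clear - r1 r2 ku u0 uw; apply/andP; split; lra.
rewrite !signs ?lexx ?(ltW ab)// nmulr_rlt0 ?subr_lt0// subr_gt0.
rewrite pmulr_rlt0 ?subr_gt0// subr_lt0.
by split; [clear - l1|clear - r1]; lra.
Qed.

(* The approximation is then so far off that the value at the point s inside
   the cluster is comparable with the cell width. *)
Lemma lucky_value a b N v s t a' b' (u := cell a b N) :
  kap <= 3 / 128 -> state_ok a b N -> (0 < v)%N ->
  pair_success P K h a b N s t a' b' \/ pair_success P K h a b N t s a' b' ->
  a <= t <= b -> 13 / 64 * (b - a) <= `|s - t| ->
  `|s - xi| < u / 8000 -> ~ accurate P xi v u s -> accurate P xi v u t ->
  u / 4000 < `|v%:R * newton_quotient P s| <= 40 * u.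
Proof.
move=> kap_small ok v0 ps tab st sxi nacc acc.
have [/andP[axi xib] N4 _ offsetP signs] := ok.
have ab := lt_trans axi xib; have u0 := cell_gt0 ab N4; have uw := cell_le ab N4.
rewrite -/u in u0 uw.
have Ps : P^`().[s] != 0 by case: ps => -[].
have vne : newton_quotient P s - newton_quotient P t != 0.
  by rewrite subr_eq0; case: ps => -[_ _ ne _] //; rewrite eq_sym.
have [lam [lamE lamx]] : exists lam, lam = secant P s t /\ `|lam - xi| <= 43 / 20 * u.
  case: ps => ps; have [_ _ _ _ lx] := pair_success_bounds ok ps.
    by exists (secant P s t).
  exists (secant P t s); split=> //; rewrite /secant.
  by field; rewrite vne -opprB oppr_eq0 vne.
have {}lamE : (lam - s) * (newton_quotient P s - newton_quotient P t) =
    (t - s) * newton_quotient P s.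
  by rewrite lamE /secant; field.
have v0' : 0 < v%:R :> R by rewrite ltr0n.
set x := v%:R * newton_quotient P s.
set y := v%:R * newton_quotient P t.
(* The secant equation without denominators: lam - s is a few cells, t - s a fixed fraction of w,
   and y at most about w, so x is at most a constant number of cells. *)
have {}lamE : (lam - s) * (x - y) = (t - s) * x.
  by rewrite /x /y -mulrBr mulrCA lamE mulrCA.
have x1 : u / 2000 < `|x - (s - xi)|.
  by rewrite ltNge; apply/negP => H; apply: nacc.
have y1 : `|y| <= 101 / 100 * (b - a).
  case: acc => _; rewrite -/y => acc.
  have := ler_normD (y - (t - xi)) (t - xi); rewrite subrK => H.
  have tx : `|t - xi| <= b - a.
    case/andP: tab => ta tb; clear - axi xib ta tb.
    by rewrite ler_norml; apply/andP; split; lra.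
  by clear - H tx acc uw u0; lra.
apply/andP; split.
  have := ler_normB x (s - xi) => H; clear - H x1 sxi u0; lra.
have ls : `|lam - s| <= 216 / 100 * u.
  have := ler_normB (lam - xi) (s - xi).
  have -> : lam - xi - (s - xi) = lam - s by ring.
  move=> H; clear - H lamx sxi u0; lra.
have : `|t - s| * `|x| <= 216 / 100 * u * (`|x| + 101 / 100 * (b - a)).
  rewrite -normrM -lamE normrM; apply: ler_pM => //.
  by apply: le_trans (ler_normB _ _) _; rewrite lerD2l.
rewrite distrC => H.
have H2 : 13 / 64 * (b - a) * `|x| <= `|s - t| * `|x| by rewrite ler_wpM2r.
have H3 : u * `|x| <= 1 / 16 * (b - a) * `|x| by rewrite ler_wpM2r//; clear - uw; lra.
have w0 : 0 < b - a by rewrite subr_gt0.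
rewrite -(ler_pM2l w0); clear - H H2 H3 u0 w0.
have uw0 : 0 < u * (b - a) by rewrite mulr_gt0.
lra.
Qed.

End Positions.

(* The equation (1/4 + i eps) = (3/4 + i' eps) (1/2 + 8 j eps) with
   eps = 1 / (32 H): a grid point close to one quarter of an interval lies, after
   a bisection, close to three quarters of the new one. *)
Lemma quarter_equation (h : nat) (H i i' j : int) : (2 <= h)%N -> H = (2 ^ h)%N :> int ->
  - (H + 2) <= 2 * i <= H + 2 -> - (H + 2) <= 2 * i' <= H + 2 ->
  - (H + 2) <= 2 * j <= H + 2 ->
  4 * H * (8 * H + i) = (24 * H + i') * (2 * H + j) -> i' = 0 /\ i <> 0.
Proof.
move=> h2 HE /andP[i1 i2] /andP[i3 i4] /andP[j1 j2] E.
(* For H >= 32 the two sides never meet: the left one is at most 34 H^2 + 4 H, the right one at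
   least (141 H^2 - 100 H + 4)/4. For H = 4, 8, 16 all values of j are tried. *)
have [h5|] := leqP 5 h.
  have H32 : 32 <= H by rewrite HE lez_nat (@leq_pexp2l 2 5 h).
  have : (47 * H - 2) * (3 * H - 2) <= (48 * H + 2 * i') * (4 * H + 2 * j).
    by apply: ler_pM; lia.
  by clear HE; nia.
case: h h2 HE => [|[|[|[|[|h]]]]] // _ HE _.
- have {}HE : H = 4 by rewrite HE.
  subst H; have : j \in [:: -3; -2; -1; 0; 1; 2; 3 : int] by rewrite !inE; lia.
  by rewrite !inE => /or4P[|||/or4P[]] /eqP jE; subst j; lia.
- have {}HE : H = 8 by rewrite HE.
  subst H; have : j \in [:: -5; -4; -3; -2; -1; 0; 1; 2; 3; 4; 5 : int].
    by rewrite !inE; lia.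
  by rewrite !inE => /or4P[|||/or4P[|||/or4P[||| /orP[]]]] /eqP jE; subst j; lia.
- have {}HE : H = 16 by rewrite HE.
  subst H; have : j \in [:: -9; -8; -7; -6; -5; -4; -3; -2; -1; 0; 1; 2; 3; 4; 5; 6; 7; 8; 9 : int].
    by rewrite !inE; lia.
  by rewrite !inE => /or4P[|||/or4P[|||/or4P[|||/or4P[|||/or4P[|||/or4P[]]]]]] /eqP jE;
    subst j; lia.
Qed.

(** * Grids through the points of a run *)

Definition on_grid (R : realFieldType) (c g x : R) : Prop :=
  exists z : int, x = c + g * z%:~R.

Lemma on_grid_refine (R : realFieldType) (c g x : R) m : (0 < m)%N ->
  on_grid c g x -> on_grid c (g / m%:R) x.
Proof.
move=> m0 [z ->]; exists (m%:Z * z); rewrite intrM.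
have m0' : m%:R != 0 :> R by rewrite pnatr_eq0 -lt0n.
by rewrite -pmulrn; field.
Qed.

Lemma on_grid_eq (R : realFieldType) (c g x y : R) :
  on_grid c g x -> on_grid c g y -> `|x - y| < g -> x = y.
Proof.
move=> [z ->] [t ->]; have -> : c + g * z%:~R - (c + g * t%:~R) = g * (z - t)%:~R.
  by rewrite intrB; ring.
have [g0|g0] := ltP 0 g; last by rewrite ltNge (le_trans g0).
rewrite normrM (gtr0_norm g0) gtr_pMr// -intr_norm -[1]/(1%:~R) ltr_int => zt.
have -> // : z = t by lia.
Qed.

Lemma epsE (R : realFieldType) h : eps R h = (32 * 2 ^+ h)^-1.
Proof. by rewrite /eps exprD -natrX. Qed.

Section Grid.
Variables (R : realFieldType) (P : {poly R}) (n K h : nat).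
Implicit Types (a b c g s t : R) (N : nat) (x : R * R * R).

Lemma samples_on_grid c g a b x : on_grid c g a -> on_grid c g b ->
  samples K h a b x ->
  [/\ on_grid c (g * eps R h) x.1.1, on_grid c (g * eps R h) x.1.2
    & on_grid c (g * eps R h) x.2].
Proof.
move=> [A ->] [B ->]; have h0 : 2 ^+ h != 0 :> R by rewrite expf_neq0// pnatr_eq0.
have main (q : nat) (d : R) : offset K h d ->
    on_grid c (g * eps R h)
      (c + g * A%:~R + (q%:R / 4 + d) * (c + g * B%:~R - (c + g * A%:~R))).
  move=> [i _ ->]; exists (32 * 2 ^+ h * A + (8 * 2 ^+ h * q%:Z + i) * (B - A)).
  by rewrite !(intrD, intrM, rmorphXn, intrB) /= epsE -!pmulrn; field.
case=> [[d1 /(main 1%N) g1 ->] [d2 /(main 2) g2 ->] [d3 /(main 3) g3 ->]]; split=> //.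
by have -> : 1 / 2 = 2%:R / 4 :> R by field.
Qed.

(** Every end point that an iteration can choose is a + z (b - a) eps/N or b - z (b - a) eps/N with
    an integer z. The grid is therefore refined by the factor 32 * 2^h * N, whatever the choices. *)
Lemma step_on_grid c g a b N x a' b' : (0 < N)%N ->
  on_grid c g a -> on_grid c g b ->
  success_step P n K h a b N x a' b' \/ bisection_step P n K h a b N x a' b' ->
  on_grid c (g * eps R h / N%:R) a' /\ on_grid c (g * eps R h / N%:R) b'.
Proof.
move=> N0 ga gb; have h0 : 2 ^+ h != 0 :> R by rewrite expf_neq0// pnatr_eq0.
have N0' : N%:R != 0 :> R by rewrite pnatr_eq0 -lt0n.
have fine y : on_grid c g y -> on_grid c (g * eps R h / N%:R) y.
  move=> gy; apply: on_grid_refine => //.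
  have -> : eps R h = (32 * 2 ^ h)%:R^-1 by rewrite epsE natrM natrX.
  by apply: on_grid_refine => //; rewrite muln_gt0 expn_gt0.
have fa := fine _ ga; have fb := fine _ gb.
have wide m1 m2 : on_grid c (g * eps R h / N%:R) m1 -> on_grid c (g * eps R h / N%:R) m2 ->
   ([/\ P.[a] * P.[m1] < 0, a' = a & b' = m1] \/
    [/\ P.[b] * P.[m2] < 0, a' = m2 & b' = b]) ->
  on_grid c (g * eps R h / N%:R) a' /\ on_grid c (g * eps R h / N%:R) b'.
  by move=> g1 g2 [] [_ -> ->].
move: ga gb fa fb wide {fine} => [A aE] [B bE] fa fb wide.
have quart d y : offset K h d -> (y = a + (1 / 2 + 8 * d) * ((b - a) / N%:R) \/
    y = b - (1 / 2 + 8 * d) * ((b - a) / N%:R)) -> on_grid c (g * eps R h / N%:R) y.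
  move=> [i _ ->] []->; rewrite aE bE.
    exists (32 * 2 ^+ h * N%:Z * A + (16 * 2 ^+ h + 8 * i) * (B - A)).
    by rewrite !(intrD, intrM, rmorphXn, intrB) /= epsE -!pmulrn; field; rewrite ?h0 ?N0'.
  exists (32 * 2 ^+ h * N%:Z * B - (16 * 2 ^+ h + 8 * i) * (B - A)).
  by rewrite !(intrB, intrD, intrM, rmorphXn) /= epsE -!pmulrn; field; rewrite ?h0 ?N0'.
case=> [[nw|[_ [ml [mr [[[d1 o1 ml1] [d2 o2 mr2]] side]]]]]|].
- have [s [t [_ _ _ [_ [l [y [z [_ [i _ ->] [j _ ->] aE' bE']]]] _]]]] :
      exists s t, pair_success P K h a b N s t a' b'.
    by case: nw; [exists x.1.1, x.1.2|exists x.1.1, x.2|exists x.1.2, x.2].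
  split.
    rewrite aE'; case: ifP => _ //; rewrite aE bE /cell.
    exists (32 * 2 ^+ h * N%:Z * A + ((l - 1) * 8 * 2 ^+ h + i) * (B - A)).
    by rewrite !(intrB, intrD, intrM, rmorphXn) /= epsE -!pmulrn; field; rewrite ?h0 ?N0'.
  rewrite bE'; case: ifP => _ //; rewrite aE bE /cell.
  exists (32 * 2 ^+ h * N%:Z * A + ((l + 2) * 8 * 2 ^+ h + j) * (B - A)).
  by rewrite !(intrB, intrD, intrM, rmorphXn) /= epsE -!pmulrn; field; rewrite ?h0 ?N0'.
- apply: (wide ml mr) => //; first by apply: (quart d1) => //; left.
  by apply: (quart d2) => //; right.
- case=> _ _ [d [[i _ dE] _ side]].
  have gm : on_grid c (g * eps R h / N%:R) (a + (1 / 2 + 8 * d) * (b - a)).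
    rewrite aE bE dE; exists (32 * 2 ^+ h * N%:Z * A + (16 * 2 ^+ h + 8 * i) * N%:Z * (B - A)).
    by rewrite !(intrB, intrD, intrM, rmorphXn) /= epsE -!pmulrn; field; rewrite ?h0 ?N0'.
  by case: side => -[_ -> ->].
Qed.

Definition quarter_index (G a b : R) (i : int) : Prop :=
  G = a + (1 / 4 + i%:~R * eps R h) * (b - a) \/
  G = b - (1 / 4 + i%:~R * eps R h) * (b - a).

Lemma samples_quarter_index a b x : samples K h a b x ->
  (exists2 i : int, (`|i| <= K)%N & quarter_index x.1.1 a b i) /\
  (exists2 i : int, (`|i| <= K)%N & quarter_index x.2 a b i).
Proof.
case=> [[_ [i iK ->] ->] _ [_ [j jK ->] ->]]; split; first by exists i => //; left.
exists (- j); first by rewrite abszN.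
by right; rewrite rmorphN /=; field.
Qed.

(** G is near a quarter before and after the bisection. Measured from the end that is kept, a second
    quarter would need a bisection point near the far end, so G is about three quarters away from
    it; the resulting equality of grid points is [quarter_equation], with the sign of i'
    reversed. *)
Lemma bisection_quarter_index (kap xi G : R) a b N x a' b' (i i' : int) :
  kap <= 3 / 128 -> (2 <= h)%N -> (2 * K <= 2 ^ h + 2)%N ->
  state_ok P K h xi kap a b N -> bisection_step P n K h a b N x a' b' ->
  `|G - xi| <= (b - a) / 1000 ->
  (`|i| <= K)%N -> (`|i'| <= K)%N ->
  quarter_index G a b i -> quarter_index G a' b' i' -> i' = 0 /\ i <> 0.
Proof.
move=> kap_small h2 Kh ok bi Gxi iK i'K qi qi'.
have [/andP[axi xib] N4 kap_le offsetP signs] := ok.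
have w0 : 0 < b - a by rewrite subr_gt0 (lt_trans axi).
have off (j : int) : (`|j| <= K)%N -> - (3 / 128) <= j%:~R * eps R h <= 3 / 128.
  move=> jK; have /andP[o1 o2] : - kap <= j%:~R * eps R h <= kap by apply: offsetP; exists j.
  by clear - o1 o2 kap_small; apply/andP; split; lra.
have offw (j : int) w : (`|j| <= K)%N -> 0 <= w ->
    - (3 / 128 * w) <= j%:~R * eps R h * w <= 3 / 128 * w.
  by move=> /off/andP[o1 o2] w00; rewrite -mulNr !ler_wpM2r.
have /andP[x1 x2] : - ((b - a) / 1000) <= G - xi <= (b - a) / 1000 by rewrite -ler_norml.
have /andP[o1 o2] := offw i (b - a) iK (ltW w0).
have qu : quarter xi a b.
  case: qi => GE; [left|right]; move: (i%:~R * eps R h) GE o1 o2 => t GE o1 o2.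
    by clear - GE x1 x2 o1 o2 w0; apply/andP; split; lra.
  by clear - GE x1 x2 o1 o2 w0; apply/andP; split; lra.
have [_ [d [[j jK dE] ma mb side]]] := bisection_from_quarter kap_small ok qu bi.
have boundK (m : int) : (`|m| <= K)%N -> - ((2 ^ h)%N%:Z + 2) <= 2 * m <= (2 ^ h)%N%:Z + 2.
  by clear - Kh; move: (2 ^ h)%N Kh => H; lia.
have h0 : 0 < 2 ^+ h :> R by rewrite exprn_gt0.
have h0' := lt0r_neq0 h0.
have HE : (2 ^+ h : R) = (2 ^ h)%N%:Z%:~R by rewrite -pmulrn natrX.
have toint (m : int) : (1 / 4 + i%:~R * eps R h) * (b - a) =
    (3 / 4 - i'%:~R * eps R h) * ((1 / 2 + 8 * (m%:~R * eps R h)) * (b - a)) ->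
    (`|m| <= K)%N -> i' = 0 /\ i <> 0.
  move=> E mK.
  have [] := @quarter_equation h _ i (- i') m h2 erefl (boundK _ iK) _ (boundK _ mK).
  - by apply: boundK; rewrite abszN.
  - apply: (@intr_inj R); rewrite !(intrD, intrM, intrN) -HE /=.
    apply: (mulIf (lt0r_neq0 w0)); move: E; rewrite epsE => E.
    transitivity (128 * 2 ^+ h * 2 ^+ h *
        ((1 / 4 + i%:~R * (32 * 2 ^+ h)^-1) * (b - a))); first by field.
    by rewrite E; field.
  - by move=> /eqP; rewrite oppr_eq0 => /eqP.
case: side => -[/andP[q1 q2] [aE bE]]; rewrite {}aE {}bE in qi'.
  have GE : G - a = (1 / 4 + i%:~R * eps R h) * (b - a).
    case: qi => GE; first by rewrite GE; ring.
    by exfalso; move: (i%:~R * eps R h) GE o1 o2 => t GE o1 o2; clear - GE x1 x2 o1 o2 w0 q2; lra.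
  move: qi' ma mb; set m := a + _ => qi' ma mb.
  have m0 : 0 <= m - a by clear - ma w0; lra.
  have /andP[p1 p2] := offw i' (m - a) i'K m0.
  case: qi' => GE'; first by exfalso; clear - GE GE' o1 o2 p1 p2 mb w0; lra.
  apply: (toint j) => //; rewrite -GE GE' -dE.
  have -> : (1 / 2 + 8 * d) * (b - a) = m - a by rewrite /m; ring.
  by field.
have GE : b - G = (1 / 4 + i%:~R * eps R h) * (b - a).
  case: qi => GE; last by rewrite GE; ring.
  by exfalso; move: (i%:~R * eps R h) GE o1 o2 => t GE o1 o2; clear - GE x1 x2 o1 o2 w0 q2; lra.
move: qi' ma mb; set m := a + _ => qi' ma mb.
have m0 : 0 <= b - m by clear - mb w0; lra.
have /andP[p1 p2] := offw i' (b - m) i'K m0.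
case: qi' => GE'; last by exfalso; clear - GE GE' o1 o2 p1 p2 ma w0; lra.
apply: (toint (- j)); last by rewrite abszN.
rewrite -GE GE' intrN mulNr -dE.
have -> : (1 / 2 + 8 * - d) * (b - a) = b - m by rewrite /m; field.
by field.
Qed.
End Grid.

Definition speed_of (e : nat) : nat := (2 ^ (2 ^ e))%N.

Lemma speed_of_ge4 e : (0 < e)%N -> (4 <= speed_of e)%N.
Proof.
move=> e0; rewrite /speed_of (@leq_pexp2l 2 2)//.
by rewrite -{1}(expn1 2) leq_pexp2l.
Qed.

Lemma speed_ofS e : speed_of e.+1 = (speed_of e ^ 2)%N.
Proof. by rewrite /speed_of expnS mulnC expnM. Qed.

Definition is_sample (R : realFieldType) (x : R * R * R) (y : R) : Prop :=
  [\/ y = x.1.1, y = x.1.2 | y = x.2].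

Section StepCases.
Variables (R : realFieldType) (P : {poly R}) (n K h : nat) (kap xi : R).
Implicit Types (a b s t rho : R) (N v : nat) (x : R * R * R).
Local Notation state_ok := (state_ok P K h xi kap).

Lemma near_quarter a b N rho x y : kap <= 3 / 128 -> state_ok a b N ->
  samples K h a b x -> rho <= cell a b N / 8000 ->
  y = x.1.1 \/ y = x.2 -> `|y - xi| < rho -> quarter xi a b.
Proof.
move=> kap_small [/andP[axi xib] N4 _ offsetP _] xs rhou yx.
have ab := lt_trans axi xib; have u0 := cell_gt0 ab N4; have uw := cell_le ab N4.
have w0 : 0 < b - a by rewrite subr_gt0.
have kw : kap * (b - a) <= 3 / 128 * (b - a) by rewrite ler_wpM2r// ltW.
have [/andP[x1a x1b] _ /andP[x3a x3b]] := samples_bounds ab offsetP xs.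
rewrite ltr_norml => /andP[y1 y2].
have {}rhou : rho <= cell a b N / 1000 by clear - rhou u0; lra.
by case: yx => yE; rewrite yE in y1 y2; [left|right]; apply/andP; split;
  [clear - x1a y2 kw uw rhou u0 w0|clear - x1b y1 kw uw rhou u0 w0
  |clear - x3b y1 kw uw rhou u0 w0|clear - x3a y2 kw uw rhou u0 w0]; lra.
Qed.

Lemma sample_in a b N x y : state_ok a b N -> samples K h a b x -> is_sample x y ->
  a <= y <= b.
Proof.
move=> [/andP[axi xib] N4 kap_le offsetP _] xs.
have ab := lt_trans axi xib; have w0 : 0 < b - a by rewrite subr_gt0.
have kw : kap * (b - a) <= 1 / 32 * (b - a) by rewrite ler_wpM2r// ltW.
have [/andP[x1a x1b] /andP[x2a x2b] /andP[x3a x3b]] := samples_bounds ab offsetP xs.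
by case=> ->; apply/andP; split; [clear - x1a kw w0|clear - x1b kw w0|clear - x2a kw w0
  |clear - x2b kw w0|clear - x3a kw w0|clear - x3b kw w0]; lra.
Qed.

Lemma newton_step_pair a b N x a' b' : state_ok a b N -> samples K h a b x ->
  newton_step P K h a b N x a' b' ->
  exists s t, [/\ is_sample x s, is_sample x t, pair_success P K h a b N s t a' b'
    & (1 / 4 - 2 * kap) * (b - a) <= `|s - t|].
Proof.
move=> [/andP[axi xib] N4 kap_le offsetP _] xs.
have ab := lt_trans axi xib; have w0 : 0 < b - a by rewrite subr_gt0.
have kw : kap * (b - a) <= 1 / 32 * (b - a) by rewrite ler_wpM2r// ltW.
have [/andP[x1a x1b] /andP[x2a x2b] /andP[x3a x3b]] := samples_bounds ab offsetP xs.
have dist (p q : R) : (1 / 4 - 2 * kap) * (b - a) <= q - p ->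
    (1 / 4 - 2 * kap) * (b - a) <= `|p - q|.
  by move/le_trans; apply; rewrite distrC ler_norm.
case=> H.
- exists x.1.1, x.1.2; split=> //; [exact: Or31|exact: Or32|apply: dist].
  by clear - x1b x2a; lra.
- exists x.1.1, x.2; split=> //; [exact: Or31|exact: Or33|apply: dist].
  by clear - x1b x3a w0; lra.
- exists x.1.2, x.2; split=> //; [exact: Or32|exact: Or33|apply: dist].
  by clear - x2b x3a; lra.
Qed.

Definition accurate_off a b N rho v : Prop := forall y, a <= y <= b ->
  rho <= `|y - xi| -> accurate P xi v (cell a b N) y.

(** If both outer points were accurate, xi would be so close to an end that the boundary test
    succeeds. *)
Lemma bisection_near a b N rho v x a' b' : state_ok a b N -> samples K h a b x ->
  (0 < v)%N -> (v <= n)%N -> accurate_off a b N rho v ->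
  bisection_step P n K h a b N x a' b' ->
  exists2 y, y = x.1.1 \/ y = x.2 & `|y - xi| < rho.
Proof.
move=> ok xs v0 vn acc [fail [ml [mr [pts nl nr]]] _].
have [x1|x1] := ltP `|x.1.1 - xi| rho; first by exists x.1.1 => //; left.
have [x3|x3] := ltP `|x.2 - xi| rho; first by exists x.2 => //; right.
have A1 := acc _ (sample_in ok xs (Or31 _ _ erefl)) x1.
have A3 := acc _ (sample_in ok xs (Or33 _ _ erefl)) x3.
have [/andP[axi xib] N4 _ _ _] := ok.
have u0 := cell_gt0 (lt_trans axi xib) N4.
have u1 : cell a b N / 100 < cell a b N by lra.
have [el er] := edge_boundary ok pts.
case: (accurate_near_edge ok v0 vn xs A1 A3 fail) => H.
  by move: nl; rewrite el// (le_lt_trans H).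
by move: nr; rewrite er// (le_lt_trans H).
Qed.

(** The points of a pair are at least 13/64 w apart, so at most one is within [rho] of xi. If it is
    inaccurate, [lucky_value] applies; otherwise the secant is accurate. A boundary success cannot
    start from an inner xi: failure of the outer pair puts xi at a quarter, which excludes that
    success, or next to an end. *)
Lemma success_cases a b N rho v x a' b' : kap <= 3 / 128 ->
  state_ok a b N -> samples K h a b x ->
  (0 < v)%N -> (v <= n)%N -> accurate_off a b N rho v -> rho <= cell a b N / 8000 ->
  success_step P n K h a b N x a' b' ->
  (exists y, [/\ is_sample x y, `|y - xi| < rho &
     cell a b N / 4000 < `|v%:R * newton_quotient P y| <= 40 * cell a b N]) \/
  (inner (1 / 10) xi a b -> inner (29 / 100) xi a' b').
Proof.
move=> kap_small ok xs v0 vn acc rhou.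
have [/andP[axi xib] N4 kap_le offsetP _] := ok.
have ab := lt_trans axi xib; have w0 : 0 < b - a by rewrite subr_gt0.
have u0 := cell_gt0 ab N4; have uw := cell_le ab N4.
have kw : kap * (b - a) <= 3 / 128 * (b - a) by rewrite ler_wpM2r// ltW.
case=> [nw|[fail [ml [mr [pts side]]]]]; last first.
  right=> -[i1 i2]; exfalso.
  have [qu|[H|H]] : quarter xi a b \/ (xi - a <= cell a b N / 100 \/ b - xi <= cell a b N / 100).
  - have [x1|x1] := ltP `|x.1.1 - xi| rho.
      by left; apply: (near_quarter kap_small ok xs rhou _ x1); left.
    have [x3|x3] := ltP `|x.2 - xi| rho.
      by left; apply: (near_quarter kap_small ok xs rhou _ x3); right.
    right; apply: (accurate_near_edge ok v0 vn xs _ _ fail).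
    - exact: acc _ (sample_in ok xs (Or31 _ _ erefl)) x1.
    - exact: acc _ (sample_in ok xs (Or33 _ _ erefl)) x3.
  - have [nl nr] := boundary_not_quarter kap_small ok pts qu.
    by case: side => -[neg _ _]; [move: nl|move: nr]; rewrite neg.
  - by clear - H i1 uw u0; lra.
  - by clear - H i2 uw u0; lra.
have [s [t [sx tx ps st]]] := newton_step_pair ok xs nw.
have st' : 13 / 64 * (b - a) <= `|s - t|.
  by apply: le_trans st; clear - kw w0 uw; lra.
have sab := sample_in ok xs sx; have tab := sample_in ok xs tx.
have rho_half : rho <= 1 / 16 * (b - a) by clear - rhou uw u0; lra.
have [sn|sn] := ltP `|s - xi| rho; last first.
  have As := acc _ sab sn; have [tn|tn] := ltP `|t - xi| rho; last first.
    right=> inn; apply: (accurate_success_inner kap_small ok inn ps).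
    apply: (secant_accurate _ N4 v0 As (acc _ tab tn) sab tab); first by rewrite axi.
    by apply: le_trans st'; clear - w0 uw; lra.
  have [At|nAt] : accurate P xi v (cell a b N) t \/ ~ accurate P xi v (cell a b N) t.
    rewrite /accurate; case: (_ != 0); last by right; case.
    by case: (_ <= _); [left|right; case].
  - right=> inn; apply: (accurate_success_inner kap_small ok inn ps).
    apply: (secant_accurate _ N4 v0 As At sab tab); first by rewrite axi.
    by apply: le_trans st'; clear - w0 uw; lra.
  left; exists t; split=> //.
  apply: (lucky_value kap_small ok v0 (or_intror ps) sab _ _ nAt As).
    by rewrite distrC.
  exact: lt_le_trans rhou.
have tn : rho <= `|t - xi|.
  have := ler_normB (s - xi) (t - xi).
  have -> : s - xi - (t - xi) = s - t by ring.
  by clear - sn st' rho_half w0; lra.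
have At := acc _ tab tn.
have [As|nAs] : accurate P xi v (cell a b N) s \/ ~ accurate P xi v (cell a b N) s.
  rewrite /accurate; case: (_ != 0); last by right; case.
  by case: (_ <= _); [left|right; case].
- right=> inn; apply: (accurate_success_inner kap_small ok inn ps).
  apply: (secant_accurate _ N4 v0 As At sab tab); first by rewrite axi.
  by apply: le_trans st'; clear - w0 uw; lra.
left; exists s; split=> //.
apply: (lucky_value kap_small ok v0 (or_introl ps) tab st' _ nAs At).
exact: lt_le_trans rhou.
Qed.

End StepCases.

(** * Windows of iterations *)

Section Window.
Variables (R : realFieldType) (P : {poly R}) (n K h : nat) (kap xi : R).
Implicit Types (a b rho c g : R) (N v W : nat) (x : R * R * R).
Local Notation state_ok := (state_ok P K h xi kap).

Definition real_step x a b e a' b' e' (s : bool) : Prop :=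
  samples K h a b x /\
  if s then success_step P n K h a b (speed_of e) x a' b' /\ e' = e.+1
  else bisection_step P n K h a b (speed_of e) x a' b' /\ e' = maxn 1 e.-1.

Lemma real_step_ok x a b e a' b' e' (s : bool) : state_ok a b (speed_of e) -> (0 < e)%N ->
  real_step x a b e a' b' e' s ->
  [/\ state_ok a' b' (speed_of e'), (0 < e')%N, a <= a' /\ b' <= b,
     (e <= e'.+1)%N /\ (s -> e' = e.+1)
    & if s then b' - a' <= (b - a) / (speed_of e)%:R else b' - a' <= 3 / 4 * (b - a)].
Proof.
move=> ok e0 [xs]; have [/andP[axi xib] N4 kap_le offsetP signs] := ok.
have trans : a <= a' -> b' <= b -> a' < xi < b' -> (0 < e')%N ->
    state_ok a' b' (speed_of e').
  move=> aa bb xi' e'0; split=> //; first exact: speed_of_ge4.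
  move=> y z /andP[y1 y2] /andP[z1 z2]; apply: signs.
    by rewrite (le_trans aa) ?(le_trans y2).
  by rewrite (le_trans aa) ?(le_trans z2).
case: s => -[st e'E].
  have [aa bb xi' wd] := success_step_bounds ok st.
  split=> //; first by apply: trans; rewrite ?e'E.
  - by rewrite e'E.
  - by rewrite e'E; split=> //; clear; lia.
have [aa bb xi' wd] := bisection_step_bounds ok st.
have e'0 : (0 < e')%N by rewrite e'E leq_max.
by split=> //; [exact: trans|split=> //; rewrite e'E; clear; lia].
Qed.

Definition trajectory W (A B : nat -> R) (E : nat -> nat) (X : nat -> R * R * R)
    (S : nat -> bool) : Prop :=
  forall i, (i < W)%N ->
    real_step (X i) (A i) (B i) (E i) (A i.+1) (B i.+1) (E i.+1) (S i).

Lemma trajectory_ok W A B E X S : trajectory W A B E X S ->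
  state_ok (A 0%N) (B 0%N) (speed_of (E 0%N)) -> (0 < E 0%N)%N ->
  forall i, (i <= W)%N -> state_ok (A i) (B i) (speed_of (E i)) /\ (0 < E i)%N.
Proof.
move=> tr ok0 E0; elim=> [//|i IH] iW.
have [ok e0] := IH (ltnW iW).
by have [] := real_step_ok ok e0 (tr i iW).
Qed.

(** Each bisection has an outer sample point within [rho] of xi, and on a grid of step at least 2
    [rho] these points coincide. The first two bisections give this point the quarter index 0, the
    last two a nonzero one, both at the middle interval. *)
Lemma no_three_bisections (A B : nat -> R) (E : nat -> nat) (X : nat -> R * R * R) rho v c g i :
  kap <= 3 / 128 -> (2 <= h)%N -> (2 * K <= 2 ^ h + 2)%N -> (0 < v)%N -> (v <= n)%N ->
  2 * rho <= g ->
  (forall j, (i <= j < i.+3)%N -> [/\ real_step (X j) (A j) (B j) (E j) (A j.+1) (B j.+1) (E j.+1) false,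
     state_ok (A j) (B j) (speed_of (E j)),
     accurate_off P xi (A j) (B j) (speed_of (E j)) rho v,
     rho <= cell (A j) (B j) (speed_of (E j)) / 8000
     & forall y, is_sample (X j) y -> on_grid c g y]) -> False.
Proof.
move=> kap_small h2 Kh v0 vn rg H.
have near j : (i <= j < i.+3)%N -> exists y k, [/\ `|y - xi| < rho,
    `|y - xi| <= (B j - A j) / 1000,
    on_grid c g y, (`|k| <= K)%N & quarter_index h y (A j) (B j) k].
  move=> /H[[xs [bi _]] ok acc rhou gr].
  have [y yx yn] := bisection_near ok xs v0 vn acc bi.
  have [[k1 k1K q1] [k2 k2K q2]] := samples_quarter_index xs.
  have yw : `|y - xi| <= (B j - A j) / 1000.
    have [/andP[axi xib] N4 _ _ _] := ok.
    have := cell_le (lt_trans axi xib) N4; have := cell_gt0 (lt_trans axi xib) N4.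
    move: (cell _ _ _) rhou => u rhou u0 uw; clear - yn rhou u0 uw; lra.
  have yg : on_grid c g y.
    by apply: gr; case: yx => ->; [exact: Or31|exact: Or33].
  by case: yx => yE; exists y; [exists k1|exists k2]; split=> //; rewrite yE.
have same j y k z : `|y - xi| < rho -> `|z - xi| < rho -> on_grid c g y -> on_grid c g z ->
    quarter_index h z (A j) (B j) k -> quarter_index h y (A j) (B j) k.
  move=> yn zn yg zg; suff -> : y = z by [].
  apply: (on_grid_eq yg zg); have := ler_normB (y - xi) (z - xi).
  have -> : y - xi - (z - xi) = y - z by ring.
  by move=> hh; clear - hh yn zn rg; lra.
have r0 : (i <= i < i.+3)%N by clear; lia.
have r1 : (i <= i.+1 < i.+3)%N by clear; lia.
have r2 : (i <= i.+2 < i.+3)%N by clear; lia.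
have [y [k [yn yw yg kK qk]]] := near _ r0.
have [y1 [k1 [yn1 yw1 yg1 kK1 qk1]]] := near _ r1.
have [y2 [k2 [yn2 yw2 yg2 kK2 qk2]]] := near _ r2.
have [[_ [bi _]] ok _ _ _] := H _ r0.
have [[_ [bi1 _]] ok1 _ _ _] := H _ r1.
have [k10 _] := bisection_quarter_index kap_small h2 Kh ok bi yw kK kK1 qk
  (same _ _ _ _ yn yn1 yg yg1 qk1).
have [_ []] := bisection_quarter_index kap_small h2 Kh ok1 bi1 yw1 kK1 kK2 qk1
  (same _ _ _ _ yn1 yn2 yg1 yg2 qk2).
exact: k10.
Qed.

Lemma window_gain A B E X S rho v c g :
  state_ok (A 0%N) (B 0%N) (speed_of (E 0%N)) -> (0 < E 0%N)%N ->
  trajectory 41 A B E X S -> (0 < v)%N -> (v <= n)%N -> 0 <= rho -> 2 * rho <= g ->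
  (0 < rho -> [/\ kap <= 3 / 128, (2 <= h)%N & (2 * K <= 2 ^ h + 2)%N]) ->
  (forall j, (j < 41)%N -> [/\
     accurate_off P xi (A j) (B j) (speed_of (E j)) rho v,
     rho <= cell (A j) (B j) (speed_of (E j)) / 8000
     & forall y, is_sample (X j) y -> on_grid c g y]) ->
  (E 0%N < E 41)%N.
Proof.
move=> ok0 E0 tr v0 vn rho0 rg small H.
have oks := trajectory_ok tr ok0 E0.
suff [nl [nf [en nl9 nfl]]] : exists nl nf,
    [/\ (E 0%N + 41 <= E 41 + 2 * nf)%N, (nl <= 9)%N & (nf <= 2 * nl + 2)%N] by clear - en nl9 nfl; lia.
(* For [rho] = 0 no point is nearer to xi than [rho], so bisections do not occur. *)
have [rho_pos|rho_zero] := ltP 0 rho; last first.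
  have {}rho_zero : rho = 0 by apply: le_anti; rewrite rho0 andbT.
  exists 0%N, 0%N; split=> //; rewrite muln0 addn0.
  suff : forall j, (j <= 41)%N -> (E 0%N + j <= E j)%N by apply.
  elim=> [_|j IH j41]; first by rewrite addn0.
  have [ok e0] := oks j (ltnW j41); have [acc _ _] := H j j41.
  have stp := tr j j41; have [_ _ _ [_ ES] _] := real_step_ok ok e0 stp.
  move: stp ES; case: (S j) => [_ -> //|[xs [bi _]] _].
    by rewrite addnS ltnS; exact: IH (ltnW j41).
  have [y _] := bisection_near ok xs v0 vn acc bi.
  by rewrite rho_zero normr_lt0.
have [kap_small h2 Kh] := small rho_pos.
pose value y := `|v%:R * newton_quotient P y|.
(* [nl] counts lucky successes. The first one leaves w <= 16000 |v p(y)/p'(y)|, and every later one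
   divides w by at least 4 at the same point y. *)
pose lucky i nl := nl = 0%N \/ (0 < nl <= 9)%N /\ exists j y, [/\ (j < 41)%N, is_sample (X j) y,
   `|y - xi| < rho & (B i - A i) * 4 ^+ nl.-1 <= 16000 * value y].
(* [nf] counts bisections. The four states: a fresh allowance of two bisections; one of them spent;
   two spent; or an accurate success after a bisection or at an inner position, which blocks
   bisections until the next lucky success renews the allowance. *)
pose ghost i nl nf := [\/ (nf <= 2 * nl)%N,
   [/\ (nf <= 2 * nl + 1)%N, inner (1 / 10) xi (A i) (B i), (0 < i)%N & S i.-1 = false],
   [/\ (nf <= 2 * nl + 2)%N, inner (1 / 10) xi (A i) (B i), (1 < i)%N
     & S i.-1 = false /\ S i.-2 = false]
   | (nf <= 2 * nl + 2)%N /\ inner (29 / 100) xi (A i) (B i)].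
suff main i : (i <= 41)%N -> exists nl nf,
    [/\ (E 0%N + i <= E i + 2 * nf)%N, lucky i nl & ghost i nl nf].
  have [nl [nf [en lk gh]]] := main 41%N isT; exists nl, nf; split=> //.
    by case: lk => [->//|[/andP[]]].
  by clear - gh; case: gh => [|[]|[]|[]] *; lia.
have inner_weak j : A j < B j -> inner (29 / 100) xi (A j) (B j) -> inner (1 / 10) xi (A j) (B j).
  by rewrite -subr_gt0 => w0 [i1 i2]; split; [clear - i1 w0|clear - i2 w0]; lra.
elim: i => [_|i IH i41].
  by exists 0%N, 0%N; split; [rewrite addn0|left|exact: Or41].
have [nl [nf [en lk gh]]] := IH (ltnW i41).
have [ok e0] := oks i (ltnW i41); have [acc rhou gr] := H i i41.
have [/andP[axi xib] N4 _ _ _] := ok; have ab := lt_trans axi xib.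
have u0 := cell_gt0 ab N4; have uw := cell_le ab N4.
have stp := tr i i41; have [_ _ _ [Ele ES] wd] := real_step_ok ok e0 stp.
have w0 : 0 < B i - A i by rewrite subr_gt0.
have wN : (B i - A i) / (speed_of (E i))%:R <= (B i - A i) / 4.
  by rewrite widthN//; clear - uw; lra.
have [ok' _] := oks i.+1 i41.
have w0' : 0 < B i.+1 - A i.+1.
  by case: ok' => /andP[h1 h3] _ _ _ _; rewrite subr_gt0 (lt_trans h1).
case SE : (S i) stp wd ES => -[xs stp] wd ES.
  have lucky_weak : lucky i.+1 nl.
    case: lk => [|[nl9 [j [y [j41 sy yn yb]]]]]; [by left|right; split=> //].
    exists j, y; split=> //; apply: le_trans yb; apply: ler_wpM2r; first by rewrite exprn_ge0.
    by apply: le_trans wd _; clear - wN w0; lra.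
  have [[y [sy yn /andP[y1 y2]]]|inn] :=
    success_cases kap_small ok xs v0 vn acc rhou stp.1; last first.
    exists nl, nf; split=> //; first by rewrite ES//; clear - en; lia.
    have inn' := inn; case: gh => [gh|[gh i1 _ _]|[gh i1 _ _]|[gh i1]].
    - exact: Or41.
    - by apply: Or44; split; [clear - gh; lia|exact: inn].
    - by apply: Or44; split; [clear - gh; lia|exact: inn].
    - by apply: Or44; split; [clear - gh; lia|apply: inn; exact: inner_weak].
  exists nl.+1, nf; split; first by rewrite ES//; clear - en; lia.
    right; case: lk => [->|[nl9 [j [z [j41 sz zn zb]]]]].
      split=> //; exists i, y; split=> //; rewrite expr0 mulr1 -/(value y).
      rewrite -/(value y) in y1; move: wd; rewrite widthN// => wd.
      by clear - y1 wd; lra.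
    have zy : z = y.
      have [_ _ gj] := H j j41; apply: (on_grid_eq (gj z sz) (gr y sy)).
      have := ler_normB (z - xi) (y - xi).
      have -> : z - xi - (y - xi) = z - y by ring.
      by move=> hh; clear - hh yn zn rg; lra.
    rewrite zy in zb; rewrite -/(value y) in y1 y2.
    (* |v p(y)/p'(y)| is at most 40 u <= 40 w/16, so 4^(nl-1) <= 16000 * 40/16 = 40000 < 4^8. *)
    have nl8 : (nl.-1 < 8)%N.
      rewrite ltnNge; apply/negP => nl8.
      have : 256 * 256 <= 4 ^+ nl.-1 :> R.
        have -> : 256 * 256 = 4 ^+ 8 :> R by ring.
        by rewrite ler_eXn2l// ltr1n.
      move/(ler_wpM2l (ltW w0)) => nl8'.
      by clear - nl8' zb y2 uw w0; lra.
    split; first by clear - nl8 nl9; lia.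
    exists i, y; split=> //; rewrite -/(value y).
    have -> : 4 ^+ nl.+1.-1 = 4 * 4 ^+ nl.-1 :> R.
      by rewrite -exprS prednK//; case/andP: nl9.
    rewrite mulrA; apply: le_trans zb; apply: ler_wpM2r; first by rewrite exprn_ge0.
    by clear - wN wd w0; lra.
  by apply: Or41; clear - gh; case: gh => [|[]|[]|[]] *; lia.
case: stp => bi eE.
have [y yx yn] := bisection_near ok xs v0 vn acc bi.
have qu := near_quarter kap_small ok xs rhou yx yn.
have [inn _] := bisection_from_quarter kap_small ok qu bi.
exists nl, nf.+1; split; first by clear - en Ele; lia.
  case: lk => [|[nl9 [j [z [j41 sz zn zb]]]]]; [by left|right; split=> //].
  exists j, z; split=> //; apply: le_trans zb; apply: ler_wpM2r; first by rewrite exprn_ge0.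
  by clear - wd w0; lra.
case: gh => [gh|[gh _ i0 S1]|[gh _ i1 [S1 S2]]|[_ i2]].
- by apply: Or42; split=> //; clear - gh; lia.
- by apply: Or43; split=> //=; clear - gh i0; lia.
- exfalso; case: i i1 i41 S1 S2 SE {wN en lk IH ok e0 acc rhou gr axi xib N4 ab u0 uw Ele ES wd w0 ok' w0' xs bi eE y yx yn qu inn gh} => [|[|i]] // _ i41 S1 S2 SE.
  apply: (@no_three_bisections A B E X rho v c g i) => // j /andP[ij ji].
  have j41 : (j < 41)%N by apply: leq_ltn_trans i41; rewrite -ltnS.
  have Sj : S j = false.
    have : j = i \/ j = i.+1 \/ j = i.+2 by clear - ij ji; lia.
    by case=> [->|[->|->]].
  have [acc rhou gr] := H j j41.
  have := tr j j41; rewrite Sj => stp.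
  by split=> //; have [] := oks j (ltnW j41).
- by exfalso; apply: quarter_not_inner ab qu i2.
Qed.

End Window.

(** * The number of iterations in a gap *)

Section Log2.
Variable R : realType.
Implicit Types (x y : R).

Lemma ln2_gt0 : 0 < ln 2 :> R. Proof. by apply: ln_gt0; rewrite ltr1n. Qed.

Lemma ln2_le1 : ln 2 <= 1 :> R.
Proof. by have := @le_ln1Dx R 1; rewrite -[1 + 1]/(2%:R); apply; lra. Qed.

Lemma log2_2 : log2 2 = 1 :> R.
Proof. by rewrite /log2 divff// lt0r_neq0// ln2_gt0. Qed.

Lemma log2M x y : 0 < x -> 0 < y -> log2 (x * y) = log2 x + log2 y.
Proof. by move=> x0 y0; rewrite /log2 lnM ?posrE// mulrDl. Qed.

Lemma log2X x k : 0 < x -> log2 (x ^+ k) = k%:R * log2 x.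
Proof. by move=> x0; rewrite /log2 lnXn// -[ln x *+ k]mulr_natl mulrA. Qed.

Lemma log2_exp2 k : log2 (2 ^+ k) = k%:R :> R.
Proof. by rewrite log2X// log2_2 mulr1. Qed.

Lemma ler_log2 x y : 0 < x -> x <= y -> log2 x <= log2 y.
Proof.
move=> x0 xy; rewrite /log2 ler_pM2r ?invr_gt0 ?ln2_gt0//.
by rewrite ler_ln ?posrE// (lt_le_trans x0).
Qed.

Lemma log2_ge0 x : 1 <= x -> 0 <= log2 x.
Proof. by move=> x1; apply: divr_ge0; [exact: ln_ge0|exact: ltW ln2_gt0]. Qed.

Lemma log2_drop x y d : 0 < y -> 0 <= d -> d < 1 -> y <= x * (1 - d) ->
  0 < x -> log2 y <= log2 x - d.
Proof.
move=> y0 d0 d1 yx x0.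
have d2 : 0 < 1 - d by rewrite subr_gt0.
apply: le_trans (ler_log2 y0 yx) _; rewrite log2M// lerD2l.
rewrite /log2 ler_pdivrMr ?ln2_gt0//.
have h : ln (1 - d) <= - d by apply: le_ln1Dx; lra.
apply: (le_trans h); rewrite mulNr lerN2.
by rewrite ler_piMr// ln2_le1.
Qed.

End Log2.

Section Gap.
Variable R : realType.

(* A trace records log2 of the relative width and the exponent e of the speed
   2^(2^e) during a run. *)
Definition gap_trace (T : nat) (L : nat -> R) (e : nat -> nat) (s : nat -> bool) : Prop :=
  forall i, (i < T)%N ->
    if s i then L i.+1 <= L i - 2 ^+ e i /\ e i.+1 = (e i).+1
    else L i.+1 <= L i - 1 / 4 /\ e i.+1 = maxn 1 (e i).-1.

Definition gap_data T L e s (X al : R) (M : nat) : Prop :=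
  [/\ gap_trace T L e s, forall i, (i <= T)%N -> 0 <= L i <= X,
     forall i, (i <= T)%N -> (1 <= e i <= M)%N, X <= 2 ^+ M & 2 <= al].

(** With X = log2(hi/lo), al = log2 Al and N = 2^(2^e), this is Al N w <= hi. *)
Definition far (L : nat -> R) (e : nat -> nat) (X al : R) i : Prop :=
  2 ^+ e i + al <= X - L i.

Lemma pow2_ge1 k : 1 <= 2 ^+ k :> R. Proof. by rewrite exprn_ege1// ler1n. Qed.

Lemma far_succ T L e s X al M i : gap_data T L e s X al M ->
  (i < T)%N -> far L e X al i -> far L e X al i.+1.
Proof.
move=> [tr Lb eb XM al2] iT; have := tr _ iT; have := pow2_ge1 (e i); rewrite /far.
case: (s i) => p1 [LS ->] fi; first by rewrite exprS; lra.
have : 2 ^+ (maxn 1 (e i).-1) <= 2 ^+ e i :> R.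
  rewrite ler_eXn2l ?ltr1n//; have /andP[] := eb _ (ltnW iT).
  by clear; lia.
by lra.
Qed.

Lemma far_le T L e s X al M i j : gap_data T L e s X al M ->
  (i <= j <= T)%N -> far L e X al i -> far L e X al j.
Proof.
move=> gd /andP[ij jT] fi; elim: j ij jT => [|j IH]; first by rewrite leqn0 => /eqP <-.
rewrite leq_eqVlt => /orP[/eqP <- //|ij jT].
by apply: (far_succ gd) => //; apply: IH => //; exact: ltnW.
Qed.

Lemma drop_quarter T L e s i j : gap_trace T L e s -> (i <= j <= T)%N -> L j <= L i - (j - i)%:R / 4.
Proof.
move=> tr /andP[ij jT]; elim: j ij jT => [|j IH].
  by rewrite leqn0 => /eqP ->; rewrite subnn mul0r subr0.
rewrite leq_eqVlt => /orP[/eqP <- _|ij jT]; first by rewrite subnn mul0r subr0.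
have := IH ij (ltnW jT); rewrite subSn// -[(_ - _).+1%:R]natr1 => IH'.
have := tr _ jT; have := pow2_ge1 (e j).
by case: (s j) => p1 [LS _]; clear - IH' LS p1; lra.
Qed.

(* The deficiency X - L - 2^e of the far condition does not decrease at a
   success, and its negative part is halved by a bisection. *)
Lemma far_eventually T L e s X al M i : gap_data T L e s X al M ->
  (i <= T)%N -> ~ far L e X al i ->
  i%:R <= 3 * M%:R + 8 * (al + 3).
Proof.
move=> [tr Lb eb XM al2] iT nfar.
(* [f] counts the bisections. The shift by 2 pays for e = 1, where a bisection no longer lowers e: a
   deficiency below -2 implies e > 1, so that 2^e is halved. After M bisections the deficiency is at
   least -3, and each further one adds 1/4. *)
have [f [f1 f2 f3]] : exists f : nat, [/\ (i <= M + 2 * f)%N,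
    - (2 ^+ M / 2 ^+ f) <= X - L i - 2 ^+ e i + 2
  & (M <= f)%N -> - 3 + (f%:R - M%:R) / 4 <= X - L i - 2 ^+ e i].
  suff [f [f1 f2 f3]] : exists f : nat, [/\ (e 0%N + i <= e i + 2 * f)%N,
    - (2 ^+ M / 2 ^+ f) <= X - L i - 2 ^+ e i + 2
  & (M <= f)%N -> - 3 + (f%:R - M%:R) / 4 <= X - L i - 2 ^+ e i].
    exists f; split=> //; have := eb _ iT; have := eb _ (leq0n T).
    by clear - f1; lia.
  elim: i iT {nfar} => [_|i IH iT].
    exists 0%N; have /andP[L0 LX] := Lb _ (leq0n T); have /andP[e0 eM] := eb _ (leq0n T).
    have : 2 ^+ e 0%N <= 2 ^+ M :> R by rewrite ler_eXn2l ?ltr1n.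
    move=> eM'; split; first by clear; lia.
      by rewrite expr0 divr1; clear - eM' LX; lra.
    rewrite leqn0 => /eqP M0; move: e0 eM; rewrite M0.
    by case: (e 0%N).
  have [f [f1 f2 f3]] := IH (ltnW iT).
  have /andP[L0 LX] := Lb _ (ltnW iT); have /andP[e0 eM] := eb _ (ltnW iT).
  have := tr _ iT; case: (s i) => -[LS eS].
    exists f; rewrite eS exprS; split; first by clear - f1; lia.
      by clear - f2 LS; lra.
    by move/f3; clear - LS; lra.
  exists f.+1; have f0 : 0 < 2 ^+ f :> R by rewrite exprn_gt0.
  have M0 : 0 < 2 ^+ M :> R by rewrite exprn_gt0.
  have gain : X - L i - 2 ^+ e i + 1 / 4 <= X - L i.+1 - 2 ^+ e i.+1.
    have : 2 ^+ e i.+1 <= 2 ^+ e i :> R.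
      by rewrite eS ler_eXn2l ?ltr1n//; clear - e0; lia.
    by clear - LS; lra.
  have step2 : - (2 ^+ M / 2 ^+ f.+1) <= X - L i.+1 - 2 ^+ e i.+1 + 2.
    have h1 : 2 ^+ M / 2 ^+ f.+1 = 2 ^+ M / 2 ^+ f / 2 :> R.
      by rewrite exprS; field; rewrite lt0r_neq0.
    have h2 : 0 <= 2 ^+ M / 2 ^+ f :> R by rewrite divr_ge0// ltW.
    have [k2|k2] := lerP (-2) (X - L i - 2 ^+ e i).
      by rewrite h1; clear - h2 k2 gain; lra.
    have e2 : (1 < e i)%N.
      rewrite ltnNge; apply/negP => e1.
      have e1' : e i = 1%N by apply/eqP; rewrite eqn_leq e1.
      by rewrite e1' expr1 in k2; clear - k2 LX; lra.
    have eE : 2 ^+ e i = 2 * 2 ^+ e i.+1 :> R.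
      by rewrite eS -exprS; congr (_ ^+ _); clear - e2; lia.
    rewrite h1; rewrite eE in f2 k2; clear - f2 k2 LS h2 LX; lra.
  split=> //.
  - by rewrite eS; clear - f1 e0; lia.
  - rewrite leq_eqVlt => /orP[/eqP Mf|Mf].
      rewrite Mf subrr mul0r addr0; rewrite Mf divff ?gt_eqF ?exprn_gt0// in step2.
      by clear - step2; lra.
    by have := f3 Mf; rewrite -natr1; clear - gain; lra.
have [Mf|fM] := leqP M f; last first.
  have : (i <= 3 * M)%N by clear - f1 fM; lia.
  rewrite -(ler_nat R) natrM; clear - al2; lra.
have := f3 Mf; have : X - L i - 2 ^+ e i < al.
  rewrite ltNge; apply/negP => H; apply: nfar; rewrite /far; clear - H; lra.
have : i%:R <= M%:R + 2 * f%:R :> R by rewrite -natrM -natrD ler_nat.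
have : M%:R <= 3 * M%:R :> R by have : 0 <= M%:R :> R by []; lra.
clear - al2; lra.
Qed.

(** An overall increase of e needs a success, and up to the first success e has lost at most W; that
    success alone lowers L by 2^e/2^W. *)
Lemma window_drop T L e s W i : gap_trace T L e s ->
  (forall j, (j <= T)%N -> (1 <= e j)%N) -> (i + W <= T)%N ->
  (e (i + W) <= e i + W)%N /\
  ((e i < e (i + W))%N -> L (i + W)%N <= L i - 2 ^+ e i / 2 ^+ W).
Proof.
move=> tr e1 iW.
suff : (e (i + W) <= e i + W)%N /\
   (L (i + W)%N <= L i - 2 ^+ e i / 2 ^+ W \/ (e (i + W) <= e i)%N /\
     (e i <= e (i + W) + W)%N /\ L (i + W)%N <= L i).
  by case=> ? [?|[le _]]; split=> //; rewrite ltnNge le.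
elim: W iW => [_|W IH iW].
  by rewrite !addn0; split=> //; right; rewrite lexx leqnn.
have iW' : (i + W < T)%N by rewrite -addnS.
have [eW alt] := IH (ltnW iW').
have p0 : 0 < 2 ^+ e i :> R by rewrite exprn_gt0.
have pW : 0 < 2 ^+ W :> R by rewrite exprn_gt0.
have half : 2 ^+ e i / 2 ^+ W.+1 = 2 ^+ e i / 2 ^+ W / 2 :> R.
  by rewrite exprS; field; rewrite lt0r_neq0.
have frac0 : 0 < 2 ^+ e i / 2 ^+ W :> R by rewrite divr_gt0.
have := tr _ iW'; rewrite addnS; have := pow2_ge1 (e (i + W)%N).
have := e1 _ (ltnW iW').
case: (s (i + W)%N) => e1W p1 [LS eS].
  split; first by rewrite eS; clear - eW; lia.
  left; rewrite half; case: alt => [alt|[_ [alt LL]]].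
    by clear - alt LS p1 frac0; lra.
  have : 2 ^+ e i / 2 ^+ W <= 2 ^+ e (i + W)%N :> R.
    by rewrite ler_pdivrMr// -exprD ler_eXn2l ?ltr1n.
  by clear - LS LL frac0; lra.
split; first by rewrite eS; clear - eW e1W; lia.
case: alt => [alt|[alt1 [alt2 LL]]].
  by left; rewrite half; clear - alt LS frac0; lra.
right; split; first by rewrite eS; clear - alt1 e1W; lia.
split; first by rewrite eS; clear - alt2; lia.
by clear - LL LS; lra.
Qed.

(** The lower condition on L is lo (Al N)^B <= w. Between both conditions Newton's approximation is
    good, and e has to grow over every W steps. *)
Definition drift W (B : R) T L e (X al : R) : Prop :=
  forall i, (i + W <= T)%N -> far L e X al i -> B * (2 ^+ e i + al) <= L i ->
    (e i < e (i + W))%N.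

Definition potential (c1 c2 l : R) (k : nat) : R :=
  c1 * log2 l + `|log2 l - k%:R - c2|.

(** Three cases. If log l drops by 1, the factor c1 pays for any change of the absolute value. If l
    is large against 2^k, then k is below its balance value log l - c2, and its growth lowers the
    absolute value. Otherwise the loss 2^k/2^W is at least the fraction 1/Q of l, so log l drops by
    1/Q; this is where c1 = (W + 2) Q + 1 comes from. *)
Lemma potential_window (W : nat) (B l l' : R) (k k' : nat)
    (Q := 2 ^+ (2 * W + 3) * B) (c1 := (W%:R + 2) * Q + 1) (c2 := log2 (4 * B)) :
  1 <= B -> 0 < l' -> l' <= l - 2 ^+ k / 2 ^+ W -> (k < k')%N -> (k' <= k + W)%N ->
  potential c1 c2 l' k' <= potential c1 c2 l k - 1.
Proof.
move=> B1 l'0 l'l kk' k'W.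
have B0 : 0 < B by apply: lt_le_trans B1.
have pW : 0 < 2 ^+ W :> R by rewrite exprn_gt0.
have pk : 0 < 2 ^+ k :> R by rewrite exprn_gt0.
have frac0 : 0 < 2 ^+ k / 2 ^+ W :> R by rewrite divr_gt0.
have l0 : 0 < l by clear - l'0 l'l frac0; lra.
have Q0 : 1 <= Q.
  by have := ler_pM ler01 ler01 (pow2_ge1 (2 * W + 3)) B1; rewrite mulr1.
have W0 : 0 <= W%:R :> R by [].
have ll : log2 l' <= log2 l by apply: ler_log2 => //; clear - l'l frac0; lra.
rewrite /potential; move: ll; set y := log2 l'; set x := log2 l => ll.
have [d [dW d1]] : exists d : R, d <= W%:R /\ 1 <= d /\ k'%:R = k%:R + d.
  exists (k' - k)%:R; rewrite ler_nat ler1n subn_gt0 -natrD subnKC ?(ltnW kk')//.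
  by split=> //; clear - k'W; lia.
case: d1 => d1 ->.
have Qbig : W%:R + 2 <= (W%:R + 2) * Q by rewrite ler_peMr// addr_ge0.
have [q1|q1] := lerP 1 (x - y).
  have : (W%:R + 2) * Q * 1 <= (W%:R + 2) * Q * (x - y).
    by apply: ler_wpM2l => //; apply: le_trans Qbig; rewrite addr_ge0.
  have : `|y - (k%:R + d) - c2| <= `|x - k%:R - c2| + `|d + (x - y)|.
    have -> : y - (k%:R + d) - c2 = (x - k%:R - c2) - (d + (x - y)) by ring.
    exact: ler_normB.
  rewrite (@ger0_norm _ (d + (x - y))); last by clear - d1 q1; lra.
  by rewrite /c1; clear - Qbig dW; lra.
have [lbig|lsmall] := lerP (2 ^+ k * (2 ^+ W.+1 * (4 * B))) l.
  have xk : k%:R + (W%:R + 1) + c2 <= x.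
    have := ler_log2 _ lbig; rewrite !log2M ?log2_exp2 ?exprn_gt0 ?mulr_gt0 ?exprn_gt0//.
    by rewrite -natr1 /c2 log2M// -/x addrA => ->.
  have a1 : `|x - k%:R - c2| = x - k%:R - c2 by rewrite ger0_norm//; clear - xk W0; lra.
  have a2 : `|y - (k%:R + d) - c2| = y - (k%:R + d) - c2.
    by rewrite ger0_norm//; clear - xk W0 dW q1; lra.
  rewrite a1 a2 /c1.
  have : 0 <= (W%:R + 2) * Q * (x - y).
    by apply: mulr_ge0; [clear - Qbig W0; lra|rewrite subr_ge0].
  by clear - d1 ll; lra.
have Qinv : Q^-1 <= x - y.
  suff : y <= x - Q^-1 by clear; lra.
  have Q01 : 0 < Q by apply: lt_le_trans Q0.
  apply: log2_drop => //.
  - by rewrite invr_ge0 ltW.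
  - rewrite invf_lt1//; apply: lt_le_trans (_ : 8 <= _); first by rewrite ltr1n.
    have e8 : 8 <= 2 ^+ (2 * W + 3) :> R.
      have -> : 8 = 2 ^+ 3 :> R by ring.
      by rewrite ler_eXn2l ?ltr1n//; clear; lia.
    by have := ler_pM (ler0n R 8) ler01 e8 B1; rewrite mulr1.
  apply: (le_trans l'l); rewrite mulrBr mulr1 lerD2l lerN2.
  rewrite ler_pdivrMr// mulrAC ler_pdivlMr//; apply: ltW.
  move: lsmall; rewrite -(ltr_pM2r pW) => /lt_le_trans; apply; rewrite le_eqVlt; apply/orP; left; apply/eqP.
  rewrite /Q exprD mulnC exprM exprS; ring.
have : (W%:R + 2) * Q * Q^-1 <= (W%:R + 2) * Q * (x - y).
  by apply: ler_wpM2l => //; apply: le_trans Qbig; rewrite addr_ge0.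
rewrite mulfK; last by rewrite lt0r_neq0// (lt_le_trans _ Q0).
have : `|y - (k%:R + d) - c2| <= `|x - k%:R - c2| + `|d + (x - y)|.
  have -> : y - (k%:R + d) - c2 = (x - k%:R - c2) - (d + (x - y)) by ring.
  exact: ler_normB.
rewrite (@ger0_norm _ (d + (x - y))); last by clear - d1 ll; lra.
by rewrite /c1; clear - dW ll q1; lra.
Qed.

(** Outside the range of [drift] single steps suffice: as l < 2B 2^k, a success removes at least the
    fraction 1/(2B) of l, which outweighs the growth of the absolute value. *)
Lemma potential_success (W : nat) (B l l' : R) (k : nat)
    (Q := 2 ^+ (2 * W + 3) * B) (c1 := (W%:R + 2) * Q + 1) (c2 := log2 (4 * B)) :
  1 <= B -> 0 < l' -> l' <= l - 2 ^+ k -> l < 2 ^+ k * (2 * B) ->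
  potential c1 c2 l' k.+1 <= potential c1 c2 l k - 1.
Proof.
move=> B1 l'0 l'l lk.
have B0 : 0 < B by apply: lt_le_trans B1.
have pk : 0 < 2 ^+ k :> R by rewrite exprn_gt0.
have l0 : 0 < l by clear - l'0 l'l pk; lra.
have Q8 : 8 * B <= Q.
  rewrite /Q; apply: ler_wpM2r; first exact: ltW.
  have -> : 8 = 2 ^+ 3 :> R by ring.
  by rewrite ler_eXn2l ?ltr1n//; clear; lia.
have W0 : 0 <= W%:R :> R by [].
have drop : log2 l' <= log2 l - (2 * B)^-1.
  apply: log2_drop => //.
  - by rewrite invr_ge0 mulr_ge0// ltW.
  - by rewrite invf_lt1 ?mulr_gt0//; clear - B1; lra.
  apply: (le_trans l'l); rewrite mulrBr mulr1 lerD2l lerN2.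
  by rewrite ler_pdivrMr ?mulr_gt0// ltW.
rewrite /potential; move: drop; set y := log2 l'; set x := log2 l => drop.
rewrite -natr1.
have i0 : 0 < (2 * B)^-1 by rewrite invr_gt0 mulr_gt0.
have : `|y - (k%:R + 1) - c2| <= `|x - k%:R - c2| + `|1 + (x - y)|.
  have -> : y - (k%:R + 1) - c2 = (x - k%:R - c2) - (1 + (x - y)) by ring.
  exact: ler_normB.
rewrite (@ger0_norm _ (1 + (x - y))); last by clear - drop i0; lra.
have : (2 * (8 * B)) * (2 * B)^-1 <= (2 * (8 * B)) * (x - y).
  by apply: ler_wpM2l; [rewrite !mulr_ge0// ltW|clear - drop; lra].
have -> : 2 * (8 * B) * (2 * B)^-1 = 8 by field; rewrite lt0r_neq0.
have : 2 * (8 * B) * (x - y) <= (W%:R + 2) * Q * (x - y).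
  apply: ler_wpM2r; first by clear - drop i0; lra.
  apply: ler_pM => //; first by rewrite mulr_ge0// ltW.
  by rewrite lerDr.
by rewrite /c1; clear; lra.
Qed.

(** Here l is so small that e exceeds its balance value by at least 1, and lowering e by 1 lowers
    the absolute value by 1. *)
Lemma potential_bisection (W : nat) (B l l' : R) (k : nat)
    (Q := 2 ^+ (2 * W + 3) * B) (c1 := (W%:R + 2) * Q + 1) (c2 := log2 (4 * B)) :
  1 <= B -> 0 < l' -> l' <= l -> l < 2 ^+ k.+1 * (2 * B) ->
  potential c1 c2 l' k <= potential c1 c2 l k.+1 - 1.
Proof.
move=> B1 l'0 l'l lk.
have B0 : 0 < B by apply: lt_le_trans B1.
have l0 : 0 < l by apply: lt_le_trans l'l.
have Q0 : 0 <= Q by rewrite mulr_ge0 ?exprn_ge0// ltW.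
have W0 : 0 <= W%:R :> R by [].
have ll := ler_log2 l'0 l'l.
have xk : log2 l <= k.+1%:R + c2 - 1.
  have := ler_log2 l0 (ltW lk); rewrite log2M ?exprn_gt0 ?mulr_gt0// log2_exp2.
  have -> : c2 = log2 (2 * B) + 1.
    have e4 : 4 * B = 2 * (2 * B) by ring.
    by rewrite /c2 e4 log2M ?mulr_gt0// log2_2 addrC.
  by clear; lra.
rewrite /potential; move: ll xk; set y := log2 l'; set x := log2 l => ll.
rewrite -natr1 => xk.
rewrite (@ler0_norm _ (y - k%:R - c2)); last by clear - xk ll; lra.
rewrite (@ler0_norm _ (x - (k%:R + 1) - c2)); last by clear - xk; lra.
have : 0 <= (W%:R + 2) * Q * (x - y).
  by apply: mulr_ge0; [rewrite mulr_ge0// addr_ge0|clear - ll; lra].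
by rewrite /c1; clear - ll; lra.
Qed.

(** A run first spends O(al + M) steps until [far] holds. From then on the potential, O(M) at that
    time, loses 1 in at most W steps until L < 2 B al. The rest takes at most 8 B al steps, because
    every step lowers L by 1/4. *)
Lemma gap_time (W : nat) (B : R) : (0 < W)%N -> 1 <= B ->
  exists C : R, 0 < C /\ forall T L e s X al M,
    gap_data T L e s X al M -> drift W B T L e X al -> T%:R <= C * (al + M%:R).
Proof.
move=> W0 B1; have B0 : 0 < B by apply: lt_le_trans B1.
pose Q : R := 2 ^+ (2 * W + 3) * B; pose c1 := (W%:R + 2) * Q + 1.
pose c2 := log2 (4 * B).
have c20 : 0 <= c2 by apply: log2_ge0; clear - B1; lra.
have Q0 : 0 <= Q by rewrite mulr_ge0 ?exprn_ge0// ltW.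
have W0' : 1 <= W%:R :> R by rewrite ler1n.
have c10 : 1 <= c1.
  by rewrite /c1 lerDr mulr_ge0// addr_ge0.
exists (40 + 8 * B + W%:R * (c1 + c2 + 5)); split.
  have : 0 <= W%:R * (c1 + c2 + 5) by apply: mulr_ge0; [clear - W0'; lra|clear - c10 c20; lra].
  by clear - B0; lra.
move=> T L e s X al M gd dr; have [tr Lb eb XM al2] := gd.
have M1 : 1 <= M%:R :> R by have /andP[e1 eM] := eb _ (leq0n T); rewrite ler1n (leq_trans e1).
have Bal : 0 < 2 * B * al by rewrite !mulr_gt0//; clear - al2; lra.
have main m i : (i <= T)%N -> far L e X al i -> potential c1 c2 (L i) (e i) < m%:R ->
    T%:R <= i%:R + W%:R * (m%:R + 1) + 8 * B * al.
  elim: m i => [|m IH] i iT fi.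
    have [Li|Li] := ltP (L i) 1.
      move=> _; have := drop_quarter tr (introT andP (conj iT (leqnn T))).
      have /andP[LT _] := Lb _ (leqnn T); rewrite natrB// => LT'.
      by rewrite add0r mulr1; clear - LT LT' Li Bal al2 B1 W0'; nra.
    rewrite ltNge /potential addr_ge0// mulr_ge0 ?log2_ge0//.
    by clear - c10; lra.
  move=> pot.
  have [Li|Li] := ltP (L i) (2 * B * al).
    have := drop_quarter tr (introT andP (conj iT (leqnn T))).
    have /andP[LT _] := Lb _ (leqnn T); rewrite natrB// => LT'.
    have : 0 <= W%:R * (m.+1%:R + 1) :> R by rewrite mulr_ge0// addr_ge0.
    by clear - LT LT' Li; lra.
  have [iW|] := leqP (i + W) T; last first.
    rewrite -(ltr_nat R) natrD => iW.
    have : W%:R <= W%:R * (m.+1%:R + 1) :> R.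
      by rewrite ler_peMr// lerDr.
    by clear - iW Bal; lra.
  have iT' : (i < T)%N by apply: leq_trans iW; rewrite -{1}(addn0 i) ltn_add2l.
  have cont j : (i < j <= i + W)%N ->
      (L j < 2 * B * al \/ potential c1 c2 (L j) (e j) <= potential c1 c2 (L i) (e i) - 1) ->
      T%:R <= i%:R + W%:R * (m.+1%:R + 1) + 8 * B * al.
    move=> /andP[ij jW] alt; have jT := leq_trans jW iW.
    have jr : j%:R <= i%:R + W%:R :> R by rewrite -natrD ler_nat.
    case: alt => [Lj|pj].
      have := drop_quarter tr (introT andP (conj jT (leqnn T))).
      have /andP[LT _] := Lb _ (leqnn T); rewrite natrB// => LT'.
      have : W%:R <= W%:R * (m.+1%:R + 1) :> R by rewrite ler_peMr// lerDr.
      by clear - jr LT LT' Lj; lra.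
    have fj : far L e X al j by apply: far_le gd _ fi; rewrite (ltnW ij).
    have pot' : potential c1 c2 (L j) (e j) < m%:R.
      by move: pot; rewrite -natr1; clear - pj; lra.
    have := IH j jT fj pot'; rewrite -natr1; clear - jr; lra.
  have e1 j : (j <= T)%N -> (1 <= e j)%N by move=> /eb/andP[].
  (* Below the range of [drift], L < B (2^e + al) and L >= 2 B al combine to L < 2 B 2^e, so the
     lemmas for single steps apply. *)
  have [near|nnear] := leP (B * (2 ^+ e i + al)) (L i).
    have ee := dr i iW fi near.
    have [eW LW] := window_drop tr e1 iW.
    apply: (cont (i + W)%N); first by rewrite leqnn andbT -{1}(addn0 i) ltn_add2l.
    have [|Lj] := ltP (L (i + W)%N) (2 * B * al); first by left.
    right; apply: potential_window => //; first exact: lt_le_trans Lj.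
    exact: LW.
  have eL : L i < 2 ^+ e i * (2 * B).
    by clear - nnear Li B0; lra.
  have pe := pow2_ge1 (e i).
  apply: (cont i.+1); first by rewrite ltnSn -addn1 leq_add2l.
  have [|Lj] := ltP (L i.+1) (2 * B * al); first by left.
  right; have Lj0 : 0 < L i.+1 by apply: lt_le_trans Lj.
  have := tr _ iT'; case: (s i) => -[LS eS].
    by rewrite eS; apply: potential_success.
  have e2 : (1 < e i)%N.
    rewrite ltnNge; apply/negP => e1'.
    have : 2 ^+ e i <= 2 :> R.
      by rewrite -[leRHS]expr1 ler_eXn2l ?ltr1n.
    by clear - eL Li al2 B0; nra.
  have eE : e i = (e i.+1).+1 by rewrite eS; clear - e2; lia.
  rewrite eE in eL *; apply: potential_bisection => //.
  by clear - LS; lra.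
have Wc0 : 0 <= W%:R * (c1 + c2 + 5).
  by apply: mulr_ge0 => //; clear - c10 c20; lra.
have [farT|/negP nfarT] := boolP (2 ^+ e T + al <= X - L T); last first.
  have := far_eventually gd (leqnn T) nfarT.
  have : 0 <= 8 * B * (al + M%:R) by rewrite !mulr_ge0 ?(ltW B0)//; clear - al2 M1; lra.
  have : 0 <= W%:R * (c1 + c2 + 5) * (al + M%:R).
    by apply: mulr_ge0 => //; clear - al2 M1; lra.
  by clear - al2 M1; lra.
(* The first index at which [far] holds; its predecessor is bounded by [far_eventually]. *)
have exfar : exists i, (i <= T)%N && (2 ^+ e i + al <= X - L i).
  by exists T; rewrite leqnn.
case: (ex_minnP exfar) => i /andP[iT fi] imin.
have ib : i%:R <= 3 * M%:R + 8 * al + 25.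
  case: i iT fi imin => [|i] iT fi imin; first by clear - al2 M1; lra.
  have nfi : ~ far L e X al i.
    by move=> fi'; have := imin i; rewrite (ltnW iT) ltnn => /(_ fi').
  have := far_eventually gd (ltnW iT) nfi; rewrite -natr1; clear; lra.
have [Li|Li] := ltP (L i) 1.
  have := drop_quarter tr (introT andP (conj iT (leqnn T))).
  have /andP[LT _] := Lb _ (leqnn T); rewrite natrB// => LT'.
  have : 0 <= 8 * B * (al + M%:R) by rewrite !mulr_ge0 ?(ltW B0)//; clear - al2 M1; lra.
  have : 0 <= W%:R * (c1 + c2 + 5) * (al + M%:R).
    by apply: mulr_ge0 => //; clear - al2 M1; lra.
  by clear - al2 M1 ib Li LT LT'; lra.
have lg0 := log2_ge0 Li.
have lgM : log2 (L i) <= M%:R.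
  have /andP[_ LX] := Lb _ iT.
  rewrite -[leRHS]log2_exp2; apply: ler_log2; first exact: lt_le_trans Li.
  exact: le_trans XM.
have pot0 : 0 <= potential c1 c2 (L i) (e i).
  by rewrite /potential addr_ge0// mulr_ge0//; clear - c10; lra.
have potb : potential c1 c2 (L i) (e i) <= c1 * M%:R + 2 * M%:R + c2.
  have /andP[_ eM] := eb _ iT; rewrite -(ler_nat R) in eM.
  have : `|log2 (L i) - (e i)%:R - c2| <= 2 * M%:R + c2.
    have e0 : 0 <= (e i)%:R :> R by [].
    by clear - lg0 lgM eM c20 e0; rewrite ler_norml; apply/andP; split; lra.
  have : c1 * log2 (L i) <= c1 * M%:R by apply: ler_wpM2l => //; clear - c10; lra.
  by rewrite /potential; clear; lra.
have /andP[tr1 tr2] := truncn_itv pot0.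
have := main _ _ iT fi tr2; rewrite -natr1 => Tb.
have : W%:R * (Num.truncn (potential c1 c2 (L i) (e i)))%:R + 2 * W%:R <=
    W%:R * (c1 * M%:R + 2 * M%:R + c2 + 2).
  rewrite [2 * _]mulrC -mulrDr; apply: ler_wpM2l => //.
  by clear - tr1 potb; lra.
have : W%:R * (c1 * M%:R + 2 * M%:R + c2 + 2) <= W%:R * ((c1 + c2 + 5) * M%:R).
  apply: ler_wpM2l => //; have : c2 <= c2 * M%:R by rewrite ler_peMr.
  by clear - M1; lra.
have : 0 <= W%:R * (c1 + c2 + 5) * al.
  by apply: mulr_ge0 => //; clear - al2; lra.
have : 0 <= 8 * B * M%:R by rewrite !mulr_ge0// ltW.
by clear - Tb ib al2 M1; lra.
Qed.
End Gap.

Lemma pow2_18_ge (R : realFieldType) : 8 * 8000 * 4 <= 2 ^+ 18 :> R.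
Proof.
have -> : 2 ^+ 18 = 512 * 512 :> R by ring.
by lra.
Qed.

(** * A common grid for a window of iterations *)

Section WindowGrid.
Variables (R : realFieldType) (P : {poly R}) (n K h : nat) (kap xi : R).

Lemma on_grid_width (c g a b : R) : 0 < g -> on_grid c g a -> on_grid c g b -> a < b ->
  g <= b - a.
Proof.
move=> g0 [z ->] [t ->]; rewrite -subr_gt0.
have -> : c + g * t%:~R - (c + g * z%:~R) = g * (t - z)%:~R by rewrite intrB; ring.
rewrite pmulr_rgt0// ltr0z => zt; apply: ler_peMr; first exact: ltW.
by have := ltr_intS R zt; rewrite mulr0z add0r.
Qed.

(** In W steps the speed rises at most to N^(2^W), so every step refines the grid by at most D = (Al
    N)^(2^W). Starting from the grid spanned by the two end points, its step stays above w0/D^W; the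
    exponent W+2 leaves two more powers of D for the factor 2^18 and for one speed. Since the ends
    are distinct grid points, the grid step also bounds the widths from below. *)
Lemma window_grid W A B E X S (r w0 Al : R) :
  trajectory P n K h W A B E X S ->
  state_ok P K h xi kap (A 0%N) (B 0%N) (speed_of (E 0%N)) -> (0 < E 0%N)%N ->
  w0 = B 0%N - A 0%N -> 0 <= r -> 32 * 2 ^+ h <= Al -> 2 ^+ 18 <= Al ->
  r * (Al * (speed_of (E 0%N))%:R) ^+ (2 ^ W * W.+2) <= w0 ->
  exists c g, 16 * r <= g /\ forall j, (j < W)%N ->
    8 * r <= cell (A j) (B j) (speed_of (E j)) / 8000 /\
    forall y, is_sample (X j) y -> on_grid c g y.
Proof.
move=> tr ok0 E0 w0E r0 A1 A2 rw.
have oks := trajectory_ok tr ok0 E0.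
have w0_gt0 : 0 < w0.
  by case: ok0 => /andP[h1 h2] _ _ _ _; rewrite w0E subr_gt0 (lt_trans h1).
pose Q := Al * (speed_of (E 0%N))%:R; rewrite -/Q in rw.
have p18 : 1 <= 2 ^+ 18 :> R by rewrite exprn_ege1// ler1n.
have Al1 : 1 <= Al by apply: le_trans A2.
have N01 : 1 <= (speed_of (E 0%N))%:R :> R by rewrite ler1n expn_gt0.
have Q1 : 1 <= Q by rewrite /Q mulr_ege1.
have AlQ : Al <= Q by rewrite /Q ler_peMr// (le_trans _ Al1).
pose D := Q ^+ (2 ^ W).
have W1 : (1 <= 2 ^ W)%N by rewrite expn_gt0.
have QD : Q <= D by rewrite /D -[leLHS]expr1 ler_weXn2l.
have D1 : 1 <= D by apply: le_trans QD.
have D0 : 0 < D by apply: lt_le_trans D1.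
have Dj j : 0 < D ^+ j by rewrite exprn_gt0.
pose m j := (32 * 2 ^ h * speed_of (E j))%N.
have m0 j : (0 < m j)%N by rewrite /m /speed_of !muln_gt0 !expn_gt0.
have Egrow j : (j <= W)%N -> (E j <= E 0%N + j)%N.
  elim: j => [|j IH] jW; first by rewrite addn0.
  have [ok e0] := oks j (ltnW jW); have [_ _ _ [_ ES] _] := real_step_ok ok e0 (tr j jW).
  have := IH (ltnW jW); have := (tr j jW).2; move: ES; case: (S j) => ES.
    by rewrite ES// addnS ltnS.
  by move=> [_ ->]; clear - e0; lia.
have mD j : (j <= W)%N -> (m j)%:R <= D.
  move=> jW; rewrite /m natrM natrM natrX.
  have : (speed_of (E j))%:R <= (speed_of (E 0%N))%:R ^+ (2 ^ W) :> R.
    rewrite -natrX ler_nat /speed_of -expnM -expnD leq_pexp2l// leq_pexp2l//.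
    by apply: leq_trans (Egrow j jW) _; rewrite leq_add2l.
  move=> sp; rewrite /D /Q exprMn; apply: ler_pM => //.
    by rewrite mulr_ge0 ?exprn_ge0.
  by apply: (le_trans A1); rewrite -[leLHS]expr1 ler_weXn2l.
pose G := fix G j := if j is j'.+1 then G j' / (m j')%:R else w0.
have G0 j : 0 < G j.
  by elim: j => //= j IH; rewrite divr_gt0// ltr0n.
have GD j : (j <= W)%N -> w0 <= G j * D ^+ j.
  elim: j => [|j IH] jW; first by rewrite expr0 mulr1.
  apply: (le_trans (IH (ltnW jW))); rewrite /= exprS mulrA; apply: ler_wpM2r.
    by rewrite exprn_ge0// ltW.
  rewrite mulrAC ler_pdivlMr ?ltr0n//; apply: ler_wpM2l; first exact: ltW.
  exact: mD (ltnW jW).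
have epsm j : (speed_of (E j))%:R != 0 :> R by rewrite pnatr_eq0 -lt0n expn_gt0.
have h0 : 2 ^+ h != 0 :> R by rewrite expf_neq0// pnatr_eq0.
have GS j : G j.+1 = G j * eps R h / (speed_of (E j))%:R.
  by rewrite /= epsE /m !natrM natrX; field; rewrite h0 epsm.
have grids j : (j <= W)%N -> on_grid (A 0%N) (G j) (A j) /\ on_grid (A 0%N) (G j) (B j).
  elim: j => [_|j IH jW].
    split; first by exists 0; rewrite mulr0z mulr0 addr0.
    by exists 1; rewrite mulr1 /= w0E; ring.
  have [ga gb] := IH (ltnW jW); rewrite GS.
  apply: (step_on_grid (P := P) (n := n) (K := K) _ ga gb (x := X j)); first by rewrite expn_gt0.
  by have := (tr j jW).2; case: (S j) => -[]; [left|right].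
have refine i j x : (i <= j)%N -> on_grid (A 0%N) (G i) x -> on_grid (A 0%N) (G j) x.
  move=> ij gx; elim: j ij => [|j IH]; first by rewrite leqn0 => /eqP i0; rewrite i0 in gx.
  rewrite leq_eqVlt => /orP[/eqP ij|ij]; first by rewrite -ij.
  by apply: on_grid_refine; [exact: m0|exact: IH].
have tiny j i : (j <= W)%N -> (i <= W.+1)%N -> 2 ^+ 18 * r * D ^+ i <= w0.
  move=> jW iW; apply: le_trans rw; rewrite exprM -/D [D ^+ W.+2]exprS.
  rewrite [2 ^+ 18 * r]mulrC -mulrA; apply: ler_wpM2l => //.
  apply: ler_pM; [by rewrite exprn_ge0|by rewrite exprn_ge0// ltW| |].
    exact: le_trans A2 (le_trans AlQ QD).
  by rewrite ler_weXn2l.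
exists (A 0%N), (G W); split.
  have := tiny W W (leqnn _) (leqnSn _); have := GD W (leqnn _).
  move=> g1 g2; have := le_trans g2 g1; rewrite ler_pM2r ?Dj//.
  apply: le_trans; apply: ler_wpM2r => //.
  have -> : 16 = 2 ^+ 4 :> R by ring.
  by rewrite ler_eXn2l ?ltr1n.
move=> j jW; have jW' := ltnW jW; split.
  have [ga gb] := grids j jW'.
  have [/andP[axi xib] N4 _ _ _] := (oks j jW').1.
  have gw := on_grid_width (G0 j) ga gb (lt_trans axi xib).
  have s0 : 0 < (speed_of (E j))%:R :> R by rewrite ltr0n expn_gt0.
  have sD : (speed_of (E j))%:R <= D.
    apply: le_trans (mD j jW'); rewrite ler_nat /m leq_pmull// muln_gt0 expn_gt0//.
  have := tiny j j.+1 jW' (leqW jW); have := GD j jW'.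
  move=> g1 g2; have := le_trans g2 g1.
  rewrite [D ^+ j.+1]exprS !mulrA ler_pM2r ?Dj// => g3.
  have g4 : 2 ^+ 18 * r * (speed_of (E j))%:R <= G j.
    apply: le_trans g3; apply: ler_wpM2l => //; by rewrite mulr_ge0 ?exprn_ge0.
  rewrite /cell ler_pdivlMr// ler_pdivlMr ?mulr_gt0//.
  apply: le_trans gw; apply: le_trans g4.
  have -> : 8 * r * 8000 * (4 * (speed_of (E j))%:R) =
    (8 * 8000 * 4) * (r * (speed_of (E j))%:R) by ring.
  rewrite -[leRHS]mulrA; apply: ler_wpM2r; first by rewrite mulr_ge0.
  exact: pow2_18_ge.
have [ga gb] := grids j jW'.
have fine y : on_grid (A 0%N) (G j * eps R h) y -> on_grid (A 0%N) (G W) y.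
  move=> gy; apply: (refine j.+1) => //; rewrite GS; apply: on_grid_refine => //.
  by rewrite expn_gt0.
have [g1 g2 g3] := samples_on_grid ga gb (tr j jW).1.
by move=> y [] ->; apply: fine.
Qed.
End WindowGrid.

Lemma accurate_off_cluster (R : rcfType) (P : {poly R}) (rs : seq R[i]) c (xi lo hi Al a b : R) N :
  c != 0 -> map_poly (real_complex R) P = c *: \prod_(z <- rs) ('X - z%:P) ->
  P.[xi] = 0 -> P^`().[xi] != 0 -> (0 < count (cluster xi lo) rs)%N ->
  (forall z, z \in rs -> cluster xi lo z \/ hi <= Normc.normc (z - real_complex R xi)) ->
  0 <= lo -> a < xi < b -> (4 <= N)%N -> 64 * 1000 * (size rs)%:R <= Al ->
  Al * N%:R * (b - a) <= hi -> 8 * lo <= cell a b N / 8000 ->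
  accurate_off P xi a b N (8 * lo) (count (cluster xi lo) rs).
Proof.
move=> c0 pE Pxi dPxi v0 sep lo0 /andP[axi xib] N4 An Ahi lou y /andP[ya yb] yxi.
have ab := lt_trans axi xib; have u0 := cell_gt0 ab N4; have w0 : 0 < b - a by rewrite subr_gt0.
(* At y = xi, possible only for lo = 0, the quotient is 0 and thus exact; [newton_value_accurate]
   excludes this point. *)
have [y0|y0] := eqVneq y xi.
  split; rewrite y0// /newton_quotient Pxi mul0r mulr0 subrr subr0 normr0.
  by rewrite divr_ge0// ltW.
have D0 : 0 < `|y - xi| by rewrite normr_gt0 subr_eq0.
have Dw : `|y - xi| <= b - a by clear - axi xib ya yb; rewrite ler_norml; apply/andP; split; lra.
have N1 : 1 <= N%:R :> R by rewrite ler1n (leq_trans _ N4).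
have n1 : 1 <= (size rs)%:R :> R.
  by rewrite ler1n (leq_trans v0)// count_size.
have Aw : Al * (b - a) <= hi.
  apply: le_trans Ahi; rewrite -mulrA; apply: ler_wpM2l; first by clear - An n1; lra.
  by rewrite ler_peMl// ltW.
have nw : 64 * 1000 * (size rs)%:R * (b - a) <= hi.
  by apply: le_trans Aw; rewrite ler_wpM2r// ltW.
have hi0 : 0 < hi.
  by apply: lt_le_trans nw; rewrite !mulr_gt0// ltr0n; rewrite -(ltr0n R); clear - n1; lra.
have nD : (size rs)%:R * `|y - xi| <= (size rs)%:R * (b - a) by rewrite ler_wpM2l.
have [|dP est] := newton_value_accurate c0 pE v0 sep lo0 D0 yxi _.
  have : 0 < (size rs)%:R * (b - a) by rewrite mulr_gt0//; clear - n1; lra.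
  by move=> nw0; clear - nw nD nw0; lra.
split=> //; apply: (le_trans est).
have : 4 * (size rs)%:R * `|y - xi| ^+ 2 / hi <= cell a b N / 4000.
  rewrite ler_pdivrMr//.
  have h1 : `|y - xi| ^+ 2 <= (b - a) * (b - a).
    by rewrite expr2 ler_pM.
  have h2 : cell a b N * (Al * N%:R * (b - a)) <= cell a b N * hi by rewrite ler_wpM2l// ltW.
  have h3 : cell a b N * (Al * N%:R * (b - a)) = Al * ((b - a) * (b - a)) / 4.
    by rewrite /cell; field; rewrite lt0r_neq0//; clear - N1; lra.
  have h4 : 64 * 1000 * (size rs)%:R * ((b - a) * (b - a)) <= Al * ((b - a) * (b - a)).
    by apply: ler_wpM2r An; rewrite mulr_ge0// ltW.
  have h5 : (size rs)%:R * `|y - xi| ^+ 2 <= (size rs)%:R * ((b - a) * (b - a)).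
    by rewrite ler_wpM2l.
  by clear - h2 h3 h4 h5; lra.
by clear - lou u0; lra.
Qed.

Section Segment.
Variable R : realType.

Lemma log2_div (x y : R) : 0 < x -> 0 < y -> log2 (x / y) = log2 x - log2 y.
Proof. by move=> x0 y0; rewrite /log2 ln_div ?posrE// mulrBl. Qed.

Lemma log2_speed e : log2 ((speed_of e)%:R : R) = 2 ^+ e.
Proof. by rewrite /speed_of natrX log2_exp2 natrX. Qed.

Lemma ler_log2E (x y : R) : 0 < x -> 0 < y -> (log2 x <= log2 y) = (x <= y).
Proof.
by move=> x0 y0; rewrite /log2 ler_pM2r ?invr_gt0 ?ln2_gt0// ler_ln.
Qed.

Lemma trajectory_shift P n K h W V (A B : nat -> R) E X S i :
  (i + V <= W)%N -> trajectory P n K h W A B E X S ->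
  trajectory P n K h V (fun j => A (i + j)%N) (fun j => B (i + j)%N)
    (fun j => E (i + j)%N) (fun j => X (i + j)%N) (fun j => S (i + j)%N).
Proof.
move=> iV tr j jV; have := tr (i + j)%N; rewrite addnS; apply.
by apply: leq_trans iV; rewrite ltn_add2l.
Qed.

(* Al is a multiple of n in the applications. *)
Lemma segment_time (W Bx : nat) : (0 < W)%N -> (0 < Bx)%N ->
  exists C : R, 0 < C /\ forall P n K h kap xi T A B E X S (lo hi Al : R) M,
    trajectory P n K h T A B E X S ->
    state_ok P K h xi kap (A 0%N) (B 0%N) (speed_of (E 0%N)) -> (0 < E 0%N)%N ->
    0 < lo -> 4 <= Al -> log2 (hi / lo) <= 2 ^+ M ->
    (forall i, (i <= T)%N -> lo <= B i - A i <= hi) ->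
    (forall i, (i <= T)%N -> (E i <= M)%N) ->
    (forall i, (i + W <= T)%N -> Al * (speed_of (E i))%:R * (B i - A i) <= hi ->
       lo * (Al * (speed_of (E i))%:R) ^+ Bx <= B i - A i -> (E i < E (i + W))%N) ->
    T%:R <= C * (log2 Al + M%:R).
Proof.
move=> W0 Bx0; have B1 : 1 <= Bx%:R :> R by rewrite ler1n.
have [C [C0 bound]] := gap_time W0 B1; exists C; split=> //.
move=> P n K h kap xi T A B E X S lo hi Al M tr ok0 E0 lo0 Al4 hiM wb EM dr.
have oks := trajectory_ok tr ok0 E0.
have wi0 i : (i <= T)%N -> 0 < B i - A i.
  by move=> iT; have /andP[h1 _] := wb i iT; apply: lt_le_trans h1.
have hi0 : 0 < hi by have /andP[_ h2] := wb 0%N (leq0n T); apply: lt_le_trans h2; exact: wi0.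
have Al0 : 0 < Al by apply: lt_le_trans Al4.
have s0 e : 0 < (speed_of e)%:R :> R by rewrite ltr0n expn_gt0.
(* L is the logarithm of the width relative to lo, so a success subtracts log2 N = 2^e; a factor 3/4
   subtracts at least 1/4. *)
apply: (bound T (fun i => log2 ((B i - A i) / lo)) E S (log2 (hi / lo)) (log2 Al) M).
  split=> //.
  - move=> i iT; have [ok e0] := oks i (ltnW iT).
    have wi := wi0 i (ltnW iT); have wS := wi0 i.+1 iT.
    have stp := tr i iT; have [_ _ _ [_ ES] wd] := real_step_ok ok e0 stp.
    rewrite !log2_div//; case: (S i) stp wd ES => -[_ [_ eS]] wd _; rewrite eS; split=> //.
      have : log2 (B i.+1 - A i.+1) <= log2 (B i - A i) - 2 ^+ E i.
        by rewrite -log2_speed -log2_div// ler_log2E// divr_gt0.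
      by clear; lra.
    have : log2 (B i.+1 - A i.+1) <= log2 (B i - A i) - 1 / 4.
      apply: log2_drop => //; [lra|lra|].
      by apply: le_trans wd _; clear; lra.
    by clear; lra.
  - move=> i iT; have /andP[h1 h2] := wb i iT; apply/andP; split.
      by apply: log2_ge0; rewrite ler_pdivlMr// mul1r.
    by rewrite ler_log2E ?divr_gt0 ?wi0// ler_pM2r// invr_gt0.
  - by move=> i iT; rewrite (oks i iT).2 EM.
  - have -> : 2 = log2 (2 ^+ 2) :> R by rewrite log2_exp2.
    by apply: ler_log2; rewrite ?exprn_gt0//; have -> : 2 ^+ 2 = 4 :> R by ring.
move=> i iW; have iT : (i <= T)%N by apply: leq_trans iW; rewrite leq_addr.
rewrite /far -log2_speed !log2_div ?wi0// => fr nr; apply: dr => //.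
  rewrite -ler_log2E ?mulr_gt0 ?wi0// !log2M ?mulr_gt0 ?wi0//.
  by clear - fr; lra.
rewrite -ler_log2E ?mulr_gt0 ?exprn_gt0 ?mulr_gt0 ?wi0//.
rewrite log2M ?exprn_gt0 ?mulr_gt0// log2X ?mulr_gt0// log2M//.
by clear - nr; lra.
Qed.

(** A success at speed N leaves a width of at least wmin and at most w/N, so N <= 2^Y; its square
    then has exponent at most 2 Y <= 2^M. *)
Lemma speed_bound P n K h kap xi T (A B : nat -> R) E X S wmin (Y M : nat) :
  trajectory P n K h T A B E X S ->
  state_ok P K h xi kap (A 0%N) (B 0%N) (speed_of (E 0%N)) -> E 0%N = 1%N ->
  0 < wmin -> B 0%N - A 0%N <= 2 ^+ Y * wmin -> (0 < Y)%N -> (2 * Y <= 2 ^ M)%N ->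
  (forall i, (i <= T)%N -> wmin <= B i - A i) ->
  forall i, (i <= T)%N -> (E i <= M)%N /\ B i - A i <= B 0%N - A 0%N.
Proof.
move=> tr ok0 E1 wm0 w0Y Y0 YM wmi.
have oks := trajectory_ok tr ok0; rewrite E1 in oks; have {}oks := oks isT.
have M1 : (1 <= M)%N by case: M YM => //; rewrite expn0; lia.
elim=> [_|i IH iT]; first by rewrite E1.
have [EM wi] := IH (ltnW iT); have [ok e0] := oks i (ltnW iT).
have [/andP[axi xib] N4 _ _ _] := ok; have w0 : 0 < B i - A i by rewrite subr_gt0 (lt_trans axi).
have stp := tr i iT; have [_ _ _ [_ ES] wd] := real_step_ok ok e0 stp.
have s0 e : 0 < (speed_of e)%:R :> R by rewrite ltr0n expn_gt0.
case: (S i) stp wd ES => -[_ [_ eS]] wd ES; rewrite eS; split.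
- have : (speed_of (E i))%:R <= 2 ^+ Y :> R.
    have := le_trans (wmi _ iT) wd; rewrite ler_pdivlMr// => H.
    by rewrite -(ler_pM2l wm0) (le_trans H)// (le_trans wi)// mulrC.
  rewrite -natrX ler_nat /speed_of leq_exp2l// => EY.
  by rewrite -(leq_exp2l _ _ (ltnSn 1)) expnS (leq_trans _ YM)// leq_pmul2l.
- apply: le_trans wi; apply: le_trans wd _; rewrite ler_pdivrMr// ler_peMr ?ltW//.
  by rewrite ltr1n (leq_trans _ N4).
- by rewrite geq_max M1 (leq_trans (leq_pred _) EM).
- by apply: le_trans wi; clear - wd w0; lra.
Qed.

End Segment.

(** * The sequence of gaps *)

Lemma first_below (R : realDomainType) (w : nat -> R) x T :
  (forall i, (i <= T)%N -> x <= w i) \/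
  exists t, [/\ (t <= T)%N, w t < x & forall i, (i < t)%N -> x <= w i].
Proof.
have [e|ne] := boolP [exists i : 'I_T.+1, w i < x].
  right; have ex : exists i, (i <= T)%N && (w i < x).
    by case/existsP: e => i wi; exists i; rewrite wi -ltnS ltn_ord.
  have := find_ex_minn ex => -[t /andP[tT wt] mn]; exists t; split=> // i it.
  rewrite leNgt; apply/negP => wi.
  have := mn i; rewrite wi (ltnW (leq_trans it tT)) => /(_ isT).
  by rewrite leqNgt it.
left=> i iT; rewrite leNgt; apply: contra ne => wi.
by apply/existsP; exists (Ordinal (iT : (i < T.+1)%N)).
Qed.

Lemma trajectory_nested (R : realFieldType) (P : {poly R}) n K h kap xi T A B E X S :
  trajectory P n K h T A B E X S ->
  state_ok P K h xi kap (A 0%N) (B 0%N) (speed_of (E 0%N)) -> (0 < E 0%N)%N ->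
  forall i, (i <= T)%N -> A 0%N <= A i /\ B i <= B 0%N.
Proof.
move=> tr ok0 E0; have oks := trajectory_ok tr ok0 E0; elim=> [//|i IH iT].
have [aa bb] := IH (ltnW iT); have [ok e0] := oks i (ltnW iT).
have [_ _ [aa' bb'] _ _] := real_step_ok ok e0 (tr i iT).
by split; [apply: le_trans aa'|apply: le_trans bb].
Qed.

Section Gaps.
Variable R : realType.
Implicit Types (P : {poly R}) (A B : nat -> R) (E : nat -> nat) (X : nat -> R * R * R)
  (S : nat -> bool) (rs : seq R[i]).
Local Notation toC := (real_complex R).
Local Notation normc := (@Normc.normc R).

Definition factored P rs xi : Prop :=
  [/\ exists2 c, c != 0 & map_poly toC P = c *: \prod_(z <- rs) ('X - z%:P),
      P.[xi] = 0 & P^`().[xi] != 0].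

(** The conditions of [quarter_equation] and of the position lemmas. They are required in a gap only
    if its cluster contains a root other than xi, which forces degree at least 3. *)
Definition fine_grid K h (kap : R) : Prop :=
  [/\ kap <= 3 / 128, (2 <= h)%N & (2 * K <= 2 ^ h + 2)%N].

(** In this order: accuracy against the far roots, refinement of the grid in one step, and the slack
    of [window_grid]. *)
Definition large_factor n h (Al : R) : Prop :=
  [/\ 64 * 1000 * n%:R <= Al, 32 * 2 ^+ h <= Al & 2 ^+ 18 <= Al].

Lemma root_mem P rs xi : factored P rs xi -> toC xi \in rs.
Proof.
case=> [[c c0 pE] P0 _]; rewrite -root_prod_XsubC -(rootZ _ _ c0) -pE.
by rewrite /root horner_map P0 rmorph0.
Qed.

Lemma normc_same (xi : R) : normc (toC xi - toC xi) = 0.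
Proof. by rewrite subrr -(rmorph0 toC) normc_real normr0. Qed.

Lemma root_gap_drift W P n K h kap xi rs lo hi Al A B E X S : W = 41 ->
  factored P rs xi -> size rs = n -> 0 <= lo ->
  (forall z, z \in rs -> cluster xi lo z \/ hi <= normc (z - toC xi)) ->
  (0 < lo -> fine_grid K h kap) -> large_factor n h Al ->
  trajectory P n K h W A B E X S ->
  state_ok P K h xi kap (A 0%N) (B 0%N) (speed_of (E 0%N)) -> (0 < E 0%N)%N ->
  Al * (speed_of (E 0%N))%:R * (B 0%N - A 0%N) <= hi ->
  lo * (Al * (speed_of (E 0%N))%:R) ^+ (2 ^ W * W.+2) <= B 0%N - A 0%N ->
  (E 0%N < E W)%N.
Proof.
move=> W41 fac rsn lo0 sep small [An Ah A18] tr ok0 E0 fr nr.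
have [c [g [rg gr]]] := window_grid tr ok0 E0 erefl lo0 Ah A18 nr.
have oks := trajectory_ok tr ok0 E0.
have [[d d0 pE] P0 dP0] := fac.
have v0 : (0 < count (cluster xi lo) rs)%N.
  rewrite -has_count; apply/hasP; exists (toC xi); first exact: root_mem fac.
  by rewrite /cluster normc_same.
have vn : (count (cluster xi lo) rs <= n)%N by rewrite -rsn count_size.
have Al0 : 0 <= Al by apply: le_trans A18; rewrite exprn_ge0.
have w_ge0 i : (i <= W)%N -> 0 <= B i - A i.
  by case/oks=> -[/andP[h1 h2] _ _ _ _] _; rewrite subr_ge0 ltW// (lt_trans h1).
(* Al N w does not grow: a success squares N but divides w by N, and a bisection increases
   neither. *)
have far_i i : (i <= W)%N -> Al * (speed_of (E i))%:R * (B i - A i) <= hi.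
  elim: i => [//|i IH iW]; apply: le_trans (IH (ltnW iW)).
  have [ok e0] := oks i (ltnW iW); have wi := w_ge0 i (ltnW iW).
  have stp := tr i iW; have [_ _ _ _ wd] := real_step_ok ok e0 stp.
  have s0 : 0 < (speed_of (E i))%:R :> R by rewrite ltr0n expn_gt0.
  rewrite -!mulrA; apply: ler_wpM2l => //.
  case: (S i) stp wd => -[_ [_ eS]] wd.
    rewrite eS speed_ofS natrX expr2 -mulrA ler_wpM2l ?(ltW s0)//.
    by move: wd; rewrite ler_pdivlMr// mulrC.
  apply: ler_pM; rewrite ?ler0n ?w_ge0//; last by clear - wi wd; lra.
  rewrite eS ler_nat /speed_of leq_exp2l// leq_exp2l// geq_max e0.
  exact: leq_pred.
rewrite W41 in tr gr oks far_i *.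
have lo8 : 0 <= 8 * lo by rewrite mulr_ge0.
apply: (@window_gain R P n K h kap xi A B E X S (8 * lo) (count (cluster xi lo) rs) c g) => //.
- by clear - rg; lra.
- by rewrite pmulr_rgt0.
move=> j j41; have [h1 h2] := gr j j41; split=> //.
have [[xi_in N4 _ _ _] _] := oks j (ltnW j41).
apply: (accurate_off_cluster d0 pE P0 dP0 v0 sep lo0 xi_in N4 _ (far_i j (ltnW j41)) h1).
by rewrite rsn.
Qed.

(* lo is the largest distance below hi from xi to a root. *)
Lemma next_distance rs (xi hi : R) : 0 < hi -> toC xi \in rs ->
  exists lo, [/\ 0 <= lo < hi,
    forall z, z \in rs -> cluster xi lo z \/ hi <= normc (z - toC xi),
    (count (near_xi xi lo) rs < count (near_xi xi hi) rs)%N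
    & 0 < lo -> exists2 z, z \in rs & z != toC xi /\ normc (z - toC xi) < hi].
Proof.
move=> hi0 xirs; pose dist z := normc (z - toC xi).
have [lo [lo_hi [z [zrs zlo]] mx]] : exists lo, [/\ 0 <= lo < hi,
    exists z, z \in rs /\ dist z = lo & forall z, z \in rs -> dist z < hi -> dist z <= lo].
  suff : forall s : seq R[i], {subset s <= rs} -> exists lo, [/\ 0 <= lo < hi,
    exists z, z \in rs /\ dist z = lo & forall z, z \in s -> dist z < hi -> dist z <= lo].
    by apply.
  elim=> [|y s IH] ss.
    exists 0; split=> //; first by rewrite lexx.
    by exists (toC xi); split=> //; rewrite /dist normc_same.
  have [z zs|lo [lo_hi [z [zrs zlo]] mx]] := IH; first by apply: ss; rewrite inE zs orbT.
  have [/andP[yhi ylo]|yhi] := boolP ((dist y < hi) && (lo < dist y)).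
    exists (dist y); split=> //.
    - by rewrite yhi normc_ge0.
    - by exists y; split=> //; apply: ss; rewrite inE eqxx.
    - by move=> t; rewrite inE => /orP[/eqP->//|ts] /(mx t ts)/le_trans; apply; exact: ltW.
  exists lo; split=> //; first by exists z.
  move=> t; rewrite inE => /orP[/eqP-> th|]; last exact: mx.
  by move: yhi; rewrite th /= -leNgt.
have [l0 lh] := andP lo_hi; exists lo; split=> //.
- move=> t trs; have [th|th] := ltP (dist t) hi; [left; exact: mx|by right].
- have sub : subpred (near_xi xi lo) (near_xi xi hi).
    by move=> t /lt_trans; apply.
  rewrite ltn_neqAle sub_count// andbT; apply/negP => /eqP eqc.
  have : (count (predI (near_xi xi hi) (predC (near_xi xi lo))) rs = 0)%N.
    have := count_predUI (near_xi xi lo) (predI (near_xi xi hi) (predC (near_xi xi lo))) rs.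
    rewrite (@eq_count _ (predU _ _) (near_xi xi hi)); last first.
      by move=> t /=; case: (boolP (near_xi xi lo t)) => [/sub->|]; rewrite ?andbT.
    rewrite (@eq_count _ (predI (near_xi xi lo) _) pred0); last first.
      by move=> t /=; case: (near_xi xi lo t); rewrite ?andbF.
    by rewrite count_pred0 addn0 eqc; lia.
  apply/eqP; rewrite -lt0n -has_count; apply/hasP; exists z => //=.
  by rewrite /near_xi -/(dist z) zlo lh ltxx.
move=> lo_pos; exists z => //; rewrite -/(dist z) zlo; split=> //.
by apply: contraTneq lo_pos => zE; rewrite -zlo zE /dist normc_same ltxx.
Qed.

Definition slow_decay P n K h kap xi wmin M T A B E X S : Prop :=
  [/\ trajectory P n K h T A B E X S,
      state_ok P K h xi kap (A 0%N) (B 0%N) (speed_of (E 0%N)), (0 < E 0%N)%N,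
      forall i, (i <= T)%N -> wmin <= B i - A i
    & forall i, (i <= T)%N -> (E i <= M)%N].

Lemma slow_decay_cut P n K h kap xi wmin M T A B E X S t : (t <= T)%N ->
  slow_decay P n K h kap xi wmin M T A B E X S ->
  slow_decay P n K h kap xi wmin M (T - t) (fun j => A (t + j)%N) (fun j => B (t + j)%N)
    (fun j => E (t + j)%N) (fun j => X (t + j)%N) (fun j => S (t + j)%N).
Proof.
move=> tT [tr ok0 E0 wm EM]; have [ok e0] := trajectory_ok tr ok0 E0 tT.
split; rewrite ?addn0//.
- by apply: trajectory_shift tr; rewrite subnKC.
- by move=> i iT; apply: wm; rewrite -(subnKC tT) leq_add2l.
- by move=> i iT; apply: EM; rewrite -(subnKC tT) leq_add2l.
Qed.

Lemma slow_decay_prefix P n K h kap xi wmin M T A B E X S t : (t <= T)%N ->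
  slow_decay P n K h kap xi wmin M T A B E X S ->
  slow_decay P n K h kap xi wmin M t A B E X S.
Proof.
move=> tT [tr ok0 E0 wm EM]; split=> //.
- by move=> i it; apply: tr; apply: leq_trans tT.
- by move=> i it; apply: wm; apply: leq_trans tT.
- by move=> i it; apply: EM; apply: leq_trans tT.
Qed.

Lemma slow_decay_width P n K h kap xi wmin M T A B E X S i : (i <= T)%N ->
  slow_decay P n K h kap xi wmin M T A B E X S -> B i - A i <= B 0%N - A 0%N.
Proof.
move=> iT [tr ok0 E0 _ _]; have [aa bb] := trajectory_nested tr ok0 E0 iT.
by rewrite lerB.
Qed.

(** The run is cut at the first width below lo; the step that crosses lo is absorbed by G >= 1. *)
Lemma slow_decay_split P n K h kap xi wmin M T A B E X S lo (G H : R) : 1 <= G -> 0 <= H ->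
  slow_decay P n K h kap xi wmin M T A B E X S ->
  (forall t, (t <= T)%N -> (forall i, (i <= t)%N -> lo <= B i - A i) -> t%:R <= G) ->
  (forall t, (t <= T)%N -> B t - A t < lo ->
     slow_decay P n K h kap xi wmin M (T - t) (fun j => A (t + j)%N) (fun j => B (t + j)%N)
    (fun j => E (t + j)%N) (fun j => X (t + j)%N) (fun j => S (t + j)%N) -> (T - t)%:R <= H) ->
  T%:R <= 2 * G + H.
Proof.
move=> G1 H0 sd above below.
have [wl|[[|t] [tT wt wl]]] := first_below (fun i => B i - A i) lo T.
- by have := above T (leqnn T) wl; clear - G1 H0; lra.
- have := below 0%N tT wt (slow_decay_cut tT sd); rewrite subn0.
  by clear - G1 H0; lra.
- have h1 := above t (ltnW tT) wl; have h2 := below _ tT wt (slow_decay_cut tT sd).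
  have -> : T%:R = t%:R + 1 + (T - t.+1)%:R :> R by rewrite natr1 -natrD subnKC.
  by clear - h1 h2 G1; lra.
Qed.

Lemma log2_ratio (x y : R) (Y M : nat) : 0 < y -> y <= x -> x <= 2 ^+ Y * y -> (Y <= 2 ^ M)%N ->
  log2 (x / y) <= 2 ^+ M.
Proof.
move=> y0 yx xy YM; have x0 := lt_le_trans y0 yx.
apply: le_trans (_ : Y%:R <= _); last by rewrite -natrX ler_nat.
by rewrite -[leRHS]log2_exp2; apply: ler_log2; rewrite ?divr_gt0// ler_pdivrMr.
Qed.

(** Induction on the number of roots closer than hi. The largest such distance lo opens the next
    gap, and passing to it removes at least one root from the count, so each gap is charged to a
    root. *)
Lemma root_gaps_time : exists C : R, 0 < C /\
  forall P n K h kap xi rs (hi Al wmin : R) (Y M T : nat) A B E X S,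
  factored P rs xi -> size rs = n -> large_factor n h Al -> 0 < wmin -> (0 < M)%N ->
  (Y <= 2 ^ M)%N -> hi <= 2 ^+ Y * wmin -> B 0%N - A 0%N <= hi ->
  (forall z, z \in rs -> z != toC xi -> normc (z - toC xi) < hi -> fine_grid K h kap) ->
  slow_decay P n K h kap xi wmin M T A B E X S ->
  T%:R <= (count (near_xi xi hi) rs)%:R * (C * (log2 Al + M%:R)).
Proof.
(* W stays a variable equal to 41, which keeps 2 ^ W in the exponents from being evaluated. *)
have [W W41] : exists W : nat, W = 41%N by exists 41%N.
have W0 : (0 < W)%N by rewrite W41.
have Bx0 : (0 < 2 ^ W * W.+2)%N by rewrite muln_gt0 expn_gt0.
have [C [C0 seg]] := segment_time R W0 Bx0.
exists (2 * (C + 1)); split; first by rewrite mulr_gt0// ltr_wpDl// ltW.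
move=> P n K h kap xi rs hi Al wmin Y M T A B E X S fac rsn lf wm0 M0 YM.
have [_ _ A18] := lf.
have Al4 : 4 <= Al.
  apply: le_trans A18; have -> : 4 = 2 ^+ 2 :> R by ring.
  by rewrite ler_eXn2l// ltr1n.
have lgA : 0 <= log2 Al by apply: log2_ge0; apply: le_trans Al4; rewrite ler1n.
pose G := (C + 1) * (log2 Al + M%:R).
have M1 : 1 <= M%:R :> R by rewrite ler1n.
have G1 : 1 <= G.
  have : 1 * 1 <= G by apply: ler_pM; rewrite // -lerBlDr ?subrr ?(ltW C0)//; clear - lgA M1; lra.
  by rewrite mulr1.
have GE : 2 * (C + 1) * (log2 Al + M%:R) = 2 * G by rewrite /G mulrA.
have [m Hm] := ubnP (count (near_xi xi hi) rs).
elim: m hi T A B E X S Hm => // m IH hi T A B E X S Hm hiY w0hi small sd.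
have hi0 : 0 < hi.
  by case: sd => _ _ _ wm _; apply: lt_le_trans w0hi; apply: lt_le_trans (wm 0%N _).
have [lo [/andP[lo0 lohi] sep cnt nz]] := next_distance hi0 (root_mem fac).
have small_lo : 0 < lo -> fine_grid K h kap by move=> /nz[z zrs [z1 z2]]; exact: small z2.
(* If wmin exceeds lo, the run ends inside this gap and nothing is left for the induction; this also
   covers lo = 0. *)
pose l1 := Num.max lo wmin.
have l10 : 0 < l1 by rewrite lt_max wm0 orbT.
have IHlo t : (t <= T)%N -> B t - A t < l1 ->
  slow_decay P n K h kap xi wmin M (T - t) (fun j => A (t + j)%N) (fun j => B (t + j)%N)
    (fun j => E (t + j)%N) (fun j => X (t + j)%N) (fun j => S (t + j)%N) ->
  (T - t)%:R <= (count (near_xi xi lo) rs)%:R * (2 * G).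
  move=> tT wt sd'; have lw : wmin < lo.
    have [_ _ _ wm _] := sd; have := le_lt_trans (wm t tT) wt.
    by rewrite lt_max ltxx orbF.
  rewrite -GE; apply: IH sd'.
  - by rewrite ltnS in Hm; apply: leq_trans Hm.
  - exact: le_trans (ltW lohi) hiY.
  - by rewrite addn0; move: wt; rewrite /l1 (max_idPl (ltW lw)) => /ltW.
  - by move=> z zrs z1 z2; apply: (small z) => //; apply: lt_trans lohi.
rewrite GE; apply: le_trans (_ : _ <= 2 * G + (count (near_xi xi lo) rs)%:R * (2 * G)) _; last first.
  rewrite -[X in X + _]mul1r -mulrDl addrC natr1 ler_wpM2r ?ler_nat//.
  by clear - G1; lra.
apply: (slow_decay_split G1 _ sd _ IHlo).
  by rewrite mulr_ge0//; clear - G1; lra.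
move=> t tT wl; have sd' := slow_decay_prefix tT sd; have [tr ok0 E0 wm EM] := sd'.
have bd i : (i <= t)%N -> l1 <= B i - A i <= hi.
  by move=> it; rewrite wl//= (le_trans (slow_decay_width it sd')).
apply: le_trans (_ : _ <= C * (log2 Al + M%:R)) _; last first.
  by apply: ler_wpM2r; [clear - lgA M1|clear]; lra.
apply: (seg P n K h kap xi t A B E X S l1 hi Al M) => //.
  apply: log2_ratio YM => //.
    by have /andP[h1 h2] := bd 0%N (leq0n _); apply: le_trans h2.
  by apply: le_trans hiY _; apply: ler_wpM2l; rewrite ?exprn_ge0// /l1 le_max lexx orbT.
move=> i iW fr nr; have iT : (i <= t)%N by apply: leq_trans iW; rewrite leq_addr.
have [ok e0] := trajectory_ok tr ok0 E0 iT.
have := @root_gap_drift W P n K h kap xi rs lo hi Al (fun j => A (i + j)%N)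
  (fun j => B (i + j)%N) (fun j => E (i + j)%N) (fun j => X (i + j)%N)
  (fun j => S (i + j)%N) W41 fac rsn lo0 sep small_lo lf.
rewrite addn0; apply=> //.
  exact: trajectory_shift iW tr.
apply: le_trans nr; rewrite ler_wpM2r ?exprn_ge0 ?mulr_ge0 ?ler0n//.
  by clear - Al4; lra.
by rewrite /l1 le_max lexx.
Qed.

End Gaps.

Section TotalTime.
Variable R : realType.
Implicit Types (P : {poly R}) (A B : nat -> R) (E : nat -> nat) (X : nat -> R * R * R)
  (S : nat -> bool) (rs : seq R[i]).
Local Notation toC := (real_complex R).
Local Notation normc := (@Normc.normc R).

(** Windows of length 1: xi is less than a cell away from an end, so the boundary test would prevent
    a bisection. *)
Lemma edge_gap_drift P n K h kap xi (e Al : R) A B E X S :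
  8 <= Al -> 0 < e -> xi - A 0%N <= e \/ B 0%N - xi <= e ->
  trajectory P n K h 1 A B E X S ->
  state_ok P K h xi kap (A 0%N) (B 0%N) (speed_of (E 0%N)) -> (0 < E 0%N)%N ->
  e * (Al * (speed_of (E 0%N))%:R) <= B 0%N - A 0%N -> (E 0%N < E 1%N)%N.
Proof.
move=> Al8 e0 edge tr ok0 E0 nr; have [/andP[axi xib] N4 _ _ _] := ok0.
have ab := lt_trans axi xib; have u0 := cell_gt0 ab N4.
have eu : e < cell (A 0%N) (B 0%N) (speed_of (E 0%N)).
  have N0 : 0 < (speed_of (E 0%N))%:R :> R by rewrite ltr0n expn_gt0.
  have h1 : e * (8 * (speed_of (E 0%N))%:R) <= e * (Al * (speed_of (E 0%N))%:R).
    by rewrite ler_pM2l// ler_wpM2r.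
  have h2 := le_trans h1 nr; rewrite /cell ltr_pdivlMr ?mulr_gt0//.
  have h3 : 0 < e * (speed_of (E 0%N))%:R by rewrite mulr_gt0.
  by clear - h2 h3; lra.
have := tr 0%N isT; case: (S 0%N) => -[_ [st ->]]; first by rewrite ltnSn.
exfalso; have [_ [ml [mr [pts nl nr']]] _] := st.
have [left right] := edge_boundary ok0 pts.
case: edge => ed; [move/negP: nl; apply|move/negP: nr'; apply].
- by apply: left; apply: le_lt_trans eu.
- by apply: right; apply: le_lt_trans eu.
Qed.

(* Three ranges of widths: above the distance e from xi to the ends of the
   initial interval the boundary test succeeds; between e and e/(16(n+3)) the
   speed plays no role; below, the roots near xi count. *)
Lemma total_time : exists C : R, 0 < C /\
  forall P n K h kap xi rs (Al wmin : R) (Y M T : nat) A B E X S (d : R),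
  factored P rs xi -> size rs = n -> large_factor n h Al -> 16 * n.+3%:R <= Al ->
  0 < wmin -> (0 < Y)%N -> (2 * Y <= 2 ^ M)%N -> B 0%N - A 0%N <= 2 ^+ Y * wmin ->
  d = Num.min (xi - A 0%N) (B 0%N - xi) / (16 * n.+3%:R) ->
  (forall z, z \in rs -> z != toC xi -> normc (z - toC xi) < d -> fine_grid K h kap) ->
  trajectory P n K h T A B E X S ->
  state_ok P K h xi kap (A 0%N) (B 0%N) (speed_of (E 0%N)) -> E 0%N = 1%N ->
  (forall i, (i <= T)%N -> wmin <= B i - A i) ->
  T%:R <= (count (near_xi xi d) rs)%:R * (C * (log2 Al + M%:R)).
Proof.
have [C1 [C10 seg]] := segment_time R (ltn0Sn 0) (ltn0Sn 0).
have [C2 [C20 gaps]] := root_gaps_time R.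
exists (4 * (C1 + 1) + C2); split; first by clear - C10 C20; lra.
move=> P n K h kap xi rs Al wmin Y M T A B E X S d fac rsn lf Aln wm0 Y0 YM w0Y dE small tr ok0 E1 wm.
have EM i : (i <= T)%N -> (E i <= M)%N.
  by move=> iT; have [] := speed_bound tr ok0 E1 wm0 w0Y Y0 YM wm iT.
have YM' : (Y <= 2 ^ M)%N by apply: leq_trans YM; rewrite leq_pmull.
have M0 : (0 < M)%N by have := EM 0%N (leq0n _); rewrite E1.
have sd : slow_decay P n K h kap xi wmin M T A B E X S by split=> //; rewrite E1.
have [_ _ A18] := lf.
have Al8 : 8 <= Al.
  apply: le_trans A18; have -> : 8 = 2 ^+ 3 :> R by ring.
  by rewrite ler_eXn2l// ltr1n.
have Al4 : 4 <= Al by clear - Al8; lra.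
have lgA : 0 <= log2 Al by apply: log2_ge0; apply: le_trans Al4; rewrite ler1n.
have [/andP[axi xib] _ _ _ _] := ok0.
set e := Num.min _ _ in dE.
have e0 : 0 < e by rewrite lt_min !subr_gt0 axi.
have edge : xi - A 0%N <= e \/ B 0%N - xi <= e.
  by rewrite /e; case: (leP (xi - A 0%N) (B 0%N - xi)) => _; [left|right].
have ew : e <= B 0%N - A 0%N.
  by apply: le_trans (_ : xi - A 0%N <= _); [rewrite ge_min lexx|rewrite lerB// ltW].
have n16 : 1 <= 16 * n.+3%:R :> R by rewrite -natrM ler1n.
have n0 : 0 < 16 * n.+3%:R :> R by apply: lt_le_trans n16.
have d0 : 0 < d by rewrite dE divr_gt0.
have de : d <= e by rewrite dE ler_pdivrMr// ler_peMr// ltW.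
pose G := (C1 + 1) * (log2 Al + M%:R).
have M1 : 1 <= M%:R :> R by rewrite ler1n.
have G1 : 1 <= G.
  have : 1 * 1 <= G by apply: ler_pM; rewrite // -lerBlDr ?subrr ?(ltW C10)//; clear - lgA M1; lra.
  by rewrite mulr1.
have C1G : C1 * (log2 Al + M%:R) <= G.
  by apply: ler_wpM2r; [clear - lgA M1|clear]; lra.
have V1 : 1 <= (count (near_xi xi d) rs)%:R :> R.
  rewrite ler1n -has_count; apply/hasP; exists (toC xi); first exact: root_mem fac.
  by rewrite /near_xi normc_same.
pose H := (count (near_xi xi d) rs)%:R * (C2 * (log2 Al + M%:R)).
have H0 : 0 <= H by rewrite mulr_ge0// mulr_ge0 ?(ltW C20)//; clear - lgA M1; lra.
apply: le_trans (_ : _ <= 2 * G + (2 * G + H)) _; last first.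
  have -> : (count (near_xi xi d) rs)%:R * ((4 * (C1 + 1) + C2) * (log2 Al + M%:R)) =
    (count (near_xi xi d) rs)%:R * (4 * G) + H by rewrite /G /H; ring.
  rewrite addrA lerD2r -mulrDl -natrD ler_peMl//.
  by clear - G1; lra.
pose l1 := Num.max e wmin; have l10 : 0 < l1 by rewrite lt_max e0.
have l1e : e <= l1 by rewrite /l1 le_max lexx.
have l1w : wmin <= l1 by rewrite /l1 le_max lexx orbT.
apply: (slow_decay_split (lo := l1) G1 _ sd).
- by clear - G1 H0; lra.
- move=> t tT wl; have sd' := slow_decay_prefix tT sd; have [tr' _ E0 _ EM'] := sd'.
  have bd i : (i <= t)%N -> l1 <= B i - A i <= B 0%N - A 0%N.
    by move=> it; rewrite wl//= (slow_decay_width it sd').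
  apply: le_trans C1G.
  apply: (seg P n K h kap xi t A B E X S l1 (B 0%N - A 0%N) Al M) => //.
    apply: log2_ratio YM' => //; first by case/andP: (bd 0%N (leq0n _)).
    by apply: le_trans w0Y _; rewrite ler_wpM2l ?exprn_ge0.
  move=> i iW _ nr; have iT : (i <= t)%N by apply: leq_trans iW; rewrite leq_addr.
  have [ok e0'] := trajectory_ok tr' ok0 E0 iT.
  have [aa bb] := trajectory_nested tr' ok0 E0 iT.
  have := @edge_gap_drift P n K h kap xi e Al (fun j => A (i + j)%N)
    (fun j => B (i + j)%N) (fun j => E (i + j)%N) (fun j => X (i + j)%N) (fun j => S (i + j)%N).
  rewrite addn0; apply=> //.
  + by case: edge => ed; [left|right]; apply: le_trans ed; rewrite lerB.
  + exact: trajectory_shift iW tr'.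
  + by apply: le_trans nr; rewrite expr1 ler_wpM2r// mulr_ge0 ?ler0n//; clear - Al4; lra.
move=> t1 t1T wt1 sd1.
have we : wmin < e.
  have := le_lt_trans (wm t1 t1T) wt1; by rewrite lt_max ltxx orbF.
have {}wt1 : B t1 - A t1 < e by move: wt1; rewrite /l1 (max_idPl (ltW we)).
pose l2 := Num.max d wmin; have l20 : 0 < l2 by rewrite lt_max d0.
have l2d : d <= l2 by rewrite /l2 le_max lexx.
have l2w : wmin <= l2 by rewrite /l2 le_max lexx orbT.
apply: (slow_decay_split (lo := l2) G1 H0 sd1).
- move=> t tT wl; have sd' := slow_decay_prefix tT sd1; have [tr' ok' E0 _ EM'] := sd'.
  have bd i : (i <= t)%N -> l2 <= B (t1 + i)%N - A (t1 + i)%N <= e.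
    move=> it; rewrite wl//=; apply: le_trans (slow_decay_width it sd') _.
    by rewrite addn0 ltW.
  apply: le_trans C1G.
  apply: (seg _ _ _ _ _ _ _ _ _ _ _ _ l2 e Al M tr' ok' E0) => //.
    apply: log2_ratio YM' => //.
      by have /andP[h1 h2] := bd 0%N (leq0n _); apply: le_trans h2.
    apply: le_trans ew _; apply: le_trans w0Y _; rewrite ler_wpM2l ?exprn_ge0//.
  (* In the middle range the condition on e growing is vacuous: e <= Al l2, so Al N w <= e and l2 Al
     N <= w contradict each other. *)
  move=> i iW fr nr; exfalso.
  have iT : (i <= t)%N by apply: leq_trans iW; rewrite leq_addr.
  have [ok e0'] := trajectory_ok tr' ok' E0 iT.
  have /andP[h1 _] := bd i iT.
  have N1 : 4 <= (speed_of (E (t1 + i)%N))%:R :> R by rewrite natN_ge4// speed_of_ge4.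
  have e_le : e <= Al * l2.
    apply: le_trans (_ : Al * d <= _); last by rewrite ler_wpM2l//; clear - Al4; lra.
    have -> : e = 16 * n.+3%:R * d by rewrite dE mulrC divfK// lt0r_neq0.
    by rewrite ler_wpM2r// ltW.
  rewrite expr1 in nr; move: fr nr => /= fr nr.
  set N := (speed_of _)%:R in N1 nr fr; set w := B _ - A _ in h1 nr fr.
  have AN : 4 <= Al * N.
    by apply: (le_trans Al4); rewrite ler_peMr//; [clear - Al4|clear - N1]; lra.
  have w0 : 0 < w by apply: lt_le_trans h1.
  have h2 : 4 * w <= Al * N * w by rewrite ler_wpM2r// ltW.
  have h3 : l2 * (Al * 4) <= l2 * (Al * N).
    by rewrite ler_wpM2l ?(ltW l20)// ler_wpM2l//; clear - Al4; lra.
  by clear - h2 h3 e_le fr nr w0 e0; lra.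
move=> t2 t2T wt2 sd2.
have wd : wmin < d.
  have := le_lt_trans (wm (t1 + t2)%N _) wt2; rewrite lt_max ltxx orbF; apply.
  by rewrite -(subnKC t1T) leq_add2l.
apply: (gaps P n K h kap xi rs d Al wmin Y M _ _ _ _ _ _ fac rsn lf wm0 M0 YM' _ _ small sd2).
  by apply: le_trans de _; apply: le_trans ew _.
by rewrite addn0; move: wt2; rewrite /l2 (max_idPl (ltW wd)) => /ltW.
Qed.

End TotalTime.

(** * The algorithm and its cost *)

Lemma pow_pos_spec x e : (pow_pos x e).2 = x ^+ BinPos.Pos.to_nat e /\
  exists2 b, (2 ^ b <= BinPos.Pos.to_nat e)%N & ((pow_pos x e).1 <= 2 * b)%N.
Proof.
elim: e => [e [IH [b b1 b2]]|e [IH [b b1 b2]]|]; last by split=> //; exists 0%N.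
- rewrite Pnat.Pos2Nat.inj_xI; split; last first.
    by exists b.+1; [rewrite expnS; lia|rewrite /= ; lia].
  rewrite /= IH -exprD -exprS; congr (_ ^+ _); lia.
- rewrite Pnat.Pos2Nat.inj_xO; split; last first.
    by exists b.+1; [rewrite expnS; lia|rewrite /= ; lia].
  rewrite /= IH -exprD; congr (_ ^+ _); lia.
Qed.

Lemma pow_value x e : (pow x e).2 = x ^+ e.
Proof.
rewrite /pow -[in RHS](bin_of_natK e); case: (bin_of_nat e) => // e'.
rewrite (pow_pos_spec x e').1; congr (_ ^+ _).
by rewrite /= ; lia.
Qed.

Lemma pow_cost x e h : (e <= 2 ^ h)%N -> ((pow x e).1 <= 2 * h)%N.
Proof.
move=> eh; have := bin_of_natK e; rewrite /pow; case: (bin_of_nat e) => // e' e'E.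
have [_ [b b1 b2]] := pow_pos_spec x e'; apply: leq_trans b2 _; rewrite leq_pmul2l//.
rewrite -(@leq_exp2l 2)//; apply: leq_trans b1 _; apply: leq_trans eh.
by rewrite -e'E /=; lia.
Qed.

Lemma eval_value s x : (eval s x).2 = \sum_(t <- s) t.2%:~R * x ^+ t.1.
Proof.
by elim: s => [|t s IH]; [rewrite big_nil|rewrite big_cons /= IH pow_value].
Qed.

Lemma eval_deriv_value s x :
  (eval_deriv s x).2 = \sum_(t <- s) t.2%:~R * x ^+ t.1.-1 *+ t.1.
Proof.
elim: s => [|[[|e] c] s IH]; first by rewrite big_nil.
- by rewrite big_cons mulr0n add0r.
- by rewrite big_cons /= IH pow_value -mulrA mulr_natl -mulrnAr.
Qed.

Lemma sum_sparse (V : nmodType) (p : {poly int}) (F : nat * int -> V) :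
  (forall i, F (i, 0) = 0) ->
  \sum_(t <- sparse p) F t = \sum_(i < size p) F (i : nat, p`_i).
Proof.
move=> F0; rewrite big_map big_filter big_mkcond.
transitivity (\sum_(i <- iota 0 (size p)) F (i, p`_i)).
  by apply: eq_bigr => i _; case: eqP => // ->; rewrite F0.
by rewrite -(big_mkord xpredT (fun i => F (i, p`_i))) /index_iota subn0.
Qed.

Lemma eval_sparse (p : {poly int}) x : (eval (sparse p) x).2 = (map_poly intr p).[x].
Proof.
rewrite eval_value sum_sparse => [|i]; last by rewrite mul0r.
rewrite (@horner_coef_wide _ (size p)) ?size_poly//.
by apply: eq_bigr => i _; rewrite coef_map.
Qed.

Lemma eval_deriv_sparse (p : {poly int}) x :
  (eval_deriv (sparse p) x).2 = (map_poly intr p)^`().[x].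
Proof.
rewrite eval_deriv_value sum_sparse => [|i]; last by rewrite mul0r mul0rn.
case E : (size p) => [|m].
  by move/eqP: E; rewrite size_poly_eq0 => /eqP ->; rewrite big_ord0 rmorph0 deriv0 horner0.
rewrite big_ord_recl mulr0n add0r (@horner_coef_wide _ m); last first.
  apply: leq_trans (size_poly _ _) _.
  have : (size (map_poly intr p : {poly rat}) <= m.+1)%N by rewrite -E size_poly.
  by case: (size _).
by apply: eq_bigr => i _; rewrite coef_deriv coef_map /= mulrnAl.
Qed.

Definition low_degree h (s : seq (nat * int)) := all (fun t => t.1 <= 2 ^ h)%N s.

Lemma eval_cost h s x : low_degree h s -> ((eval s x).1 <= size s * (2 * h + 3))%N.
Proof.
rewrite /low_degree; elim: s => [//|t s IH] /= /andP[t1 /IH]; have := pow_cost x t1.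
by rewrite mulSn; lia.
Qed.

Lemma eval_deriv_cost h s x : low_degree h s ->
  ((eval_deriv s x).1 <= size s * (2 * h + 3))%N.
Proof.
rewrite /low_degree; elim: s => [//|[[|e] c] s IH] /=; first by move=> /IH; rewrite mulSn; lia.
move=> /andP[t1 /IH]; rewrite mulSn; have := pow_cost x (ltnW t1); lia.
Qed.

Lemma sparse_low_degree n (p : {poly int}) : (size p <= n.+1)%N ->
  low_degree (up_log 2 n) (sparse p).
Proof.
move=> pn; rewrite /low_degree all_map; apply/allP => i; rewrite mem_filter mem_iota /=.
move=> /andP[_ ip].
apply: leq_trans (up_logP n (ltnSn 1)).
by rewrite -ltnS; apply: leq_trans pn.
Qed.

Lemma size_sparse (p : {poly int}) : size (sparse p) = count (fun c : int => c != 0) p.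
Proof.
rewrite size_map -size_filter -[in RHS](mkseq_nth 0 p) filter_map size_map.
by rewrite !size_filter; apply: eq_count.
Qed.

Lemma max0_pred (l : int) : Num.max 0 (l - 1) = if l <= 1 then 0 else l - 1.
Proof. by rewrite maxEle subr_ge0 le_eqVlt; case: ltgtP => // <-; rewrite subrr. Qed.

Lemma sqrtn_sqr m : sqrtn (m ^ 2) = m.
Proof.
apply/eqP; rewrite eqn_leq; apply/andP; split.
  by apply/bigmax_leqP => i; rewrite leq_sqr.
have mm : (m < (m ^ 2).+1)%N by rewrite ltnS -{1}(expn1 m); case: m => // m; rewrite leq_pexp2l.
by rewrite -[X in (X <= _)%N]/(val (Ordinal mm)) leq_bigmax_cond.
Qed.

Lemma slow_down_speed e : (0 < e)%N ->
  maxn 4 (sqrtn (speed_of e)) = speed_of (maxn 1 e.-1).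
Proof.
case: e => // e _; rewrite speed_ofS sqrtn_sqr /=; case: e => [//|e].
by rewrite (maxn_idPr _) ?speed_of_ge4// (maxn_idPr _).
Qed.

Section Semantics.
Variables (k n : nat) (p : {poly int}).
Local Notation q := (map_poly intr p : {poly rat}).
Local Notation h := (up_log 2 n).
Local Notation K := (uphalf k).
Local Notation s := (sparse p).
Local Notation eps := (eps rat h).

Lemma grid_eps_value c : (grid_eps c n).2 = (2 ^+ (c + h))^-1.
Proof. by rewrite /grid_eps pow_value div1r exprVn. Qed.

Lemma grid_eps5 : (grid_eps 5 n).2 = eps. Proof. exact: grid_eps_value. Qed.

Lemma grid_eps2 : (grid_eps 2 n).2 = 8 * eps.
Proof.
rewrite grid_eps_value exprD epsE; field.
by rewrite expf_neq0.
Qed.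

Definition grid_offset (i : grid k) : rat := ((i : nat)%:R - K%:R) * eps.

Lemma grid_offsetP i : offset K h (grid_offset i).
Proof.
exists ((i : nat)%:Z - K%:Z); last by rewrite /grid_offset intrD rmorphN.
by have := ltn_ord i; lia.
Qed.

Lemma offsetN d : offset K h d -> offset K h (- d : rat).
Proof. by case=> i iK ->; exists (- i); [rewrite abszN|rewrite mulrNz mulNr]. Qed.

Lemma newton_value_spec x :
  (newton_value s x).2 = if q^`().[x] == 0 then None else Some (newton_quotient q x).
Proof.
rewrite /newton_value /bind /= eval_deriv_sparse; case: ifP => //= _.
by rewrite eval_sparse.
Qed.

Lemma opposite_signs_spec x y : (opposite_signs s x y).2 = (q.[x] * q.[y] < 0).
Proof. by rewrite /opposite_signs /bind /= !eval_sparse. Qed.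

Lemma bind2 (T U : Type) (m : cost T) (f : T -> cost U) : (bind m f).2 = (f m.2).2.
Proof. by []. Qed.

Lemma charge2 (T : Type) c (x : T) : (charge c x).2 = x. Proof. by []. Qed.

Lemma keep_pair_spec w vi vj c : 0 < w -> (0 < n)%N ->
  let kept := (keep_pair n w vi vj c).2 in
  (kept -> vi != vj) /\
  (`|vi| <= w -> `|vj| < 2 * w -> w / (8 * n%:R) < `|vi - vj| ->
   w / (4 * n%:R) <= `|vi - vj| -> kept).
Proof.
move=> w0 n0; rewrite /keep_pair !bind2 !charge2 /=.
have n0' : 0 < n%:R :> rat by rewrite ltr0n.
split.
  apply: contraTneq => ->; rewrite subrr normr0 divr_gt0 ?mulr_gt0// orbT.
  have -> : (w / (8 * n%:R) < 0) = false by apply/negbTE; rewrite -leNgt divr_ge0 ?mulr_ge0 ?ltW.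
  by rewrite !andbF.
move=> viw vjw d2 d1; rewrite ltNge viw /= ltNge d1 /= vjw d2 !andbT.
by have -> : `|vi| < 2 * w by lra.
Qed.

(** The program is opened one [bind] at a time and every intermediate result gets a name together
    with its value, so that results used repeatedly are not copied into the goal. *)
Lemma newton_pair_spec st (c : pair_choices k) x y vx vy r :
  lo st < hi st -> (4 <= speed st)%N -> (0 < n)%N ->
  vx = (newton_value s x).2 -> vy = (newton_value s y).2 ->
  r = (newton_pair n s st c x y vx vy).2 ->
  match r with
  | Some J => pair_success q K h (lo st) (hi st) (speed st) x y J.1 J.2
  | None => pair_failure q n K h (lo st) (hi st) (speed st) x y
  end.
Proof.
move=> ab N4 n0 -> -> ->; rewrite !newton_value_spec; case: st ab N4 => a b N /= ab N4.
case: ifPn => [dx|dx]; first by rewrite /newton_pair /pair_failure /= dx.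
case: ifPn => [dy|dy]; first by rewrite /newton_pair /pair_failure /= dy.
have w0 : 0 < b - a by rewrite subr_gt0.
have N0 : 0 < N%:R :> rat by apply: lt_le_trans (natN_ge4 _ N4).
have u0 : 0 < cell a b N by rewrite cell_gt0.
have uE : (b - a) / (4 * N%:R) = cell a b N by [].
rewrite /newton_pair bind2; set w := (calc _).2; have wE : w = b - a by [].
have [ne kept] := keep_pair_spec (newton_quotient q x) (newton_quotient q y) (keep c) w0 n0.
rewrite bind2 wE; move: ne kept; set kp := (keep_pair _ _ _ _ _).2 => ne kept.
case: ifPn => [nk|/negPn kp1].
  by rewrite charge2 /pair_failure; cbv zeta => _ _ v1 v2 v3 v4; move/negP: nk; case; apply: kept.
rewrite bind2; set lam := (calc _).2; have lamE : lam = secant q x y by [].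
rewrite bind2; set below := (test_lt _ _).2; have belowE : below = (lam < a) by [].
rewrite bind2; set above := (test_lt _ _).2; have aboveE : above = (b < lam) by [].
case: ifPn => [|].
  rewrite belowE aboveE lamE charge2 /pair_failure => /orP lo_hi; cbv zeta => _ _ _ _ _ _ /andP[h1 h2]; exfalso.
  by case: lo_hi; rewrite ltNge ?h1 ?h2.
rewrite negb_or belowE aboveE -!leNgt => lam_in.
rewrite bind2; set z := (calc _).2; have zE : z = 4 * N%:R * (lam - a) / (b - a) by [].
rewrite bind2 charge2; set l := Num.floor z.
rewrite bind2 charge2; set la := Num.max _ _.
rewrite bind2 charge2; set lb := Num.min _ _.
rewrite bind2; set aij := (calc _).2; have aijE : aij = a + la%:~R * cell a b N by [].
rewrite bind2; set bij := (calc _).2; have bijE : bij = a + lb%:~R * cell a b N by [].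
rewrite bind2 grid_eps5 bind2; set delta := (calc _).2.
have deltaE : delta = eps * (4 * cell a b N) by rewrite -widthN.
rewrite bind2; set ea := (test_eq _ _).2; have eaE : ea = (aij == a) by [].
rewrite bind2; set a' := (if ea then _ else _).2.
rewrite bind2; set eb := (test_eq _ _).2; have ebE : eb = (bij == b) by [].
rewrite bind2; set b' := (if eb then _ else _).2.
rewrite bind2 charge2 opposite_signs_spec.
have loc : located K h a b N (secant q x y) a' b'.
  rewrite -lamE; exists l, (grid_offset (a_idx c)), (grid_offset (b_idx c)).
  split; try exact: grid_offsetP.
  - have lz : z = (lam - a) / cell a b N.
      by rewrite zE -(cellE a b N4); field; rewrite !lt0r_neq0.
    rewrite -ler_pdivlMr// -ltr_pdivrMr// -lz.
    by have := floor_itv z; rewrite intrD.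
  - have -> : a' = if ea then a else aij + grid_offset (a_idx c) * (4 * cell a b N).
      by rewrite /a'; case: (ea) => //; rewrite -mulrA -deltaE.
    (* The program tests a_ij = a; as cells have positive width this means that max(0, l - 1) = 0,
       that is l <= 1. *)
    rewrite eaE aijE -subr_eq0 addrAC subrr add0r mulf_eq0 (gt_eqF u0) orbF intr_eq0.
    rewrite /la max0_pred; case: (boolP (l <= 1)) => [_|l1]; first by rewrite eqxx.
    rewrite subr_eq0; case: eqP => [l1'|_]; first by rewrite l1' lexx in l1.
    by rewrite intrD rmorphN /=; ring.
  - have -> : b' = if eb then b else bij + grid_offset (b_idx c) * (4 * cell a b N).
      by rewrite /b'; case: (eb) => //; rewrite -mulrA -deltaE.
    have wN : b = a + (4 * N%:Z)%:~R * cell a b N.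
      have -> : (4 * N%:Z)%:~R = 4 * N%:R :> rat by rewrite intrM.
      by rewrite cellE// addrC subrK.
    have -> : eb = (4 * N%:R <= l + 2).
      rewrite ebE bijE [X in _ == X]wN (inj_eq (addrI a)) (inj_eq (mulIf (lt0r_neq0 u0))) eqr_int.
      by rewrite /lb -natz eq_minl.
    case: ifPn => // /negbTE l1; rewrite bijE /lb minEle l1.
    by rewrite intrD /=; ring.
case: ifPn => [sg|sg].
  by split=> //; exact: ne.
by rewrite /pair_failure; cbv zeta => _ _ _ _ _ _ _; exists a', b'.
Qed.

Lemma grid_point_value (m delta : rat) (i : grid k) :
  (grid_point m delta i).2 = m + ((i : nat)%:R - K%:R) * delta.
Proof. by []. Qed.

Lemma first_some (T : Type) (i : 'I_3) (r1 r2 r3 : option T) :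
  match ohead (pmap id (rot i [:: r1; r2; r3])) with
  | Some J => [\/ r1 = Some J, r2 = Some J | r3 = Some J]
  | None => [/\ r1 = None, r2 = None & r3 = None]
  end.
Proof.
case: i => [[|[|[|//]]] ?]; case: r1 r2 r3 => [?|] [?|] [?|] /=;
  by [split|apply: Or31|apply: Or32|apply: Or33].
Qed.

Lemma newton_test_spec st (c : choices k) :
  lo st < hi st -> (4 <= speed st)%N -> (0 < n)%N ->
  exists x, samples K h (lo st) (hi st) x /\
  match (newton_test n s c st).2 with
  | Some J => newton_step q K h (lo st) (hi st) (speed st) x J.1 J.2
  | None => pair_failure q n K h (lo st) (hi st) (speed st) x.1.1 x.2
  end.
Proof.
move=> ab N4 n0; set a := lo st in ab *; set b := hi st in ab *.
pose pt t (i : grid k) := a + (t + grid_offset i) * (b - a).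
exists (pt (1 / 4) (x1_idx c), pt (1 / 2) (x2_idx c), pt (3 / 4) (x3_idx c)).
split; first by split; eexists; try reflexivity; exact: grid_offsetP.
rewrite /newton_test bind2; set w := (calc _).2; have wE : w = b - a by [].
rewrite bind2 grid_eps5 bind2; set delta := (calc _).2; have deltaE : delta = eps * w by [].
rewrite bind2; set m1 := (calc _).2; have m1E : m1 = a + 1 / 4 * w by [].
rewrite bind2; set m2 := (calc _).2; have m2E : m2 = a + 1 / 2 * w by [].
rewrite bind2; set m3 := (calc _).2; have m3E : m3 = a + 3 / 4 * w by [].
do 3 rewrite bind2 grid_point_value.
have ptE m t (i : grid k) : m = a + t * w -> m + ((i : nat)%:R - K%:R) * delta = pt t i.
  by move=> ->; rewrite /pt /grid_offset deltaE wE; ring.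
rewrite !(ptE _ _ _ m1E) !(ptE _ _ _ m2E) !(ptE _ _ _ m3E).
move: (pt _ _) (pt _ _) (pt _ _) => x3 x2 x1.
rewrite bind2; set v1 := (newton_value _ _).2.
rewrite bind2; set v2 := (newton_value _ _).2.
rewrite bind2; set v3 := (newton_value _ _).2.
rewrite bind2; set r12 := (newton_pair n s st (c12 c) x1 x2 v1 v2).2; have s12 := newton_pair_spec ab N4 n0 (erefl v1) (erefl v2) (erefl r12).
rewrite bind2; set r13 := (newton_pair n s st (c13 c) x1 x3 v1 v3).2; have s13 := newton_pair_spec ab N4 n0 (erefl v1) (erefl v3) (erefl r13).
rewrite bind2; set r23 := (newton_pair n s st (c23 c) x2 x3 v2 v3).2; have s23 := newton_pair_spec ab N4 n0 (erefl v2) (erefl v3) (erefl r23).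
rewrite charge2; clearbody r12 r13 r23.
have := first_some (first_pair c) r12 r13 r23.
case: (ohead _) => [J [] rE|[_ rE _]].
- by apply: Or31; move: s12; rewrite rE.
- by apply: Or32; move: s13; rewrite rE.
- by apply: Or33; move: s23; rewrite rE.
- by move: s13; rewrite rE.
Qed.

Lemma boundary_test_spec st (c : choices k) :
  exists ml mr, boundary_points K h (lo st) (hi st) (speed st) ml mr /\
  match (boundary_test n s c st).2 with
  | Some J => [/\ q.[lo st] * q.[ml] < 0, J.1 = lo st & J.2 = ml] \/
              [/\ q.[hi st] * q.[mr] < 0, J.1 = mr & J.2 = hi st]
  | None => ~~ (q.[lo st] * q.[ml] < 0) /\ ~~ (q.[hi st] * q.[mr] < 0)
  end.
Proof.
case: st => a b N; rewrite /boundary_test.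
rewrite bind2; set w := (calc _).2; have wE : w = b - a by [].
rewrite bind2 grid_eps2 bind2; set delta := (calc _).2.
have deltaE : delta = 8 * eps * (w / N%:R) by [].
rewrite bind2; set ml := (calc _).2; have mlE : ml = a + w / (2 * N%:R) by [].
rewrite bind2; set mr := (calc _).2; have mrE : mr = b - w / (2 * N%:R) by [].
do 2 rewrite bind2 grid_point_value.
set ml' := ml + _; set mr' := mr + _.
exists ml', mr'; split.
  have half : w / (2 * N%:R) = 1 / 2 * (w / N%:R) by rewrite invfM mulrA mulrAC [RHS]mulrC; ring.
  split; [exists (grid_offset (ml_idx c))|exists (- grid_offset (mr_idx c))].
  - exact: grid_offsetP.
  - by rewrite /ml' mlE deltaE half wE /grid_offset /=; ring.
  - by apply: offsetN; exact: grid_offsetP.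
  - by rewrite /mr' mrE deltaE half wE /grid_offset /=; ring.
rewrite bind2 opposite_signs_spec bind2 opposite_signs_spec charge2 /=.
case: ifP => [sl|/negbT sl]; first by left.
by case: ifP => [sr|/negbT sr]; [right|].
Qed.

Lemma iteration_spec st (c : choices k) e :
  lo st < hi st -> speed st = speed_of e -> (0 < e)%N -> (0 < n)%N ->
  match (iteration n s c st).2 with
  | inl st' => exists x e' succ,
      real_step q n K h x (lo st) (hi st) e (lo st') (hi st') e' succ /\ speed st' = speed_of e'
  | inr m => q.[m] = 0 /\
      exists2 d, offset K h d & m = lo st + (1 / 2 + 8 * d) * (hi st - lo st)
  end.
Proof.
move=> ab Ne e0 n0; have N4 : (4 <= speed st)%N by rewrite Ne speed_of_ge4.
rewrite /iteration bind2; have [x [xs]] := newton_test_spec c ab N4 n0.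
case: (newton_test _ _ _ _).2 => [J ns|nf].
  rewrite charge2 /=; exists x, e.+1, true; split; last by rewrite Ne -speed_ofS.
  by split=> //; split=> //; left; rewrite -Ne.
rewrite bind2; have [ml [mr [pts]]] := boundary_test_spec st c.
case: (boundary_test _ _ _ _).2 => [J bs|[nl nr]].
  rewrite charge2 /=; exists x, e.+1, true; split; last by rewrite Ne -speed_ofS.
  split=> //; split=> //; right; rewrite -Ne; split=> //; exists ml, mr; split=> //.
set a := lo st in ab xs nf pts nl *; set b := hi st in ab xs nf pts nr *.
rewrite /bisection bind2; set w := (calc _).2; have wE : w = b - a by [].
rewrite bind2; set mid := (calc _).2; have midE : mid = (a + b) / 2 by [].
rewrite bind2 grid_eps2 bind2; set delta := (calc _).2.
have deltaE : delta = w * (8 * eps) by [].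
rewrite bind2 grid_point_value; set m := mid + _.
have mE : m = a + (1 / 2 + 8 * grid_offset (m_idx c)) * (b - a).
  by rewrite /m midE deltaE wE /grid_offset; field.
rewrite bind2 opposite_signs_spec bind2 charge2 Ne slow_down_speed//.
have bis a' b' : q.[m] != 0 -> [/\ q.[a] * q.[m] < 0, a' = a & b' = m] \/
    [/\ ~~ (q.[a] * q.[m] < 0), a' = m & b' = b] -> exists x' e' succ,
    real_step q n K h x' a b e a' b' e' succ /\ speed_of (maxn 1 e.-1) = speed_of e'.
  move=> m0 sides; exists x, (maxn 1 e.-1), false; split=> //; split=> //; split=> //.
  rewrite -Ne; split=> //; first by exists ml, mr.
  by exists (grid_offset (m_idx c)); cbv zeta; rewrite -mE; split=> //; exact: grid_offsetP.
case: ifPn => [sg|sg].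
  rewrite charge2; apply: bis; last by left.
  by apply: contraTneq sg => ->; rewrite mulr0 ltxx.
rewrite bind2 eval_sparse bind2; set z := (test_eq _ _).2; have zE : z = (q.[m] == 0) by [].
rewrite charge2 zE; case: eqP => [m0|/eqP m0]; last by apply: bis => //; right.
by split=> //; exists (grid_offset (m_idx c)) => //; exact: grid_offsetP.
Qed.

End Semantics.

(** * Counting operations *)

Lemma bind_le (T U : Type) (m : cost T) (f : T -> cost U) a b :
  (m.1 <= a)%N -> (forall x, (f x).1 <= b)%N -> ((bind m f).1 <= a + b)%N.
Proof. by move=> ma fb; rewrite leq_add. Qed.

Lemma if_le (T : Type) (t : bool) (m m' : cost T) a b :
  (m.1 <= a)%N -> (m'.1 <= b)%N -> ((if t then m else m').1 <= a + b)%N.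
Proof. by case: t => ma mb; rewrite (leq_trans ma, leq_trans mb) ?leq_addr ?leq_addl. Qed.

Lemma option_le (T U : Type) (o : option T) (f : T -> cost U) (m : cost U) a b :
  (forall x, (f x).1 <= a)%N -> (m.1 <= b)%N ->
  ((if o is Some x then f x else m).1 <= a + b)%N.
Proof.
by case: o => [x|] fa mb; [rewrite (leq_trans (fa x)) ?leq_addr|rewrite (leq_trans mb) ?leq_addl].
Qed.

Lemma cost_le (T : Type) (m : cost T) a : m.1 = a -> (m.1 <= a)%N.
Proof. by move=> ->. Qed.

Ltac count_nops :=
  apply: cost_le; cbv [calc charge test_lt test_eq grid_point slow_down nops fst]; reflexivity.

(** Builds the bound by recursion on the program: the right-hand side is an existential variable
    which the rules instantiate with a sum, branches being added rather than compared. [known]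
    handles calls of subroutines, and the caller then compares the sum with the stated bound. *)
Ltac count_ops known :=
  lazymatch goal with
  | |- is_true (fst (bind _ _) <= _)%N => eapply bind_le; [count_ops known | intros ?; count_ops known]
  | |- is_true (fst (if _ then _ else _) <= _)%N => eapply if_le; [count_ops known | count_ops known]
  | |- is_true (fst (match _ with Some _ => _ | None => _ end) <= _)%N =>
      eapply option_le; [intros ?; count_ops known | count_ops known]
  | |- is_true (fst (calc _) <= _)%N => count_nops
  | |- is_true (fst (test_lt _ _) <= _)%N => count_nops
  | |- is_true (fst (test_eq _ _) <= _)%N => count_nops
  | |- is_true (fst (grid_point _ _ _) <= _)%N => count_nops
  | |- is_true (fst (charge _ _) <= _)%N => count_nops
  | |- _ => known
  end.

Section IterationCost.
Variables (k n : nat) (s : seq (nat * int)).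
Local Notation h := (up_log 2 n).
Hypothesis low : low_degree h s.
Local Notation Q := (size s * (2 * h + 3))%N.

Lemma opposite_signs_cost x y : ((opposite_signs s x y).1 <= 2 * Q + 2)%N.
Proof.
rewrite /opposite_signs; eapply leq_trans; first by count_ops ltac:(apply: eval_cost low).
lia.
Qed.

Lemma newton_value_cost x : ((newton_value s x).1 <= 2 * Q + 2)%N.
Proof.
rewrite /newton_value; eapply leq_trans; first by count_ops ltac:(first [apply: eval_cost low | apply: eval_deriv_cost low]).
lia.
Qed.

Lemma grid_eps_cost c : ((grid_eps c n).1 <= 2 * (c + h))%N.
Proof. by apply: pow_cost; rewrite ltnW// ltn_expl. Qed.

Lemma keep_pair_cost w vi vj c : ((keep_pair n w vi vj c).1 <= 30)%N.
Proof. by rewrite /keep_pair; eapply leq_trans; first by count_ops idtac. Qed.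

Ltac known := first [apply: opposite_signs_cost | apply: newton_value_cost
  | apply: grid_eps_cost | apply: keep_pair_cost].

Lemma newton_pair_cost st (c : pair_choices k) x y vx vy :
  ((newton_pair n s st c x y vx vy).1 <= 2 * Q + 2 * h + 100)%N.
Proof.
case: vx => [vx|//]; case: vy => [vy|//]; rewrite /newton_pair.
eapply leq_trans; first by count_ops known.
lia.
Qed.

Ltac known2 := first [known | apply: newton_pair_cost].

Lemma newton_test_cost st (c : choices k) :
  ((newton_test n s c st).1 <= 12 * Q + 8 * h + 400)%N.
Proof.
rewrite /newton_test; eapply leq_trans; first by count_ops known2.
lia.
Qed.

Lemma boundary_test_cost st (c : choices k) :
  ((boundary_test n s c st).1 <= 4 * Q + 2 * h + 40)%N.
Proof.
rewrite /boundary_test; eapply leq_trans; first by count_ops known2.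
lia.
Qed.

Lemma bisection_cost st (c : choices k) :
  ((bisection n s c st).1 <= 3 * Q + 2 * h + 40)%N.
Proof.
rewrite /bisection; eapply leq_trans; first by count_ops ltac:(first [known | apply: eval_cost low | count_nops]).
lia.
Qed.

Lemma iteration_cost st (c : choices k) : (0 < size s)%N ->
  ((iteration n s c st).1 <= 600 * (size s * h.+1))%N.
Proof.
rewrite /iteration => s0; eapply leq_trans.
  by count_ops ltac:(idtac; lazymatch goal with
    | |- is_true (fst (newton_test _ _ _ _) <= _)%N => apply: newton_test_cost
    | |- is_true (fst (boundary_test _ _ _ _) <= _)%N => apply: boundary_test_cost
    | |- _ => apply: bisection_cost end).
nia.
Qed.

End IterationCost.

(** * From rational runs to real trajectories *)

Section Embedding.
Variables (R : realType) (q : {poly rat}) (n K h : nat).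
Local Notation f := (ratr : rat -> R).
Local Notation P := (map_poly f q).
Implicit Types (a b x y lam d : rat) (N : nat).

Lemma horner_ratr x : P.[f x] = f q.[x]. Proof. exact: horner_map. Qed.

Lemma horner_deriv_ratr x : P^`().[f x] = f q^`().[x].
Proof. by rewrite deriv_map horner_map. Qed.

Lemma newton_quotient_ratr x : newton_quotient P (f x) = f (newton_quotient q x).
Proof. by rewrite /newton_quotient horner_ratr horner_deriv_ratr -fmorph_div. Qed.

Lemma secant_ratr x y : secant P (f x) (f y) = f (secant q x y).
Proof.
by rewrite /secant !newton_quotient_ratr -!rmorphB -fmorph_div -rmorphM -rmorphD.
Qed.

Lemma cell_ratr a b N : cell (f a) (f b) N = f (cell a b N).
Proof. by rewrite /cell -rmorphB fmorph_div rmorphM !rmorph_nat. Qed.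

Lemma offset_ratr d : offset K h d -> offset K h (f d).
Proof.
case=> i iK ->; exists i => //.
by rewrite rmorphM rmorph_int /eps fmorphV rmorphXn rmorph_nat.
Qed.

Lemma located_ratr a b N lam a' b' : located K h a b N lam a' b' ->
  located K h (f a) (f b) N (f lam) (f a') (f b').
Proof.
move=> [l [y [z [/andP[l1 l2] oy oz a'E b'E]]]]; exists l, (f y), (f z).
rewrite cell_ratr; split; try exact: offset_ratr.
- have <- : f (l%:~R * cell a b N) = l%:~R * f (cell a b N) by rewrite rmorphM rmorph_int.
  have <- : f ((l%:~R + 1) * cell a b N) = (l%:~R + 1) * f (cell a b N).
    by rewrite rmorphM rmorphD rmorph_int rmorph1.
  by rewrite -rmorphB ler_rat ltr_rat l1.
- rewrite a'E; case: ifP => // _.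
  by rewrite rmorphD rmorphM rmorphD rmorphB rmorphM rmorph_int rmorph_nat rmorph1.
- rewrite b'E; case: ifP => // _.
  by rewrite rmorphD rmorphM 2!rmorphD rmorphM rmorph_int !rmorph_nat.
Qed.

Lemma prod_ratr_lt0 x y : (P.[f x] * P.[f y] < 0) = (q.[x] * q.[y] < 0).
Proof. by rewrite !horner_ratr -rmorphM ltrq0. Qed.

Lemma pair_success_ratr a b N x y a' b' : pair_success q K h a b N x y a' b' ->
  pair_success P K h (f a) (f b) N (f x) (f y) (f a') (f b').
Proof.
case=> dx dy ne [/andP[s1 s2] loc sg]; split; rewrite ?horner_deriv_ratr ?fmorph_eq0//.
  by rewrite !newton_quotient_ratr (inj_eq (fmorph_inj _)).
rewrite secant_ratr !ler_rat s1 s2 prod_ratr_lt0 sg; split=> //.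
exact: located_ratr.
Qed.

Lemma pair_failure_ratr a b N x y : pair_failure q n K h a b N x y ->
  pair_failure P n K h (f a) (f b) N (f x) (f y).
Proof.
move=> H; rewrite /pair_failure; cbv zeta.
rewrite !horner_deriv_ratr !fmorph_eq0 !newton_quotient_ratr secant_ratr -!rmorphB -!ratr_norm.
have nE c : c%:R * n%:R = f (c%:R * n%:R) by rewrite rmorphM !rmorph_nat.
have -> : 2 * f (b - a) = f (2 * (b - a)) by rewrite rmorphM rmorph_nat.
rewrite !nE -!fmorph_div !ler_rat !ltr_rat.
move=> h1 h2 h3 h4 h5 h6 h7; have [a' [b' [loc sg]]] := H h1 h2 h3 h4 h5 h6 h7.
by exists (f a'), (f b'); rewrite prod_ratr_lt0; split=> //; exact: located_ratr.
Qed.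

Lemma samples_ratr a b (x : rat * rat * rat) : samples K h a b x ->
  samples K h (f a) (f b) (f x.1.1, f x.1.2, f x.2).
Proof.
have sE t d : f (a + (t + d) * (b - a)) = f a + (f t + f d) * (f b - f a).
  by rewrite rmorphD rmorphM rmorphB !rmorphD.
case=> -[d1 o1 ->] [d2 o2 ->] [d3 o3 ->]; rewrite !sE /=.
by split; [exists (f d1)|exists (f d2)|exists (f d3)];
  rewrite ?fmorph_div ?rmorph_nat ?rmorph1 //; exact: offset_ratr.
Qed.

Lemma half_ratr d : f (1 / 2 + 8 * d) = 1 / 2 + 8 * f d.
Proof. by rewrite rmorphD rmorphM fmorph_div !rmorph_nat rmorph1. Qed.

Lemma boundary_points_ratr a b N ml mr : boundary_points K h a b N ml mr ->
  boundary_points K h (f a) (f b) N (f ml) (f mr).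
Proof.
have wN : f ((b - a) / N%:R) = (f b - f a) / N%:R by rewrite fmorph_div rmorphB rmorph_nat.
case=> -[d1 o1 ->] [d2 o2 ->]; split; [exists (f d1)|exists (f d2)];
  try exact: offset_ratr.
  by rewrite rmorphD rmorphM /= half_ratr wN.
by rewrite rmorphB rmorphM /= half_ratr wN.
Qed.

Lemma real_step_ratr a b e a' b' e' (x : rat * rat * rat) (s : bool) : real_step q n K h x a b e a' b' e' s ->
  real_step P n K h (f x.1.1, f x.1.2, f x.2) (f a) (f b) e (f a') (f b') e' s.
Proof.
case=> /samples_ratr xs st; split=> //; case: s st => -[st e'E]; split=> //.
  case: st => [ns|[pf [ml [mr [pts bd]]]]]; [left|right].
    by case: ns => /pair_success_ratr ?; [apply: Or31|apply: Or32|apply: Or33].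
  split; first exact: pair_failure_ratr.
  exists (f ml), (f mr); split; first exact: boundary_points_ratr.
  by rewrite !prod_ratr_lt0; case: bd => -[sg -> ->]; [left|right].
case: st => pf [ml [mr [pts nl nr]]] [d [od m0 sides]]; split; first exact: pair_failure_ratr.
  by exists (f ml), (f mr); rewrite !prod_ratr_lt0; split=> //; exact: boundary_points_ratr.
exists (f d); cbv zeta.
have -> : f a + (1 / 2 + 8 * f d) * (f b - f a) = f (a + (1 / 2 + 8 * d) * (b - a)).
  by rewrite rmorphD rmorphM rmorphB /= half_ratr.
rewrite prod_ratr_lt0 horner_ratr fmorph_eq0; split=> //; first exact: offset_ratr.
by case: sides => -[sg -> ->]; [left|right].
Qed.

End Embedding.

(** * The sign change at a simple root *)

Section SimpleRoot.
Variable R : rcfType.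
Implicit Types (P g : {poly R}) (xi a b : R).

Lemma simple_root_factor P xi : P != 0 -> mup xi P = 1%N ->
  exists2 g, P = g * ('X - xi%:P) & g.[xi] != 0.
Proof.
move=> P0 m1; have : 'X - xi%:P %| P by rewrite XsubC_dvd// m1.
case/(dvdpP _ _) => g PE; exists g => //; apply/negP => g0.
have : ('X - xi%:P) ^+ 2 %| P.
  by rewrite PE expr2 dvdp_mul// dvdp_XsubCl.
by rewrite -mup_geq// m1.
Qed.

Lemma no_root_sign g a b : a <= b -> (forall y, a <= y <= b -> g.[y] != 0) ->
  0 < g.[a] * g.[b].
Proof.
move=> ab nz; have an : g.[a] != 0 by rewrite nz// lexx ab.
have bn : g.[b] != 0 by rewrite nz// lexx ab.
rewrite lt_def mulf_neq0//= leNgt; apply/negP => sg.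
have [x xab] : exists2 x, a <= x <= b & root (g.[b] *: g) x.
  by apply: poly_ivt => //; rewrite !hornerZ -expr2 sqr_ge0 andbT mulrC ltW.
by rewrite rootZ// => /rootP gx; have := nz x xab; rewrite gx eqxx.
Qed.

(** P = g (X - xi), and g has no root on the closed interval, hence constant sign there by the
    intermediate value theorem. *)
Lemma simple_root_signs P xi a b : P != 0 -> mup xi P = 1%N -> a < xi < b ->
  (forall y, a <= y <= b -> root P y -> y = xi) -> signs_at P xi a b.
Proof.
move=> P0 m1 xi_in uniq_xi; have [g PE gxi] := simple_root_factor P0 m1.
have gnz y : a <= y <= b -> g.[y] != 0.
  move=> yab; apply/negP => gy; have yxi : y = xi.
    by apply: uniq_xi => //; rewrite PE rootM /root gy.
  by move: gxi; rewrite -yxi gy.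
have gg x y : a <= x <= b -> a <= y <= b -> 0 < g.[x] * g.[y].
  wlog xy : x y / x <= y => [H|] /andP[ax xb] /andP[ay yb].
    have [xy|/ltW yx] := leP x y; first by apply: H => //; apply/andP.
    by rewrite mulrC; apply: H => //; apply/andP.
  apply: no_root_sign => // z /andP[xz zy]; apply: gnz.
  by rewrite (le_trans ax)// (le_trans zy).
move=> x y xab yab; rewrite PE !hornerM !hornerXsubC.
by rewrite mulrACA pmulr_rlt0 ?gg.
Qed.

Lemma simple_root_deriv P xi : P != 0 -> mup xi P = 1%N -> P.[xi] = 0 /\ P^`().[xi] != 0.
Proof.
move=> P0 m1; have [g PE gxi] := simple_root_factor P0 m1.
rewrite PE derivM derivXsubC mulr1 hornerD !hornerM hornerXsubC subrr !mulr0 add0r.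
by split.
Qed.

End SimpleRoot.

Lemma log2_up_log (R : realType) m : (0 < m)%N -> (up_log 2 m)%:R <= log2 (m%:R : R) + 1.
Proof.
case: m => [//|[|m]] _; first by rewrite up_log1 /log2 ln1 mul0r add0r ler01.
have h0 : (0 < up_log 2 m.+2)%N by rewrite up_log_gt0.
have := up_log_gtn (ltnSn 1) (isT : (1 < m.+2)%N) => /ltnW mm.
rewrite -[X in X%:R <= _](prednK h0) -natr1 lerD2r; apply: le_trans (_ : log2 (2 ^+ (up_log 2 m.+2).-1) <= _).
  by rewrite log2_exp2.
by apply: ler_log2; rewrite ?exprn_gt0// -natrX ler_nat.
Qed.

Lemma exp_up_log_le n : (0 < n)%N -> (2 ^ up_log 2 n <= 2 * n)%N.
Proof.
case: n => [//|[|n]] _ //; have h0 : (0 < up_log 2 n.+2)%N by rewrite up_log_gt0.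
rewrite -(prednK h0) expnS leq_pmul2l// ltnW//.
exact: up_log_gtn (ltnSn 1) (isT : (1 < n.+2)%N).
Qed.

Lemma speed_of_inj : injective speed_of.
Proof. by move=> i j /eqP; rewrite /speed_of !eqn_exp2l// => /eqP. Qed.

(** * Runs, termination and correctness *)

Section Runs.
Variables (k n : nat) (s : seq (nat * int)) (width : rat) (ch : nat -> choices k).

Definition continues (T t : nat) (F : nat -> state) : Prop := forall i, (i < T)%N ->
  width <= hi (F i) - lo (F i) /\ (iteration n s (ch (t + i)) (F i)).2 = inl (F i.+1).

(** Termination is not known in advance. Either a run ends within [fuel] iterations, or that many
    iterations can be made, which the bound on trajectories later refutes. *)
Lemma run_or_continues fuel t st :
  (exists it ops o, run n s width ch t st it ops o /\ (it <= fuel)%N) \/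
  exists F, F 0%N = st /\ continues fuel t F.
Proof.
elim: fuel t st => [|fuel IH] t st; first by right; exists (fun=> st).
case E : (test_lt (hi st - lo st) width) => [c [|]].
  by left; exists 0%N, c, (Defs.Interval (lo st) (hi st)); split=> //; exact: run_stop.
have wd : width <= hi st - lo st by move: E => [_ /negbT]; rewrite -leNgt.
case I : (iteration n s (ch t) st) => [d [st'|m]]; last first.
  by left; exists 1%N, (c + d)%N, (Exact m); split=> //; exact: run_exact E I.
have [[it [ops [o [r itf]]]]|[F [F0 cont]]] := IH t.+1 st'.
  by left; exists it.+1, (c + d + ops)%N, o; split=> //; exact: run_step E I r.
right; exists (fun i => if i is j.+1 then F j else st); split=> // -[_|i iT].
  by rewrite addn0 I F0.
by have := cont i iT; rewrite addnS -addSn.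
Qed.

Lemma run_cost c t st it ops o : (forall t st, (iteration n s (ch t) st).1 <= c)%N ->
  run n s width ch t st it ops o -> (ops <= 2 * it.+1 + c * it)%N.
Proof.
move=> bd; elim=> {t st it ops o} [t st d [dE _]|t st d e m [dE _] I|t st d e st' it ops o [dE _] I _ IH].
- by rewrite -dE; lia.
- by have := bd t st; rewrite I -dE /=; lia.
- by have := bd t st; rewrite I -dE /=; lia.
Qed.

End Runs.

Section Correctness.
Variables (R : realType) (k n : nat) (p : {poly int}) (xi kap : R).
Local Notation P := (map_poly intr p : {poly R}).
Local Notation h := (up_log 2 n).
Local Notation K := (uphalf k).

Definition valid (st : state) (e : nat) : Prop :=
  [/\ state_ok P K h xi kap (ratr (lo st)) (ratr (hi st)) (speed_of e),
      speed st = speed_of e & (0 < e)%N].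

Lemma map_poly_ratr_int : map_poly (ratr : rat -> R) (map_poly intr p) = P.
Proof. by rewrite -map_poly_comp; apply: eq_map_poly => c /=; rewrite rmorph_int. Qed.

Lemma valid_lt st e : valid st e -> lo st < hi st.
Proof. by case=> -[/andP[h1 h2] _ _ _ _] _ _; rewrite -(ltr_rat R) (lt_trans h1). Qed.

Lemma valid_step st (c : choices k) e st' : (0 < n)%N -> valid st e ->
  (iteration n (sparse p) c st).2 = inl st' -> exists x e' b,
  real_step P n K h x (ratr (lo st)) (ratr (hi st)) e (ratr (lo st')) (ratr (hi st')) e' b /\
  valid st' e'.
Proof.
move=> n0 va it; have [ok se e0] := va.
have := iteration_spec p c (valid_lt va) se e0 n0; rewrite it => -[x [e' [b [st1 se']]]].
have st2 := @real_step_ratr R _ _ _ _ _ _ _ _ _ _ _ _ st1; rewrite map_poly_ratr_int in st2.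
exists (ratr x.1.1, ratr x.1.2, ratr x.2), e', b; split=> //.
by have [ok' e'0 _ _ _] := real_step_ok ok e0 st2.
Qed.

Lemma valid_exact st (c : choices k) e m : (0 < n)%N -> valid st e ->
  (iteration n (sparse p) c st).2 = inr m -> root P (ratr m) /\ lo st < m < hi st.
Proof.
move=> n0 va it; have [ok se e0] := va.
have ab := valid_lt va.
have := iteration_spec p c ab se e0 n0; rewrite it => -[m0 [d od mE]].
split; first by rewrite -map_poly_ratr_int /root horner_ratr m0 rmorph0.
have [_ _ kap_le /(_ _ (offset_ratr R od)) /andP[d1 d2] _] := ok.
have dle : - (1 / 32) <= d <= 1 / 32.
  rewrite -!(ler_rat R) rmorphN fmorph_div rmorph1 rmorph_nat.
  by apply/andP; split; [apply: le_trans d1; rewrite lerN2|apply: le_trans kap_le].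
have w0 : 0 < hi st - lo st by rewrite subr_gt0.
have [dl dh] := andP dle.
have dw1 := ler_wpM2r (ltW w0) dl; have dw2 := ler_wpM2r (ltW w0) dh.
by rewrite mE; clear - dw1 dw2 w0; apply/andP; split; lra.
Qed.

Lemma run_correct (a0 b0 : rat) L (ch : nat -> choices k) t st it ops o e : (0 < n)%N ->
  (forall y : R, ratr a0 < y < ratr b0 -> root P y -> y = xi) ->
  run n (sparse p) (2 ^- L) ch t st it ops o ->
  valid st e -> a0 <= lo st -> hi st <= b0 -> correct_output a0 b0 xi L o.
Proof.
move=> n0 uniq_xi r; elim: r e => {t st it ops o}
  [t st c [_ wd]|t st c d m _ it|t st c d st' it ops o _ I _ IH] e va a0l hb0.
- by have [[xi_in _ _ _ _] _ _] := va.
- have [m0 /andP[lm mh]] : root P (ratr m) /\ lo st < m < hi st.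
    by apply: (valid_exact (c := ch t) n0 va); rewrite it.
  have m_in : a0 < m < b0 by rewrite (le_lt_trans a0l)// (lt_le_trans mh).
  by split=> //; apply/esym/uniq_xi => //; rewrite !ltr_rat.
- have [x [e' [b [stp va']]]] : exists x e' b, real_step P n K h x (ratr (lo st))
    (ratr (hi st)) e (ratr (lo st')) (ratr (hi st')) e' b /\ valid st' e'.
    by apply: (valid_step (c := ch t) n0 va); rewrite I.
  have [ok _ e0] := va; have [_ _ [aa bb] _ _] := real_step_ok ok e0 stp.
  rewrite !ler_rat in aa bb.
  by apply: (IH e'); rewrite ?(le_trans a0l) ?(le_trans bb).
Qed.

Lemma continues_trajectory width (ch : nat -> choices k) T t F e : (0 < n)%N ->
  continues n (sparse p) width ch T t F -> valid (F 0%N) e ->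
  exists E X S, E 0%N = e /\
    trajectory P n K h T (fun i => ratr (lo (F i))) (fun i => ratr (hi (F i))) E X S.
Proof.
move=> n0 cont va0.
have vas i : exists e', (i <= T)%N -> valid (F i) e'.
  elim: i => [|i [e' IH]]; first by exists e.
  have [iT|iT] := ltnP i T; last by exists 0%N.
  have [_ I] := cont i iT; have [x [e'' [b [_ va]]]] := valid_step n0 (IH (ltnW iT)) I.
  by exists e''.
(* Exponents and sample points are only known to exist for each state. Exponents of consecutive
   steps match because the speed determines its exponent. *)
have [E HE] := boolp.choice vas.
have stps i : exists xb : (R * R * R) * bool, (i < T)%N -> real_step P n K h xb.1
  (ratr (lo (F i))) (ratr (hi (F i))) (E i) (ratr (lo (F i.+1))) (ratr (hi (F i.+1))) (E i.+1) xb.2.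
  have [iT|iT] := ltnP i T; last by exists ((0, 0, 0), true).
  have [_ I] := cont i iT; have [x [e' [b [stp va]]]] := valid_step n0 (HE i (ltnW iT)) I.
  exists (x, b) => _; have [_ s1 _] := HE i.+1 iT; have [_ s2 _] := va.
  by rewrite -(speed_of_inj (etrans (esym s2) s1)).
have [X HX] := boolp.choice stps.
exists E, (fun i => (X i).1), (fun i => (X i).2); split; last exact: HX.
have [_ s1 _] := HE 0%N (leq0n T); have [_ s2 _] := va0.
exact: speed_of_inj (etrans (esym s1) s2).
Qed.

End Correctness.

Lemma grid_radius (R : realFieldType) K h (d : R) :
  offset K h d -> - (K%:R * eps R h) <= d <= K%:R * eps R h.
Proof.
case=> i iK ->; rewrite -ler_norml normrM [X in _ * X]ger0_norm; last first.
  by rewrite invr_ge0 exprn_ge0.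
rewrite ler_pM2r ?invr_gt0 ?exprn_gt0//.
by rewrite -intr_norm -abszE -pmulrn ler_nat.
Qed.

Lemma grid_radius_le (R : realFieldType) k n : (0 < n)%N -> (k <= n.+1)%N ->
  (uphalf k)%:R * eps R (up_log 2 n) <= 1 / 32.
Proof.
move=> n0 kn; rewrite epsE ler_pdivrMr ?mulr_gt0 ?exprn_gt0//.
have -> : 1 / 32 * (32 * 2 ^+ up_log 2 n) = (2 ^ up_log 2 n)%:R :> R by rewrite natrX; field.
by rewrite ler_nat; have := up_logP n (ltnSn 1); lia.
Qed.

(** The constant 3/128 is attained for n = 4 and k = 5, where the grid radius is 3 steps of 1/(32 *
    4). *)
Lemma grid_radius_fine (R : realType) k n : (3 <= n)%N -> (k <= n.+1)%N ->
  fine_grid (uphalf k) (up_log 2 n) ((uphalf k)%:R * eps R (up_log 2 n)).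
Proof.
move=> n3 kn; have nh := up_logP n (ltnSn 1).
have h2 : (2 <= up_log 2 n)%N.
  by move: nh; case: (up_log 2 n) => [|[|//]]; rewrite ?expn0 ?expn1; lia.
have h4 : (4 <= 2 ^ up_log 2 n)%N by rewrite (@leq_exp2l 2 2).
have K2 : (2 * uphalf k <= 2 ^ up_log 2 n + 2)%N by lia.
split=> //; rewrite epsE ler_pdivrMr ?mulr_gt0 ?exprn_gt0//.
have -> : 3 / 128 * (32 * 2 ^+ up_log 2 n) = (3 * 2 ^ up_log 2 n)%:R / 4 :> R.
  by rewrite natrM natrX; field.
by rewrite ler_pdivlMr// -natrM ler_nat; lia.
Qed.

Lemma factored_root (R : realType) (P : {poly R}) rs xi z : factored P rs xi ->
  root (map_poly (real_complex R) P) z = (z \in rs).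
Proof. by case=> -[c c0 ->] _ _; rewrite rootZ// root_prod_XsubC. Qed.

Lemma factored_exists (R : realType) (P : {poly R}) xi : P != 0 -> mup xi P = 1%N ->
  exists rs, factored P rs xi /\ (size rs).+1 = size P.
Proof.
move=> P0 m1; have [rs PE] := closed_field_poly_normal (map_poly (real_complex R) P).
have [x0 dx0] := simple_root_deriv P0 m1.
have c0 : lead_coef (map_poly (real_complex R) P) != 0 by rewrite lead_coef_eq0 map_poly_eq0.
exists rs; split; first by split=> //; exists (lead_coef (map_poly (real_complex R) P)).
rewrite -(size_map_poly (real_complex R) P) PE size_scale//.
by rewrite size_prod_XsubC.
Qed.

(* A root z of P close to xi is not real, so xi, z and its conjugate are distinct. *)
Lemma near_root_degree (R : realType) (P : {poly R}) rs xi z (a b d : R) :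
  factored P rs xi -> d <= xi - a -> d <= b - xi ->
  (forall y, a < y < b -> root P y -> y = xi) ->
  z \in rs -> z != real_complex R xi -> near_xi xi d z -> (3 <= size rs)%N.
Proof.
move=> fac da db uniq_xi; case: z => x y zrs zxi near.
have d0 : 0 <= d by rewrite ltW// (le_lt_trans _ near)// normc_ge0.
have [xd _] := near_xi_bounds d0 near.
have y0 : y != 0.
  apply: contraNneq zxi => y0; rewrite y0 in zrs *.
  have rx : root P x.
    have : root (map_poly (real_complex R) P) (real_complex R x) by rewrite (factored_root _ fac).
    by rewrite /root horner_map /= fmorph_eq0.
  suff -> : x = xi by [].
  apply: uniq_xi rx; move: xd; rewrite ltr_norml => /andP[x1 x2].
  by clear - x1 x2 da db; apply/andP; split; lra.
have crs : Complex x (- y) \in rs.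
  by rewrite -(factored_root _ fac); apply: real_conj_root (Complex x y) _; rewrite (factored_root _ fac).
have sub : {subset [:: real_complex R xi; Complex x y; Complex x (- y)] <= rs}.
  by move=> t; rewrite !inE => /or3P[] /eqP->//; exact: root_mem fac.
apply: (uniq_leq_size _ sub); rewrite /= !inE !negb_or eq_sym zxi /= !eq_complex /=.
have yN : y != - y by rewrite -subr_eq0 opprK -mulr2n mulrn_eq0.
by rewrite eqxx yN (eq_sym 0) oppr_eq0 (negbTE y0) andbF.
Qed.

(** * The bounds for the initial interval *)

Section Assembly.
Variables (R : realType) (k n : nat) (p : {poly int}) (a0 b0 : rat) (xi : R).
Local Notation P := (map_poly intr p : {poly R}).
Local Notation radius := ((uphalf k)%:R * eps R (up_log 2 n)).
Hypotheses (size_p : size p = n.+1) (kn : (k <= n.+1)%N).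
Hypotheses (iso : isolating p a0 b0 xi) (m1 : mup xi P = 1%N).
Hypotheses (Pa0 : (map_poly intr p).[a0] != 0) (Pb0 : (map_poly intr p).[b0] != 0).

Let size_P : size P = n.+1.
Proof. by rewrite size_map_inj_poly//; exact: intr_inj. Qed.

Let P_neq0 : P != 0. Proof. by rewrite -size_poly_eq0 size_P. Qed.

Lemma degree_gt0 : (0 < n)%N.
Proof.
have [_ Pxi _] := iso; rewrite lt0n; apply/eqP => n0.
have := size_P; rewrite n0 => /eqP/size_poly1P[c c0 PE].
by move: Pxi; rewrite PE rootC (negbTE c0).
Qed.

Lemma initial_valid : valid k n p xi radius (State a0 b0 4) 1.
Proof.
have [xi_in _ uniq_xi] := iso; have n0 := degree_gt0; split=> //=.
split=> //; first exact: grid_radius_le.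
- by move=> d; exact: grid_radius.
apply: simple_root_signs => // y /andP[ay yb] Py; apply: uniq_xi => //.
(* The isolating interval is open; p does not vanish at its end points, so xi is the only root in
   the closed interval as well. *)
have end_ne (c : rat) : (map_poly intr p).[c] != 0 -> y != ratr c.
  apply: contraNneq => yc; move: Py; rewrite yc -map_poly_ratr_int /root horner_ratr.
  by rewrite fmorph_eq0.
by rewrite !lt_neqAle ay yb eq_sym (end_ne _ Pa0) (end_ne _ Pb0).
Qed.

Lemma var_ge_near_roots rs (d : R) : factored P rs xi -> size rs = n ->
  d = Num.min (xi - ratr a0) (ratr b0 - xi) / (16 * n.+3%:R) ->
  (count (near_xi xi d) rs <= var n p a0 b0)%N.
Proof.
move=> [[c c0 pE] _ _] rsn dE; have [/andP[axi xib] _ _] := iso.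
have n16 : 0 < 16 * n.+3%:R :> R by rewrite mulr_gt0.
have dmin : 16 * n.+3%:R * d = Num.min (xi - ratr a0) (ratr b0 - xi).
  by rewrite dE mulrC divfK// lt0r_neq0.
apply: (near_roots_le_var _ _ _ rsn c0 pE).
- by rewrite dE divr_gt0// lt_min !subr_gt0 axi.
- by rewrite dmin ge_min lexx.
- by rewrite dmin ge_min lexx orbT.
Qed.

End Assembly.

Lemma iterations_le (R : realType) : exists C : R, 0 < C /\
  forall (k n tau L : nat) (p : {poly int}) (a0 b0 : rat) (xi : R),
    size p = n.+1 -> (k <= n.+1)%N -> 0 <= a0 -> b0 <= 2 ^+ tau.+1 ->
    isolating p a0 b0 xi -> mup xi (map_poly intr p) = 1%N ->
    (map_poly intr p).[a0] != 0 -> (map_poly intr p).[b0] != 0 ->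
    (0 < tau)%N -> (0 < L)%N ->
  (1 <= var n p a0 b0)%N /\
  forall (ch : nat -> choices k) T F, F 0%N = State a0 b0 4 ->
    continues n (sparse p) (2 ^- L) ch T.+1 0 F ->
    T%:R <= C * ((var n p a0 b0)%:R * (log2 n%:R + log2 (tau + L)%:R)).
Proof.
have [C [C0 total]] := total_time R; exists (22 * C); split; first by rewrite mulr_gt0.
move=> k n tau L p a0 b0 xi size_p kn a00 b0le iso m1 Pa0 Pb0 tau0 L0.
have n0 := degree_gt0 size_p iso; have [/andP[axi xib] _ uniq_xi] := iso.
pose P : {poly R} := map_poly intr p.
have size_P : size P = n.+1 by rewrite size_map_inj_poly//; exact: intr_inj.
have P_neq0 : P != 0 by rewrite -size_poly_eq0 size_P.
have [rs [fac]] := factored_exists P_neq0 m1; rewrite size_P => -[rsn].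
pose d := Num.min (xi - ratr a0) (ratr b0 - xi) / (16 * n.+3%:R).
have V := var_ge_near_roots iso fac rsn (erefl d).
have n16 : 1 <= 16 * n.+3%:R :> R by rewrite -natrM ler1n.
have min0 : 0 < Num.min (xi - ratr a0) (ratr b0 - xi) by rewrite lt_min !subr_gt0 axi.
have d0 : 0 < d by rewrite divr_gt0// (lt_le_trans _ n16).
have dmin : d <= Num.min (xi - ratr a0) (ratr b0 - xi).
  by rewrite ler_pdivrMr ?(lt_le_trans _ n16)// ler_peMr// ltW.
split.
  apply: leq_trans V; rewrite -has_count; apply/hasP.
  exists (real_complex R xi); first exact: root_mem fac.
  by rewrite /near_xi normc_same.
move=> ch T F F0 cont.
have va0 : valid k n p xi ((uphalf k)%:R * eps R (up_log 2 n)) (F 0%N) 1.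
  by rewrite F0; exact: initial_valid.
(* The premise covers T+1 iterations, so that the width after T of them is still at least 2^-L. *)
have cont' : continues n (sparse p) (2 ^- L) ch T 0 F by move=> i iT; apply: cont; apply: ltnW.
have [E [X [S [E1 tr]]]] := continues_trajectory n0 cont' va0; have [ok0 _ _] := va0.
(* The initial width is at most 2^(tau+1) = 2^Y 2^-L, and M bounds the exponents of the speed. Al =
   2^18 n dominates 64000 n, 32 * 2^h <= 64 n and 16(n+3), while its logarithm is only 18 + log
   n. *)
pose Y := (tau.+1 + L)%N; pose M := up_log 2 (2 * Y).
pose Al : R := 2 ^+ 18 * n%:R.
have n1 : 1 <= n%:R :> R by rewrite ler1n.
have A18 : 2 ^+ 18 <= Al by rewrite ler_peMr ?exprn_ge0.
have A256 : 256 * 256 * n%:R <= Al.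
  rewrite ler_wpM2r//; have -> : 256 * 256 = 2 ^+ 16 :> R by ring.
  by rewrite ler_eXn2l// ltr1n.
have lf : large_factor n (up_log 2 n) Al.
  split=> //; first by clear - A256 n1; lra.
  apply: le_trans (_ : 32 * (2 * n%:R) <= _); last by clear - A256 n1; lra.
  by rewrite ler_wpM2l// -natrX -natrM ler_nat exp_up_log_le.
have Aln : 16 * n.+3%:R <= Al.
  apply: le_trans A256; rewrite -!natrM ler_nat -[X in (_ <= X)%N]/(256 * 256 * n)%N.
  by clear - n0; lia.
have wmin i : (i <= T)%N -> 2 ^- L <= ratr (hi (F i)) - ratr (lo (F i)) :> R.
  move=> iT; have [wd _] := cont i iT; move: wd.
  by rewrite -(ler_rat R) rmorphB fmorphV rmorphXn rmorph_nat.
have w0 : ratr (hi (F 0%N)) - ratr (lo (F 0%N)) <= 2 ^+ Y * 2 ^- L :> R.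
  rewrite F0 /= /Y exprD mulfK ?expf_neq0 ?pnatr_eq0//.

  have := b0le; rewrite -(ler_rat R) rmorphXn rmorph_nat.
  by have := a00; rewrite -(ler0q R); clear; lra.
have key : T%:R <= (count (near_xi xi d) rs)%:R * (C * (log2 Al + M%:R)).
  apply: (total P n _ _ _ xi rs Al _ Y M T _ _ E X S d fac rsn lf Aln _ _ _ w0 _ _ tr) => //.
  - by rewrite invr_gt0 exprn_gt0.
  - exact: up_logP.
  - by rewrite F0.
  - move=> z zrs zxi zd; apply: grid_radius_fine kn; rewrite -rsn.
    apply: (near_root_degree fac _ _ uniq_xi zrs zxi zd).
      by apply: le_trans dmin _; rewrite ge_min lexx.
    by apply: le_trans dmin _; rewrite ge_min lexx orbT.
  - by rewrite E1.
have lgn : 0 <= log2 (n%:R : R) by apply: log2_ge0.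
have tL : (2 <= tau + L)%N by clear - tau0 L0; lia.
have lgt : 1 <= log2 ((tau + L)%:R : R).
  apply: le_trans (_ : log2 2 <= _); first by rewrite log2_2.
  by apply: ler_log2; [rewrite ltr0n|rewrite ler_nat].
have MY : M%:R <= 3 + log2 ((tau + L)%:R : R).
  have Y2 : (0 < 2 * Y)%N by rewrite muln_gt0.
  have := log2_up_log R Y2; rewrite -/M.
  have : log2 ((2 * Y)%:R : R) <= log2 (4 * (tau + L)%:R).
    by apply: ler_log2; [rewrite ltr0n|rewrite -natrM ler_nat /Y; clear - tau0 L0; lia].
  have -> : 4 = 2 ^+ 2 :> R by ring.
  rewrite log2M ?exprn_gt0 ?log2_exp2 ?ltr0n//; first by clear; lra.
  by apply: leq_trans tL.
have lgA : log2 Al = 18 + log2 n%:R by rewrite log2M ?exprn_gt0 ?ltr0n// log2_exp2.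
apply: (le_trans key); rewrite lgA.
(* 18 + log n + 3 + log(tau+L) is at most 22 (log n + log(tau+L)), because log(tau+L) >= 1. *)
apply: le_trans (_ : _ <= (var n p a0 b0)%:R * (C * (22 * (log2 n%:R + log2 (tau + L)%:R)))) _.
  apply: ler_pM => //; [|by rewrite ler_nat|].
    by rewrite mulr_ge0 ?(ltW C0)// addr_ge0 ?ler0n// addr_ge0.
  by rewrite ler_pM2l//; clear - lgn lgt MY; lra.
by rewrite le_eqVlt; apply/orP; left; apply/eqP; ring.
Qed.

(* MathComp-Analysis world. *)
Theorem theorem7 (R : realType) :
  exists C : R, 0 < C /\
  forall (k n tau L : nat) (p : {poly int}) (a0 b0 : rat) (xi : R),
    knomial k n tau p -> size p = n.+1 -> (k <= n.+1)%N ->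
    0 <= a0 -> b0 <= 2 ^+ tau.+1 ->
    isolating p a0 b0 xi -> mup xi (map_poly intr p) = 1%N ->
    (map_poly intr p).[a0] != 0 -> (map_poly intr p).[b0] != 0 ->
    (0 < L)%N ->
  forall ch : nat -> choices k, exists (it ops : nat) (o : output),
    [/\ NewRefine n p a0 b0 L ch it ops o,
        correct_output a0 b0 xi L o,
        it%:R <= C * ((var n p a0 b0)%:R *
                      (log2 n%:R + log2 (tau + L)%:R))
      & ops%:R <= C * (k%:R * Num.max 1 (log2 n%:R) * (var n p a0 b0)%:R *
                       (log2 n%:R + log2 (tau + L)%:R))].
Proof.
(* The operation count splits into at most 4 D for computing 2^-L, two per test of the width, and
   1800 k max(1, log n) per iteration. *)
have [C [C0 iters]] := iterations_le R; exists (6 + 2000 * (C + 2)).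
split; first by clear - C0; lra.
move=> k n tau L p a0 b0 xi [_ card coef] size_p kn a00 b0le iso m1 Pa0 Pb0 L0 ch.
(* For tau = 0 all coefficients would be integers of absolute value less than 1, so p = 0. *)
have tau0 : (0 < tau)%N.
  rewrite lt0n; apply/eqP => tau0; have /eqP := size_p; apply/negP.
  suff -> : p = 0 by rewrite size_poly0.
  by apply/polyP => i; rewrite coef0; have := coef i; rewrite tau0 expr0; lia.
have n0 := degree_gt0 size_p iso.
have [V1 time] := iters k n tau L p a0 b0 xi size_p kn a00 b0le iso m1 Pa0 Pb0 tau0 L0.
set V := var n p a0 b0 in V1 time *.
set D := log2 n%:R + log2 (tau + L)%:R in time *.
have D1 : 1 <= D.
  apply: le_trans (_ : log2 2 <= _); first by rewrite log2_2.
  apply: le_trans (_ : log2 (tau + L)%:R <= _).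
    by apply: ler_log2; [rewrite ltr0n|rewrite ler_nat; clear - tau0 L0; lia].
  by rewrite lerDr log2_ge0// ler1n.
have VR1 : 1 <= V%:R :> R by rewrite ler1n.
have VD1 : 1 <= V%:R * D by have := ler_pM ler01 ler01 VR1 D1; rewrite mulr1.
(* Two more than the integer part: with T+1 iterations, T exceeds C V D, which contradicts the
   bound. *)
pose w : rat := 2 ^- L; pose fuel := (Num.truncn (C * (V%:R * D))).+2.
have CVD0 : 0 <= C * (V%:R * D) by rewrite mulr_ge0 ?ltW// (lt_le_trans ltr01).
have [[it [ops [o [r itf]]]]|[F [F0 cont]]] :=
    run_or_continues n (sparse p) w ch fuel 0 (State a0 b0 4); last first.
  have := time ch _ F F0 cont; rewrite leNgt => /negP; case.
  exact: truncnS_gt.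
have itR : it%:R <= (C + 2) * (V%:R * D).
  have h1 : it%:R <= fuel%:R :> R by rewrite ler_nat.
  have h2 : (Num.truncn (C * (V%:R * D)))%:R <= C * (V%:R * D) by rewrite truncn_le.
  by move: h1; rewrite /fuel -!natr1; clear - h2 VD1; lra.
have powE : pow (1 / 2) L = ((pow (1 / 2) L).1, w).
  by rewrite [LHS]surjective_pairing pow_value div1r exprVn.
exists it, ((pow (1 / 2) L).1 + ops)%N, o; split.
- by exists (pow (1 / 2) L).1, w, ops.
- have [_ _ uniq_xi] := iso.
  by apply: (run_correct n0 uniq_xi r (initial_valid size_p kn iso m1 Pa0 Pb0)).
- apply: le_trans itR _; rewrite ler_wpM2r ?(le_trans ler01)//; clear - C0; lra.
have p0 : p != 0 by rewrite -size_poly_eq0 size_p.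
have sz0 : (0 < size (sparse p))%N.
  rewrite size_sparse -has_count; apply/hasP; exists (lead_coef p).
    by rewrite mem_nth// size_p.
  by rewrite lead_coef_eq0.
have szk : (size (sparse p) <= k)%N by rewrite size_sparse.
have low : low_degree (up_log 2 n) (sparse p) by apply: sparse_low_degree; rewrite size_p.
have ops_le := run_cost (fun t st => iteration_cost low st (ch t) sz0) r.
set mx := Num.max 1 _.
have mx1 : 1 <= mx by rewrite le_max lexx.
have hmx : (up_log 2 n).+1%:R <= 3 * mx.
  have : log2 n%:R <= mx by rewrite le_max lexx orbT.
  by have := log2_up_log R n0; rewrite -natr1; clear - mx1; lra.
have kR1 : 1 <= k%:R :> R by rewrite ler1n (leq_trans sz0).
have pow_le : (pow (1 / 2) L).1%:R <= 4 * D.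
  apply: le_trans (_ : (2 * up_log 2 L)%:R <= _).
    by rewrite ler_nat pow_cost// up_logP.
  have h1 := log2_up_log R L0.
  have h2 : log2 (L%:R : R) <= log2 (tau + L)%:R.
    by apply: ler_log2; rewrite ?ltr0n// ler_nat leq_addl.
  have h3 : 0 <= log2 (n%:R : R) by rewrite log2_ge0// ler1n.
  by rewrite natrM; move: h2 h3 D1; rewrite /D; clear - h1; lra.
pose Z := k%:R * mx * V%:R * D.
have km1 : 1 <= k%:R * mx by have := ler_pM ler01 ler01 kR1 mx1; rewrite mulr1.
have ZVD : Z = k%:R * mx * (V%:R * D) by rewrite /Z !mulrA.
have Z1 : 1 <= Z by rewrite ZVD; have := ler_pM ler01 ler01 km1 VD1; rewrite mulr1.
have DZ : D <= Z.
  have kmV1 : 1 <= k%:R * mx * V%:R by have := ler_pM ler01 ler01 km1 VR1; rewrite mulr1.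
  by rewrite ler_peMl// (le_trans ler01).
have VDZ : V%:R * D <= Z by rewrite ZVD ler_peMl// (le_trans ler01).
have itZ : it%:R <= (C + 2) * Z.
  by apply: le_trans itR _; rewrite ler_wpM2l//; clear - C0; lra.
have kitZ : k%:R * mx * it%:R <= (C + 2) * Z.
  rewrite ZVD mulrCA; apply: ler_wpM2l itR.
  by rewrite (le_trans ler01).
have opsR : ops%:R <= 2 * (it%:R + 1) + 600 * (k%:R * (3 * mx)) * it%:R.
  apply: le_trans (_ : (2 * it.+1 + 600 * (k * (up_log 2 n).+1) * it)%:R <= _).
    rewrite ler_nat (leq_trans ops_le)// leq_add2l !leq_mul//.
  rewrite natrD !natrM -[it.+1%:R]natr1 lerD2l ler_wpM2r// ler_wpM2l// ler_wpM2l//.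
rewrite natrD.
have e1 : 600 * (k%:R * (3 * mx)) * it%:R = 1800 * (k%:R * mx * it%:R) by ring.
rewrite e1 in opsR; rewrite -/Z.
have e2 : (6 + 2000 * (C + 2)) * Z = 6 * Z + 2000 * ((C + 2) * Z) by ring.
have CZ0 : 0 <= (C + 2) * Z by rewrite mulr_ge0 ?(le_trans ler01 Z1)//; clear - C0; lra.
by rewrite e2; clear - pow_le DZ opsR itZ kitZ Z1 CZ0; lra.
Qed.
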